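(* Let $\mathcal{H}$ be an infinite-dimensional complex Hilbert space (not assumed separable), and let $\Phi:\mathcal{B}(\mathcal{H})\to\mathcal{B}(\mathcal{H})$ be a bijective linear map. The following are equivalent: (i) For all $T,S\in\mathcal{B}(\mathcal{H})$, $\Phi(T)\sim_u\Phi(S)$ whenever $T\sim_u S$. (ii) For all $T,S\in\mathcal{B}(\mathcal{H})$, $w(\Phi(T))=w(\Phi(S))$ whenever $T\sim_u S$. (iii) There exist a unitary operator $W\in\mathcal{B}(\mathcal{H})$ and a nonzero scalar $c\in\mathbb{C}$ such that either $$\Phi(X)=cWXW^*\qquad\text{for every }X\in\mathcal{B}(\mathcal{H}),$$ or $$\Phi(X)=cWX^{\mathrm{t}}W^*\qquad\text{for every }X\in\mathcal{B}(\mathcal{H}).$$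
   Context: $\mathcal{B}(\mathcal{H})$ is the algebra of all bounded linear operators on $\mathcal{H}$. $T\sim_u S$ (unitarily similar) means $T=WSW^*$ for some unitary $W\in\mathcal{B}(\mathcal{H})$. The numerical radius is $w(T)=\sup\{|\langle Tx,x\rangle|:\|x\|=1\}$. $X^{\mathrm{t}}$ is the transpose of $X$ with respect to a fixed orthonormal basis $(e_i)$ of $\mathcal{H}$, i.e. the bounded operator with $\langle X^{\mathrm{t}}e_j,e_i\rangle=\langle Xe_i,e_j\rangle$ for all $i,j$. The map $\Phi$ is not assumed to be continuous. *)

(* Defs.v *)
From HB Require Import structures.
From mathcomp Require Import all_boot all_order all_algebra.
From mathcomp Require Import complex.
From mathcomp Require Import boolp classical_sets functions reals.
From mathcomp Require Import topology normedtype.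

Set Implicit Arguments.
Unset Strict Implicit.
Unset Printing Implicit Defensive.

Import Order.TTheory GRing.Theory Num.Theory.
Import numFieldNormedType.Exports.

Local Open Scope classical_set_scope.
Local Open Scope ring_scope.
Local Open Scope complex_scope.

(* The inner product is linear in its first argument and conjugate-linear in
   its second one. *)
HB.mixin Record CompleteNormedModule_isHilbert (R : realType) H
    of CompleteNormedModule R[i] H := {
  inner : {dot H for Num.conj};
  inner_norm : forall x : H, `|x| ^+ 2 = inner x x
}.

#[short(type="hilbertType")]
HB.structure Definition Hilbert (R : realType) :=
  {H of CompleteNormedModule R[i] H & CompleteNormedModule_isHilbert R H}.

Definition infinite_dimensional (R : realType) (H : hilbertType R) : Prop :=
  ~ exists (n : nat) (v : 'I_n -> H),
      forall x : H, exists a : 'I_n -> R[i], x = \sum_i a i *: v i.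

Section BoundedOperators.
Variables (R : realType) (H : hilbertType R).

Definition bounded_linear (f : H -> H) : Prop :=
  linear f /\ exists M : R, forall x, `|f x| <= M%:C * `|x|.

Definition is_bounded_linear : {pred H -> H} := fun f => `[< bounded_linear f >].

Record bounded_op := BoundedOp
  { bounded_op_fun :> H -> H ; _ : bounded_op_fun \in is_bounded_linear }.

HB.instance Definition _ := [isSub for bounded_op_fun].
HB.instance Definition _ := [Choice of bounded_op by <:].

Lemma bounded_linearP (f : H -> H) :
  reflect (bounded_linear f) (f \in is_bounded_linear).
Proof. exact: asboolP. Qed.

Lemma bounded_opP (T : bounded_op) : bounded_linear T.
Proof. by apply/bounded_linearP; case: T. Qed.

Lemma bounded_op_ext (S T : bounded_op) : S =1 T -> S = T.
Proof. by move=> ST; apply/val_inj/funext. Qed.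

HB.instance Definition _ (T : bounded_op) :=
  GRing.isLinear.Build R[i] H H *:%R T (proj1 (bounded_opP T)).

Lemma bounded_linear_ge0 (f : H -> H) : bounded_linear f ->
  exists2 M : R, 0 <= M & forall x, `|f x| <= M%:C * `|x|.
Proof.
move=> [_ [M fM]]; exists (Num.max 0 M); first by rewrite le_max lexx.
move=> x; apply: (le_trans (fM x)); apply: ler_wpM2r => //.
by rewrite lecR le_max lexx orbT.
Qed.

Lemma is_bounded_linear_submod_closed : submod_closed is_bounded_linear.
Proof.
split=> [|a f g /bounded_linearP bf /bounded_linearP bg]; apply/bounded_linearP.
  split=> [b x y|]; first by rewrite /= scaler0 addr0.
  by exists 0 => x; rewrite normr0 mul0r.
have [M M0 fM] := bounded_linear_ge0 bf; have [N N0 gN] := bounded_linear_ge0 bg.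
split=> [b x y|].
  rewrite !fctE bf.1 bg.1 !scalerDr !scalerA [b * a]mulrC.
  by rewrite !addrA; congr (_ + _); rewrite -!addrA; congr (_ + _); rewrite addrC.
have [r aE] : exists r : R, `|a| = r%:C.
  by exists (complex.Re `|a|); rewrite RRe_real// normr_real.
exists (r * M + N) => x; apply: (le_trans (ler_normD _ _)).
rewrite normrZ aE rmorphD mulrDl; apply: lerD => //.
by rewrite rmorphM -mulrA ler_wpM2l// -aE.
Qed.

HB.instance Definition _ :=
  GRing.isSubmodClosed.Build R[i] (H -> H) is_bounded_linear
    is_bounded_linear_submod_closed.
HB.instance Definition _ := [SubChoice_isSubLmodule of bounded_op by <:].

Lemma id_bounded_linear : (@idfun H) \in is_bounded_linear.
Proof. by apply/bounded_linearP; split=> //; exists 1 => x; rewrite mul1r. Qed.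

Lemma comp_bounded_linear (S T : bounded_op) :
  (S \o T : H -> H) \in is_bounded_linear.
Proof.
apply/bounded_linearP; split=> [a x y|]; first by rewrite /= !linearP.
have [M M0 SM] := bounded_linear_ge0 (bounded_opP S).
have [N N0 TN] := bounded_linear_ge0 (bounded_opP T).
exists (M * N) => x; apply: (le_trans (SM _)).
by rewrite rmorphM -mulrA ler_wpM2l// lecR.
Qed.

Definition id_op : bounded_op := BoundedOp id_bounded_linear.
Definition comp_op (S T : bounded_op) : bounded_op :=
  BoundedOp (comp_bounded_linear S T).

Lemma comp_opA : associative comp_op.
Proof. by move=> S T U; apply: bounded_op_ext. Qed.
Lemma comp_id_op : left_id id_op comp_op.
Proof. by move=> T; apply: bounded_op_ext. Qed.
Lemma comp_op_id : right_id id_op comp_op.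
Proof. by move=> T; apply: bounded_op_ext. Qed.
Lemma comp_opDl : left_distributive comp_op +%R.
Proof. by move=> S T U; apply: bounded_op_ext. Qed.
Lemma comp_opDr : right_distributive comp_op +%R.
Proof. by move=> S T U; apply: bounded_op_ext => x /=; rewrite raddfD. Qed.

HB.instance Definition _ := GRing.Zmodule_isPzRing.Build bounded_op
  comp_opA comp_id_op comp_op_id comp_opDl comp_opDr.

(* The adjoint exists by the Riesz representation theorem, and is unique, so the
   default value 0 is never used. *)
Definition adjoint (T : bounded_op) : bounded_op :=
  xget 0 [set S : bounded_op | forall x y, inner (T x) y = inner x (S y)].

Definition unitary (W : bounded_op) : Prop :=
  W * adjoint W = 1 /\ adjoint W * W = 1.

Definition unitarily_similar (T S : bounded_op) : Prop :=
  exists2 W, unitary W & T = W * S * adjoint W.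

Definition numerical_radius (T : bounded_op) : R :=
  sup [set ComplexField.Normc.normc (inner (T x) x) | x in [set x : H | `|x| = 1]].

Definition orthonormal_basis (I : choiceType) (e : I -> H) : Prop :=
  (forall i j, inner (e i) (e j) = (i == j)%:R) /\
  dense [set x : H | exists (s : seq I) (a : I -> R[i]),
                       x = \sum_(i <- s) a i *: e i].

(* As for the adjoint, such an operator exists and is unique when e is an
   orthonormal basis. *)
Definition transpose_op (I : choiceType) (e : I -> H) (X : bounded_op) : bounded_op :=
  xget 0 [set Y : bounded_op |
           forall i j, inner (Y (e j)) (e i) = inner (X (e i)) (e j)].

End BoundedOperators.

(* Main.v *)
(** For (ii) => (iii), conjugating by a unitary [V] and transporting along [Phi] gives linear
    bijections [psi V = Phi \o Ad V \o Phi^-1] that are isometric for the numerical radius.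
    The dyad [xx*] exposes the vector state of [x] quantitatively, so [psi V] pulls vector states
    back to unimodular multiples of vector states. As [Phi^-1 1] turns out to be scalar, the
    multiples are [1], and [psi V] is a Jordan *-automorphism. Hence the triple product
    [(A, Z) |-> Phi^-1 (Phi A * Phi Z * Phi A)] commutes with all unitary conjugations, and
    comparing the weights of conjugation by [1 + (mu - 1) xx*] shows
    [Phi (xy* ) * Phi Z * Phi (xy* ) = c <Zx, y> Phi (xy* )] for orthogonal [x], [y], which makes
    [Phi (xy* )] of rank one. Fixing [x] and varying [y], these share their range or their
    corange; up to a transposition they glue to a unitary [U] with [U* Phi(Z) U = l Z + f(Z) 1].
    Finally [f] is a unitarily invariant functional, and it vanishes by a swindle based on
    [H = H (+) H]. *)
Require Import Defs.
From HB Require Import structures.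
From mathcomp Require Import all_boot all_order all_algebra.
From mathcomp Require Import complex.
From mathcomp Require Import boolp classical_sets functions cardinality reals topology normedtype.
From mathcomp Require Import ring lra.

Set Implicit Arguments.
Unset Strict Implicit.
Unset Printing Implicit Defensive.

Import Order.TTheory GRing.Theory Num.Theory.
Import numFieldNormedType.Exports.
Local Open Scope classical_set_scope.
Local Open Scope ring_scope.
Local Open Scope complex_scope.

(** In finite dimension the maps [X |-> l X + tr(X) 1] also preserve unitary similarity, so the term
    [f(Z) 1] can only be excluded by an argument that fails there: this is why the proof cannot stop
    at [l Z + f(Z) 1]. A supremum [w(T)] need not be attained, and the dual of B(H) contains many
    states that are not vector states; hence exposedness is proved with explicit constants, for
    functionals that almost attain their norm at xx*, and vector states are recovered as norm
    limits. Conjugations by unitaries are the only symmetry given. Conjugation by the reflection 1 +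
    (mu - 1) xx* has the weights 1, mu and conj mu only. An equivariant expression of degree two or
    three in operators of known weight therefore vanishes when its weight is mu^2 or mu^3, and is
    confined to one block when its weight is mu or conj mu; this is how equivariance becomes an
    algebraic identity. *)

Local Notation "''[' u , v ]" := (inner u v).
Local Notation normc := ComplexField.Normc.normc.

(** * Complex scalars and the reflection parameter [mu] *)

Section Scalars.
Variable R : realType.
Implicit Types z w : R[i].

Lemma normcE z : `|z| = (normc z)%:C. Proof. by []. Qed.
Lemma normc_ge0 z : 0 <= normc z.
Proof. by rewrite -(lecR 0) -normcE normr_ge0. Qed.
Lemma conjE z : Num.conj z = z^*. Proof. by []. Qed.
Lemma normc_sq z : (normc z ^+ 2)%:C = z * Num.conj z.
Proof. by rewrite rmorphXn /= -normcE normCK. Qed.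
Lemma normc_sqE z : normc z ^+ 2 = complex.Re z ^+ 2 + complex.Im z ^+ 2.
Proof. by case: z => a b /=; rewrite sqr_sqrtr // addr_ge0 ?sqr_ge0. Qed.
Lemma normc_conj z : normc (Num.conj z) = normc z.
Proof. by apply: complexI; rewrite -!normcE norm_conjC. Qed.
Lemma normcM z w : normc (z * w) = normc z * normc w.
Proof. exact: ComplexField.Normc.normcM. Qed.
Lemma normcD z w : normc (z + w) <= normc z + normc w.
Proof. by rewrite -lecR rmorphD /= -!normcE ler_normD. Qed.
Lemma normc_real (a : R) : normc a%:C = `|a|.
Proof. by rewrite /= expr0n /= addr0 sqrtr_sqr. Qed.
Lemma Re_le_normc z : `|complex.Re z| <= normc z.
Proof. by rewrite -lecR; apply: normc_ge_Re. Qed.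
Lemma normc_eq0 z : (normc z == 0) = (z == 0).
Proof. by rewrite -(inj_eq (@complexI R)) -normcE normr_eq0. Qed.
Lemma normc1 : normc (1 : R[i]) = 1.
Proof. by rewrite -[1 in LHS]/(1%:C) normc_real normr1. Qed.
Lemma normc0 : normc (0 : R[i]) = 0.
Proof. by rewrite -[0 in LHS]/(0%:C) normc_real normr0. Qed.
Lemma normcN z : normc (- z) = normc z.
Proof. by apply: complexI; rewrite -!normcE normrN. Qed.
Lemma normcV z : normc z^-1 = (normc z)^-1.
Proof. exact: ComplexField.Normc.normcV. Qed.
Lemma RImE z : z = (complex.Re z)%:C + 'i * (complex.Im z)%:C.
Proof. exact: complexE. Qed.
Lemma ReD z w : complex.Re (z + w) = complex.Re z + complex.Re w.
Proof. by case: z w => [a b] [c d]. Qed.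
Lemma ReN z : complex.Re (- z) = - complex.Re z.
Proof. by case: z. Qed.
Lemma ReM z w : complex.Re (z * w) = complex.Re z * complex.Re w - complex.Im z * complex.Im w.
Proof. by case: z w => [a b] [c d]. Qed.
Lemma ImM z w : complex.Im (z * w) = complex.Re z * complex.Im w + complex.Im z * complex.Re w.
Proof. by case: z w => [a b] [c d]. Qed.
Lemma ReC z : complex.Re (Num.conj z) = complex.Re z.
Proof. by case: z. Qed.
Lemma ImC z : complex.Im (Num.conj z) = - complex.Im z.
Proof. by case: z. Qed.
Lemma ReZ (a : R) z : complex.Re (a%:C * z) = a * complex.Re z.
Proof. by rewrite ReM /= mul0r subr0. Qed.

Definition ii : R[i] := Complex 0 1.
Lemma ii_sq : ii * ii = -1. Proof. by rewrite -expr2 sqr_i. Qed.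
Lemma ii_conj : Num.conj ii = - ii. Proof. by rewrite conjE /ii; simpc. Qed.
Lemma normc_ii : normc ii = 1. Proof. by rewrite /= expr0n /= add0r expr1n sqrtr1. Qed.

Lemma phase z : exists2 u, normc u = 1 & u * z = (normc z)%:C.
Proof.
have [->|z0] := eqVneq z 0.
  by exists 1; rewrite ?normc1// mulr0 -normcE normr0.
exists (Num.conj z / (normc z)%:C).
  by rewrite normcM normcV normc_conj normc_real ger0_norm ?normc_ge0// divff// normc_eq0.
rewrite mulrAC [_ * z]mulrC -normc_sq rmorphXn /= expr2 mulfK//.
by rewrite -normcE normr_eq0.
Qed.

(* Not a root of unity: the weights [1, mu, mu^-1] of conjugation by a reflection are far
   enough apart for [mu^2] and [mu^3] not to be weights. *)
Definition mu : R[i] := (3 / 5) +i* (4 / 5).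

Lemma mu_mul : mu * mu = (- 7 / 25) +i* (24 / 25).
Proof. by rewrite /mu; apply/eqP; rewrite eq_complex /=; apply/andP; split; apply/eqP; field. Qed.
Lemma mu_mul3 : mu * mu * mu = (- 117 / 125) +i* (44 / 125).
Proof.
by rewrite mu_mul /mu; apply/eqP; rewrite eq_complex /=; apply/andP; split; apply/eqP; field.
Qed.
Lemma normc_mu : normc mu = 1.
Proof.
apply/eqP; by rewrite -(@eqrXn2 _ 2) ?normc_ge0// normc_sqE /= expr1n; apply/eqP; field.
Qed.
Lemma neq_complex_Re (a b c d : R) : a < c -> a +i* b <> c +i* d.
Proof. by move=> ac [e _]; rewrite e ltxx in ac. Qed.
Lemma neq_complex_Im (a b c d : R) : d < b -> a +i* b <> c +i* d.
Proof. by move=> ac [_ e]; rewrite e ltxx in ac. Qed.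
Lemma mu_neq1 : mu <> 1. Proof. by apply: neq_complex_Re; lra. Qed.
Lemma mu_neqC : mu <> Num.conj mu. Proof. by apply: neq_complex_Im => /=; lra. Qed.
Lemma mu2_neq : [/\ mu * mu <> 1, mu * mu <> mu & mu * mu <> Num.conj mu].
Proof. by rewrite mu_mul; split; apply: neq_complex_Re; lra. Qed.
Lemma mu3_neq : [/\ mu * mu * mu <> 1, mu * mu * mu <> mu & mu * mu * mu <> Num.conj mu].
Proof. by rewrite mu_mul3; split; apply: neq_complex_Re; lra. Qed.
End Scalars.
Arguments ii {R}.
Arguments mu {R}.

(** * Inner product and real-valued norm *)

Section Vectors.
Variables (R : realType) (H : hilbertType R).
Local Notation C := R[i].
Implicit Types (x y z u v : H) (a b c : C).

Lemma inDl x y z : '[x + y, z] = '[x, z] + '[y, z].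
Proof. by rewrite linearDl. Qed.
Lemma inDr x y z : '[z, x + y] = '[z, x] + '[z, y].
Proof. by rewrite linearDr. Qed.
Lemma inZl a x y : '[a *: x, y] = a * '[x, y].
Proof. by rewrite linearZl_LR. Qed.
Lemma inZr a x y : '[x, a *: y] = Num.conj a * '[x, y].
Proof. by rewrite linearZr. Qed.
Lemma in0l x : '[0, x] = 0. Proof. by rewrite linear0l. Qed.
Lemma in0r x : '[x, 0] = 0. Proof. by rewrite linear0r. Qed.
Lemma inNl x y : '[- x, y] = - '[x, y]. Proof. by rewrite linearNl. Qed.
Lemma inNr x y : '[x, - y] = - '[x, y]. Proof. by rewrite linearNr. Qed.
Lemma inBl x y z : '[x - y, z] = '[x, z] - '[y, z].
Proof. by rewrite inDl inNl. Qed.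
Lemma inBr x y z : '[z, x - y] = '[z, x] - '[z, y].
Proof. by rewrite inDr inNr. Qed.
Lemma inC x y : '[y, x] = Num.conj '[x, y].
Proof. by rewrite (hermC (@inner R H)) expr0 mul1r. Qed.
Lemma orthC x y : '[x, y] = 0 -> '[y, x] = 0.
Proof. by rewrite [in X in _ -> X]inC => ->; rewrite rmorph0. Qed.

Definition ipE := (inDl, inDr, inZl, inZr, inNl, inNr).

(* The library norm of a complex normed module takes values in [R[i]]. *)
Definition nm x : R := complex.Re `|x|.
Lemma nmE x : `|x| = (nm x)%:C.
Proof. by rewrite /nm RRe_real// normr_real. Qed.
Lemma nm_ge0 x : 0 <= nm x.
Proof. by rewrite -(lecR 0) -nmE normr_ge0. Qed.
Lemma nm_sqC x : '[x, x] = (nm x ^+ 2)%:C.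
Proof. by rewrite rmorphXn /= -nmE inner_norm. Qed.
Lemma nm_sq x : nm x ^+ 2 = complex.Re '[x, x].
Proof. by rewrite nm_sqC. Qed.
Lemma nm_eq0 x : (nm x == 0) = (x == 0).
Proof. by rewrite -(inj_eq (@complexI R)) -nmE normr_eq0. Qed.
Lemma nm_gt0 x : (0 < nm x) = (x != 0).
Proof. by rewrite lt_def nm_eq0 nm_ge0 andbT. Qed.
Lemma nm0 : nm 0 = 0. Proof. by apply/eqP; rewrite nm_eq0. Qed.
Lemma nmZ a x : nm (a *: x) = normc a * nm x.
Proof. by apply: complexI; rewrite -nmE normrZ nmE normcE rmorphM. Qed.
Lemma nmN x : nm (- x) = nm x.
Proof. by apply: complexI; rewrite -!nmE normrN. Qed.
Lemma nmD x y : nm (x + y) <= nm x + nm y.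
Proof. by rewrite -lecR rmorphD /= -!nmE ler_normD. Qed.
Lemma nmBC x y : nm (x - y) = nm (y - x).
Proof. by rewrite -nmN opprB. Qed.
Lemma in_eq0 x : '[x, x] = 0 -> x = 0.
Proof.
rewrite nm_sqC => /eqP; rewrite -[0]/(0%:C) (inj_eq (@complexI R)).
by rewrite expf_eq0 /= nm_eq0 => /eqP.
Qed.
Lemma nm1_in x : nm x = 1 -> '[x, x] = 1.
Proof. by move=> x1; rewrite nm_sqC x1 expr1n. Qed.
Lemma nm1P x : '[x, x] = 1 -> nm x = 1.
Proof.
move=> /(congr1 (@complex.Re R)); rewrite -nm_sq /= => /eqP.
by rewrite sqrp_eq1 ?nm_ge0// => /eqP.
Qed.
Lemma nm1_neq0 x : nm x = 1 -> x != 0.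
Proof. by rewrite -nm_gt0 => ->. Qed.
Lemma nm_norm1 x : (`|x| = 1) <-> nm x = 1.
Proof. by rewrite nmE; split=> [[]//|->]. Qed.

Lemma nmD_sq x y : nm (x + y) ^+ 2 = nm x ^+ 2 + nm y ^+ 2 + complex.Re '[x, y] *+ 2.
Proof.
rewrite !nm_sq !ipE [in '[y, x]]inC !ReD ReC; ring.
Qed.
Lemma pythagoras x y : '[x, y] = 0 -> nm (x + y) ^+ 2 = nm x ^+ 2 + nm y ^+ 2.
Proof. by move=> xy; rewrite nmD_sq xy mul0rn addr0. Qed.
Lemma parallelogram x y :
  nm (x + y) ^+ 2 + nm (x - y) ^+ 2 = (nm x ^+ 2 + nm y ^+ 2) *+ 2.
Proof. by rewrite !nmD_sq inNr nmN ReN; ring. Qed.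

Lemma CauchySchwarz x y : normc '[x, y] <= nm x * nm y.
Proof.
have [->|y0] := eqVneq y 0.
  by rewrite in0r nm0 mulr0 -[0]/(0%:C) normc_real normr0.
have yp : 0 < nm y by rewrite nm_gt0.
pose a := '[x, y] / '[y, y].
have : 0 <= nm (x - a *: y) ^+ 2 by rewrite sqr_ge0.
rewrite nmD_sq nmN nmZ inNr inZr.
have -> : complex.Re (- (Num.conj a * '[x, y])) = - (normc '[x,y] ^+ 2 / nm y ^+ 2).
  rewrite ReN; congr (- _).
  rewrite /a rmorphM fmorphV /= mulrAC [_ * '[x, y]]mulrC -normc_sq -inC nm_sqC.
  by rewrite -fmorphV -rmorphM.
rewrite /a normcM normcV nm_sqC normc_real ger0_norm ?sqr_ge0//.
set n := normc _; set s := nm y; move=> h.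
have : n ^+ 2 <= (nm x * s) ^+ 2.
  have -> : (nm x * s) ^+ 2 =
      n ^+ 2 + s ^+ 2 * (nm x ^+ 2 + (n / s ^+ 2 * s) ^+ 2 + - (n ^+ 2 / s ^+ 2) *+ 2).
    by field; rewrite gt_eqF.
  by rewrite lerDl mulr_ge0// sqr_ge0.
by rewrite ler_sqr// nnegrE ?mulr_ge0 ?nm_ge0 ?normc_ge0.
Qed.

(** The library norm and its balls have radii in [R[i]]; a positive complex radius is real, which
    brings completeness back to real tolerances. *)
Lemma hilbert_complete (s : nat -> H) :
  (forall e : R, 0 < e -> exists N, forall n m, (N <= n)%N -> (N <= m)%N -> nm (s n - s m) <= e) ->
  exists l, forall e : R, 0 < e -> exists N, forall n, (N <= n)%N -> nm (s n - l) <= e.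
Proof.
move=> cs.
have : cvg (s @ \oo).
  apply/cauchy_cvgP/cauchy_ballP => e e0.
  have [r er] : exists r : R, e = r%:C by exists (complex.Re e); rewrite RRe_real// gtr0_real.
  have r0 : 0 < r by rewrite -ltcR -er.
  have [N sN] := cs (r / 2) (divr_gt0 r0 (ltr0Sn _ _)).
  exists (s @` [set n | (N <= n)%N], s @` [set n | (N <= n)%N]).
    by split; exists N => // n Nn; exists n.
  move=> [_ _] /= [[n Nn <-] [m Nm <-]]; rewrite -ball_normE /ball_ /= nmE er ltcR.
  by rewrite (le_lt_trans (sN _ _ Nn Nm))// ltr_pdivrMr// mulr2n mulrDr mulr1 ltrDl.
move=> /cvg_ex[l sl]; exists l => e e0.
have e0' : 0 < (e%:C : C) by rewrite ltcR.
have [N _ sN] := (@cvgrPdist_le _ _ _ _ _ _ _).1 sl _ e0'.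
exists N => n Nn; have := sN n Nn; rewrite /= nmE lecR nmBC//.
Qed.

Lemma nm_eps0 x : (forall e : R, 0 < e -> nm x <= e) -> x = 0.
Proof.
move=> h; apply/eqP; rewrite -nm_eq0 eq_le nm_ge0 andbT; apply/ler_addgt0Pl => e e0.
by rewrite addr0 h.
Qed.

End Vectors.

(** * Limit arguments and Riesz representation *)

Section Riesz.
Variable (R : realType).

Lemma eps0 (x K : R) : (forall e, 0 < e -> `|x| <= e * K) -> x = 0.
Proof.
move=> h; apply/eqP; rewrite -normr_eq0; apply/negPn/negP => x0.
have xp : 0 < `|x| by rewrite lt_def x0 normr_ge0.
have K0 : 0 < K by have := h 1 ltr01; rewrite mul1r; apply: lt_le_trans.
have := h (`|x| / (K *+ 2)) (divr_gt0 xp _); rewrite mulrn_wgt0// => /(_ isT).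
have -> : `|x| / (K *+ 2) * K = `|x| / 2 by field; rewrite gt_eqF.
by move=> ?; lra.
Qed.

Lemma eps_le (x y K : R) : (forall e, 0 < e -> x <= y + e * K) -> x <= y.
Proof.
move=> h; rewrite leNgt; apply/negP => yx.
have K0 : 0 < K by have := h 1 ltr01; lra.
have := h ((x - y) / (K *+ 2)) (divr_gt0 _ _); rewrite subr_gt0 yx mulrn_wgt0// => /(_ isT isT).
have -> : (x - y) / (K *+ 2) * K = (x - y) / 2 by field; rewrite gt_eqF.
by move=> ?; lra.
Qed.

Lemma ex_invn_le (e : R) : 0 < e -> exists N, forall n, (N <= n)%N -> n.+1%:R^-1 <= e.
Proof.
move=> e0; exists (Num.truncn e^-1) => n Nn.
rewrite -[e]invrK lef_pV2 ?posrE ?invr_gt0 ?ltr0n//.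
apply/ltW/(lt_le_trans (truncnS_gt _)).
by rewrite ler_nat.
Qed.

Variable H : hilbertType R.
Local Notation C := R[i].

Lemma in_inj (y z : H) : (forall x, '[x, y] = '[x, z]) -> y = z.
Proof.
move=> h; apply/eqP; rewrite -subr_eq0; apply/eqP/in_eq0.
by rewrite inBr h subrr.
Qed.

Lemma in_injl (y z : H) : (forall x, '[y, x] = '[z, x]) -> y = z.
Proof. by move=> h; apply: in_inj => x; rewrite !(inC _ x) h. Qed.

(** Completing the square shows that the representing vector minimizes [J]. A minimizing sequence is
    Cauchy by the parallelogram law, and varying it along [h] identifies the real part of [f h]. *)
Lemma riesz (f : H -> C) (M : R) : scalar f ->
  (forall x, normc (f x) <= M * nm x) -> exists z, forall x, f x = '[x, z].
Proof.
move=> lf bf.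
have fD x y : f (x + y) = f x + f y by exact: (GRing.semilinear_linear lf).2.
have f0 : f 0 = 0 by apply: (addrI (f 0)); rewrite -fD !addr0.
have fZ a x : f (a *: x) = a * f x by exact: GRing.scalable_linear.
pose J x := nm x ^+ 2 - complex.Re (f x) *+ 2.
have Jlb x : - M ^+ 2 <= J x.
  have h1 := bf x; have h2 := Re_le_normc (f x); have h3 := nm_ge0 x.
  have h4 : complex.Re (f x) <= M * nm x.
    by apply: le_trans h1; apply: le_trans h2; apply: ler_norm.
  have := sqr_ge0 (nm x - M); rewrite /J sqrrB; lra.
have hinf : has_inf (range J).
  split; first by exists (J 0); exists 0.
  by exists (- M ^+ 2) => _ [x _ <-].
pose m := inf (range J).
have mJ x : m <= J x by apply: ge_inf; [exact: hinf.2 | exists x].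
have exs n : exists x, J x <= m + n.+1%:R^-1.
  have n0 : 0 < n.+1%:R^-1 :> R by rewrite invr_gt0 ltr0n.
  have [_ [x _ <-] h] := inf_adherent n0 hinf.
  by exists x; apply: ltW.
have [s sP] := choice exs.
have sq_le n k : nm (s n - s k) ^+ 2 <= (n.+1%:R^-1 + k.+1%:R^-1) *+ 2.
  move: (mJ (2^-1%:C *: (s n + s k))) (sP n) (sP k); rewrite /J.
  rewrite fZ fD ReZ ReD nmZ normc_real ger0_norm ?invr_ge0// exprMn.
  have := parallelogram (s n) (s k).
  set p := nm (s n + s k) ^+ 2; have -> : 2^-1 ^+ 2 * p = p / 4 by field.
  have aux (q d a b fa fb t e1 e2 : R) : q + d = (a + b) *+ 2 ->
    t <= q / 4 - 2^-1 * (fa + fb) *+ 2 -> a - fa *+ 2 <= t + e1 ->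
    b - fb *+ 2 <= t + e2 -> d <= (e1 + e2) *+ 2 by move=> *; lra.
  exact: aux.
have [l lP] : exists l, forall e : R, 0 < e -> exists N, forall n, (N <= n)%N -> nm (s n - l) <= e.
  apply: hilbert_complete => e e0.
  have [N NP] := @ex_invn_le (e ^+ 2 / 4) (divr_gt0 (exprn_gt0 2 e0) (ltr0Sn _ _)).
  exists N => n k /NP h1 /NP h2; rewrite -ler_sqr ?nnegrE ?nm_ge0 ?(ltW e0)//.
  apply: (le_trans (sq_le n k)); move: h1 h2; set e1 := n.+1%:R^-1; set e2 := k.+1%:R^-1.
  by move=> h1 h2; lra.
have main h : complex.Re '[h, l] = complex.Re (f h).
  have [->|h0] := eqVneq h 0; first by rewrite in0l f0.
  have hp : 0 < nm h by rewrite nm_gt0.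
  apply/eqP; rewrite -subr_eq0; apply/eqP/(@eps0 _ (nm h *+ 2)) => e e0.
  have [N1 N1P] := @ex_invn_le (e ^+ 2) (exprn_gt0 2 e0).
  have [N2 N2P] := lP e e0.
  pose n := maxn N1 N2.
  have := N1P n (leq_maxl _ _); have := N2P n (leq_maxr _ _).
  set d := n.+1%:R^-1 => h2 h1.
  pose D := complex.Re '[s n, h] - complex.Re (f h).
  have hD : D ^+ 2 <= (e * nm h) ^+ 2.
    (* The coefficient [- D / nm h ^+ 2] minimizes [J] on the line through [s n] in direction [h].
       The decrease, [D ^+ 2 / nm h ^+ 2], cannot exceed the gap between [J (s n)] and the infimum,
       which is at most [d]. *)
    have := mJ (s n + (- D / nm h ^+ 2)%:C *: h); have := sP n.
    rewrite /J fD fZ ReD ReZ nmD_sq inZr conjE conjc_real ReZ nmZ normc_real.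
    rewrite exprMn real_normK ?num_real// -/d.
    set q := nm h ^+ 2; have q0 : 0 < q by rewrite exprn_gt0.
    have -> : (- D / q) ^+ 2 * q = D ^+ 2 / q by field; rewrite gt_eqF.
    have -> : complex.Re '[s n, h] = D + complex.Re (f h) by rewrite /D; ring.
    move=> a1 a2; have : D ^+ 2 / q <= d.
      have : - D / q * (D + complex.Re (f h)) = - (D ^+ 2 / q) + - D / q * complex.Re (f h) by ring.
      lra.
    rewrite ler_pdivrMr// exprMn -/q => h3; apply: (le_trans h3).
    by rewrite ler_wpM2r// ltW.
  rewrite -(real_normK (num_real D)) ler_sqr ?nnegrE// ?mulr_ge0 ?(ltW e0) ?nm_ge0// in hD.
  have -> : complex.Re '[h, l] - complex.Re (f h) = D - complex.Re '[s n - l, h].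
    by rewrite (inC l h) ReC inBl ReD ReN /D; ring.
  apply: (le_trans (ler_normB _ _)).
  have := Re_le_normc '[s n - l, h]; have := CauchySchwarz (s n - l) h.
  have : nm (s n - l) * nm h <= e * nm h by rewrite ler_wpM2r// ltW.
  by move: hD; lra.
(* The real part of [f (ii *: x)] is minus the imaginary part of [f x], so real parts suffice. *)
exists l => x; have := main x; have := main (ii *: x).
rewrite fZ inZl !ReM /= !mul0r !mul1r !sub0r => /oppr_inj h1 h2.
by rewrite [LHS]RImE [RHS]RImE h1 h2.
Qed.
End Riesz.

Lemma scaler_half (R : realType) (V : lmodType R[i]) (x : V) : x = 2^-1 *: (x + x).
Proof. by rewrite -mulr2n -(scaler_nat 2 x) scalerA mulVf ?scale1r// pnatr_eq0. Qed.

Lemma mulr2n_inj (R : realType) (V : lmodType R[i]) (x y : V) : x *+ 2 = y *+ 2 -> x = y.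
Proof. by move=> e; rewrite [LHS]scaler_half [RHS]scaler_half -!mulr2n e. Qed.

(** * Bounded operators, adjoints and rank-one operators *)

Section Operators.
Variables (R : realType) (H : hilbertType R).
Local Notation C := R[i].
Local Notation B := (bounded_op H).
Implicit Types (x y z u v : H) (a b c : C) (S T X : B).

Lemma nm_bounded (f : H -> H) : linear f -> (exists M, forall x, nm (f x) <= M * nm x) ->
  f \in @is_bounded_linear R H.
Proof.
move=> lf [M bM]; apply/bounded_linearP; split=> //; exists M => x.
by rewrite !nmE -rmorphM lecR.
Qed.

Lemma op_bound T : exists2 M, 0 < M & forall x, nm (T x) <= M * nm x.
Proof.
have [M M0 bM] := bounded_linear_ge0 (bounded_opP T).
exists (M + 1); first by rewrite ltr_wpDl.
move=> x; have := bM x; rewrite !nmE -rmorphM lecR => /le_trans; apply.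
by rewrite ler_wpM2r ?nm_ge0// lerDl.
Qed.

Lemma opDE S T x : (S + T) x = S x + T x. Proof. by []. Qed.
Lemma opNE T x : (- T) x = - T x. Proof. by []. Qed.
Lemma opZE a T x : (a *: T) x = a *: T x. Proof. by []. Qed.
Lemma opME S T x : (S * T) x = S (T x). Proof. by []. Qed.
Lemma op1E x : (1 : B) x = x. Proof. by []. Qed.
Lemma op0E x : (0 : B) x = 0. Proof. by []. Qed.
Definition opE := (opDE, opNE, opZE, opME, op1E, op0E).

Lemma mapD T x y : T (x + y) = T x + T y. Proof. exact: linearD. Qed.
Lemma mapZ T a x : T (a *: x) = a *: T x. Proof. exact: linearZ. Qed.
Lemma mapN T x : T (- x) = - T x. Proof. exact: linearN. Qed.
Lemma mapB T x y : T (x - y) = T x - T y. Proof. exact: linearB. Qed.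
Lemma map0 T : T 0 = 0. Proof. exact: linear0. Qed.
Definition mapE := (mapD, mapZ, mapN, map0).

Lemma opZMl a S T : (a *: S) * T = a *: (S * T).
Proof. exact: bounded_op_ext. Qed.
Lemma opZMr a S T : S * (a *: T) = a *: (S * T).
Proof. by apply: bounded_op_ext => x; rewrite !opE linearZ. Qed.

Lemma adjoint_exists T : exists S : B, forall x y, '[T x, y] = '[x, S y].
Proof.
have [M M0 bM] := op_bound T.
have ex y : exists z, forall x, '[T x, y] = '[x, z].
  apply: (@riesz _ _ (fun x => '[T x, y]) (M * nm y)) => [a x z|x].
    by rewrite linearP !ipE.
  apply: (le_trans (CauchySchwarz _ _)).
  by rewrite mulrAC ler_wpM2r ?nm_ge0.
have [f fP] := choice ex.
have lf : linear f.
  move=> a x y; apply: in_inj => z.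
  by rewrite -fP !ipE -!fP.
have bf : exists M, forall x, nm (f x) <= M * nm x.
  exists M => x; have [->|fx] := eqVneq (f x) 0.
    by rewrite nm0 mulr_ge0 ?nm_ge0// ltW.
  have fp : 0 < nm (f x) by rewrite nm_gt0.
  (* ['[f x, f x] = '[T (f x), x]], so the bound on [T] passes to [f]. *)
  rewrite -(ler_pM2r fp) -expr2 nm_sq -fP.
  apply: (le_trans (ler_norm _)); apply: (le_trans (Re_le_normc _)).
  apply: (le_trans (CauchySchwarz _ _)).
  by rewrite mulrAC ler_wpM2r ?nm_ge0.
by exists (BoundedOp (nm_bounded lf bf)) => x y; rewrite fP.
Qed.

Lemma adjE T x y : '[T x, y] = '[x, adjoint T y].
Proof.
rewrite /adjoint; case: xgetP => [S _ ->//|h]; have [S SP] := adjoint_exists T.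
by case: (h S).
Qed.
Lemma adjEr T x y : '[x, T y] = '[adjoint T x, y].
Proof. by rewrite inC adjE -inC. Qed.

Lemma adj_uniq T S : (forall x y, '[T x, y] = '[x, S y]) -> adjoint T = S.
Proof.
move=> h; apply: bounded_op_ext => y; apply: in_inj => x.
by rewrite -adjE h.
Qed.
Lemma adjK T : adjoint (adjoint T) = T.
Proof. by apply: adj_uniq => x y; rewrite -adjEr. Qed.
Lemma adjD S T : adjoint (S + T) = adjoint S + adjoint T.
Proof. by apply: adj_uniq => x y; rewrite !opE !ipE !adjE. Qed.
Lemma adjN T : adjoint (- T) = - adjoint T.
Proof. by apply: adj_uniq => x y; rewrite !opE !ipE !adjE. Qed.
Lemma adjZ a T : adjoint (a *: T) = Num.conj a *: adjoint T.
Proof. by apply: adj_uniq => x y; rewrite !opE !ipE conjCK !adjE. Qed.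
Lemma adjM S T : adjoint (S * T) = adjoint T * adjoint S.
Proof. by apply: adj_uniq => x y; rewrite !opE !adjE. Qed.
Lemma adj0 : adjoint (0 : B) = 0.
Proof. by apply: adj_uniq => x y; rewrite !op0E in0l in0r. Qed.
Lemma adj1 : adjoint (1 : B) = 1.
Proof. exact: adj_uniq. Qed.

Lemma op_eq S T : (forall x y, '[S x, y] = '[T x, y]) -> S = T.
Proof. by move=> h; apply: bounded_op_ext => x; apply: in_injl. Qed.

(** Polarization: summing the form at [x + t *: y] over the fourth roots of unity [t], with weight
    [t], isolates the coefficient of the conjugate of [t]. *)
Lemma form4 T x y : 4 * '[T x, y] =
  '[T (x + y), x + y] - '[T (x - y), x - y]
  + ii * '[T (x + ii *: y), x + ii *: y] - ii * '[T (x - ii *: y), x - ii *: y].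
Proof.
have e (t : C) : '[T (x + t *: y), x + t *: y] =
    '[T x, x] + t * '[T y, x] + Num.conj t * '[T x, y] + t * Num.conj t * '[T y, y].
  by rewrite !mapE !ipE; ring.
have -> : x + y = x + 1 *: y by rewrite scale1r.
have -> : x - y = x + (-1) *: y by rewrite scaleN1r.
have -> : x - ii *: y = x + (- ii) *: y by rewrite scaleNr.
rewrite !e !(rmorphN, rmorph1) /= !ii_conj.
have := @ii_sq R; set i := ii => i2.
set p := '[T x, x]; set q := '[T y, x]; set r := '[T x, y]; set s := '[T y, y].
rewrite -addrA -mulrBr; clearbody p q r s i.
have -> : p + i * q + - i * r + i * - i * s -
   (p + - i * q + - - i * r + - i * - - i * s) = i * (2 * q - 2 * r) by ring.
by rewrite mulrA i2; ring.
Qed.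

Lemma form_eq S T : (forall x, '[S x, x] = '[T x, x]) -> S = T.
Proof.
move=> h; apply: op_eq => x y.
by apply: (@mulfI _ 4); rewrite ?pnatr_eq0// !form4 !h.
Qed.

(** This is the rank-one operator written xy* in the overview. *)
Definition dyad_fun x y : H -> H := fun h => '[h, y] *: x.
Lemma dyad_subproof x y : dyad_fun x y \in @is_bounded_linear R H.
Proof.
apply: nm_bounded => [a u v|]; first by rewrite /dyad_fun !ipE scalerDl scalerA.
exists (nm y * nm x) => h; rewrite nmZ mulrAC ler_wpM2r ?nm_ge0// mulrC.
exact: CauchySchwarz.
Qed.
Definition dyad x y : B := BoundedOp (dyad_subproof x y).

Lemma dyadE x y h : dyad x y h = '[h, y] *: x. Proof. by []. Qed.
Lemma dyadDl x x' y : dyad (x + x') y = dyad x y + dyad x' y.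
Proof. by apply: bounded_op_ext => h; rewrite !opE !dyadE scalerDr. Qed.
Lemma dyadDr x y y' : dyad x (y + y') = dyad x y + dyad x y'.
Proof. by apply: bounded_op_ext => h; rewrite !opE !dyadE inDr scalerDl. Qed.
Lemma dyadZl a x y : dyad (a *: x) y = a *: dyad x y.
Proof. by apply: bounded_op_ext => h; rewrite !opE !dyadE !scalerA mulrC. Qed.
Lemma dyadZr a x y : dyad x (a *: y) = Num.conj a *: dyad x y.
Proof. by apply: bounded_op_ext => h; rewrite !opE !dyadE inZr scalerA. Qed.
Lemma dyad0r x : dyad x 0 = 0.
Proof. by apply: bounded_op_ext => h; rewrite dyadE in0r scale0r. Qed.
Lemma dyad0l x : dyad 0 x = 0.
Proof. by apply: bounded_op_ext => h; rewrite dyadE scaler0. Qed.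
Lemma adj_dyad x y : adjoint (dyad x y) = dyad y x.
Proof. by apply: adj_uniq => u v; rewrite !dyadE !ipE -inC mulrC. Qed.
Lemma mul_op_dyad T x y : T * dyad x y = dyad (T x) y.
Proof. by apply: bounded_op_ext => h; rewrite !opE !dyadE linearZ. Qed.
Lemma mul_dyad_op T x y : dyad x y * T = dyad x (adjoint T y).
Proof. by apply: bounded_op_ext => h; rewrite !opE !dyadE adjE. Qed.
Lemma mul_dyad x y u v : dyad x y * dyad u v = '[u, y] *: dyad x v.
Proof. by rewrite mul_op_dyad dyadE dyadZl. Qed.
Lemma dyad_eq0 x y : dyad x y = 0 -> x = 0 \/ y = 0.
Proof.
move=> /(congr1 (fun T : B => T y)); rewrite dyadE op0E => /eqP.
by rewrite scaler_eq0 => /orP[/eqP/in_eq0|/eqP]; [right|left].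
Qed.

End Operators.

(** * Unit vectors orthogonal to a finite family *)

Section InfiniteDimension.
Variables (R : realType) (H : hilbertType R).
Hypothesis H_infinite : infinite_dimensional H.
Local Notation C := R[i].

(** The orthogonal complement of finitely many vectors has finite codimension: a new [v] either cuts
    the complement of [vs] no further, or costs one more direction [r]. The list [vs] may be
    linearly dependent. *)
Lemma ortho_decomposition (vs : seq H) : exists (n : nat) (u : 'I_n -> H),
  forall x, exists a : 'I_n -> C, forall v, v \in vs -> '[x - \sum_i a i *: u i, v] = 0.
Proof.
elim: vs => [|v vs [n [u IH]]].
  by exists 0%N, (fun=> 0) => x; exists (fun=> 0).
have [[r [rvs rv]]|h] := pselect (exists r, (forall w, w \in vs -> '[r, w] = 0) /\ '[r, v] <> 0).
  exists n.+1, (fun i => if unlift ord0 i is Some j then u j else r) => x.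
  have [a aP] := IH x.
  set s := x - \sum_i a i *: u i in aP.
  exists (fun i => if unlift ord0 i is Some j then a j else '[s, v] / '[r, v]) => w.
  rewrite big_ord_recl unlift_none.
  under eq_bigr do rewrite liftK.
  rewrite opprD addrCA -/s inDl inNl inZl inE => /orP[/eqP->|wvs].
    by rewrite divfK ?addNr//; apply/eqP.
  by rewrite (rvs _ wvs) mulr0 oppr0 add0r aP.
exists n, u => x; have [a aP] := IH x; exists a => w.
rewrite inE => /orP[/eqP->|/aP//].
apply: contrapT => neq; apply: h; eexists; split; last exact: neq.
by move=> w' /aP.
Qed.

(** Otherwise every remainder in [ortho_decomposition] is zero and the finite family [u] spans
    [H]. *)
Lemma exists_ortho (vs : seq H) : exists2 z, nm z = 1 & forall v, v \in vs -> '[z, v] = 0.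
Proof.
have [n [u uP]] := ortho_decomposition vs.
have [[z [z0 zP]]|h] := pselect (exists z, z != 0 /\ forall v, v \in vs -> '[z, v] = 0).
  have zp : 0 < nm z by rewrite nm_gt0.
  exists ((nm z)^-1%:C *: z); last by move=> v /zP; rewrite inZl => ->; rewrite mulr0.
  by rewrite nmZ normc_real ger0_norm ?invr_ge0 ?nm_ge0// mulVf// gt_eqF.
case: H_infinite; exists n, u => x; have [a aP] := uP x; exists a.
apply/eqP; rewrite -subr_eq0; apply/negPn/negP => neq; apply: h.
by eexists; split; first exact: neq.
Qed.

Lemma exists_unit : exists x : H, nm x = 1.
Proof. by have [z z1 _] := exists_ortho [::]; exists z. Qed.

End InfiniteDimension.

(** * Unitaries, complex reflections and transitivity *)

Section Unitaries.
Variables (R : realType) (H : hilbertType R).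
Local Notation C := R[i].
Local Notation B := (bounded_op H).
Implicit Types (x y z u v : H) (a b c : C) (S T X V : B).

Lemma unitary_in V x y : unitary V -> '[V x, V y] = '[x, y].
Proof. by move=> [_ VV]; rewrite adjE -opME VV. Qed.
Lemma unitary_nm V x : unitary V -> nm (V x) = nm x.
Proof.
move=> uV; apply/eqP; rewrite -(@eqrXn2 _ 2) ?nm_ge0//.
by rewrite !nm_sq unitary_in.
Qed.
Lemma unitary_adj V : unitary V -> unitary (adjoint V).
Proof. by move=> [h1 h2]; split; rewrite adjK. Qed.
Lemma unitary_mul U V : unitary U -> unitary V -> unitary (U * V).
Proof.
move=> [u1 u2] [v1 v2]; split; rewrite adjM.
  by rewrite mulrA -(mulrA U) v1 mulr1.
by rewrite mulrA -(mulrA (adjoint V)) u2 mulr1.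
Qed.
Lemma unitary1 : unitary (1 : B).
Proof. by split; rewrite adj1 mulr1. Qed.

Definition reflection u a : B := 1 + (a - 1) *: dyad u u.

Lemma reflectionE u a x : reflection u a x = x + ((a - 1) * '[x, u]) *: u.
Proof. by rewrite /reflection !opE dyadE scalerA. Qed.
Lemma reflection_self u a : nm u = 1 -> reflection u a u = a *: u.
Proof. by move=> /nm1_in u1; rewrite reflectionE u1 mulr1 scalerBl scale1r addrC subrK. Qed.
Lemma reflection_orth u a x : '[x, u] = 0 -> reflection u a x = x.
Proof. by move=> xu; rewrite reflectionE xu mulr0 scale0r addr0. Qed.
Lemma adj_reflection u a : adjoint (reflection u a) = reflection u (Num.conj a).
Proof. by rewrite /reflection adjD adj1 adjZ adj_dyad rmorphB rmorph1. Qed.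
Lemma reflection_mul u a b : nm u = 1 -> reflection u a * reflection u b = reflection u (a * b).
Proof.
move=> /nm1_in u1; apply: bounded_op_ext => x; rewrite opE !reflectionE inDl inZl u1.
by rewrite -addrA -scalerDl; congr (_ + _ *: _); ring.
Qed.
Lemma reflection1 u : reflection u 1 = 1.
Proof. by rewrite /reflection subrr scale0r addr0. Qed.
Lemma reflection_unitary u a : nm u = 1 -> normc a = 1 -> unitary (reflection u a).
Proof.
move=> u1 a1; have aa : a * Num.conj a = 1 by rewrite -normc_sq a1 expr1n.
by split; rewrite adj_reflection reflection_mul// ?aa ?[_ * a]mulrC ?aa reflection1.
Qed.

(** A reflection along [a - b] does it. That it fixes whatever is orthogonal to both vectors allows
    several such moves to be composed. *)
Lemma unit_transitive (a b : H) : nm a = 1 -> nm b = 1 -> exists2 U : B, unitary U &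
  U a = b /\ forall z, '[z, a] = 0 -> '[z, b] = 0 -> U z = z.
Proof.
move=> a1 b1; have [->|ab] := eqVneq a b; first by exists 1; [exact: unitary1|].
pose d := nm (a - b).
have d0 : 0 < d by rewrite nm_gt0 subr_eq0.
pose s := 1 - '[a, b].
have d2 : (d ^+ 2)%:C = s + Num.conj s.
  rewrite -nm_sqC !ipE !nm1_in// (inC a b) rmorphB rmorph1 /s; ring.
have s0 : s != 0.
  apply/negP => /eqP s0; move: d2; rewrite s0 rmorph0 addr0 => /complexI/eqP.
  by rewrite expf_eq0 /= gt_eqF.
have cs0 : Num.conj s != 0 by rewrite fmorph_eq0.
pose u := d^-1%:C *: (a - b).
have u1 : nm u = 1.
  by rewrite nmZ normc_real ger0_norm ?invr_ge0 ?nm_ge0// mulVf// gt_eqF.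
(* As [s = '[a, a - b]], the reflection adds [(t - 1) * s / d ^+ 2] times [a - b] to [a]. This
   factor must be [-1], and [d ^+ 2 = s + Num.conj s] gives the value of [t]. *)
pose t := - (Num.conj s / s).
have t1 : normc t = 1.
  by rewrite normcN normcM normc_conj normcV divff// normc_eq0.
exists (reflection u t); first exact: reflection_unitary.
split=> [|z za zb].
  rewrite reflectionE /u scalerA inZr inBr nm1_in// -/s.
  have -> : (t - 1) * (Num.conj d^-1%:C * s) * d^-1%:C = -1.
    have -> : t - 1 = - ((d ^+ 2)%:C / s) by rewrite d2 /t; field.
    rewrite conjE conjc_real -mulrA.
    rewrite fmorphV rmorphXn /= ; field.
    by rewrite s0 fmorph_eq0 gt_eqF.
  by rewrite scaleN1r opprB addrC subrK.
by rewrite reflection_orth// inZr inBr za zb subrr mulr0.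
Qed.

Definition orthonormal3 x y z := [/\ nm x = 1, nm y = 1, nm z = 1 &
  [/\ '[x, y] = 0, '[x, z] = 0 & '[y, z] = 0]].

(** The three vectors are moved one after the other, each reflection fixing those already in
    place. *)
Lemma orthonormal3_transitive x y z x' y' z' :
  orthonormal3 x y z -> orthonormal3 x' y' z' ->
  exists2 U : B, unitary U & [/\ U x = x', U y = y' & U z = z'].
Proof.
move=> [x1 y1 z1 [xy xz yz]] [x1' y1' z1' [xy' xz' yz']].
have [U uU [Ux _]] := unit_transitive x1 x1'.
have Uy1 : nm (U y) = 1 by rewrite unitary_nm.
have [V uV [Vy Vf]] := unit_transitive Uy1 y1'.
have Vx : V x' = x' by apply: Vf => //; rewrite -Ux unitary_in.
have uVU : unitary (V * U) := unitary_mul uV uU.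
have Uz1 : nm ((V * U) z) = 1 by rewrite unitary_nm.
have [W uW [Wz Wf]] := unit_transitive Uz1 z1'.
exists (W * (V * U)); first exact: unitary_mul.
rewrite !opE Ux Vx Vy; split=> //; apply: Wf => //.
  by rewrite -{1}Vx -Ux !opE !unitary_in.
by rewrite -{1}Vy !opE !unitary_in.
Qed.

Lemma reflection_eigen u a c h : nm u = 1 -> reflection u a h = c *: h ->
  (c <> 1 -> h = '[h, u] *: u) /\ (c <> a -> '[h, u] = 0).
Proof.
move=> u1 e; split=> [c1|ca].
  have : (c - 1) *: h = ((a - 1) * '[h, u]) *: u.
    by rewrite scalerBl -e scale1r reflectionE addrAC subrr add0r.
  move=> e2; have {2}-> : h = ((c - 1)^-1 * ((a - 1) * '[h, u])) *: u.
    by rewrite -scalerA -e2 scalerA mulVf ?scale1r// subr_eq0; apply/eqP.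
  rewrite inZl nm1_in// mulr1 -scalerA -e2 scalerA mulVf ?scale1r// subr_eq0; exact/eqP.
have := congr1 (fun x => '[x, u]) e; rewrite reflectionE inDl !inZl nm1_in// => e2.
apply/eqP; have : (a - c) * '[h, u] == 0 by apply/eqP; rewrite -(subrr (c * '[h, u])) -{1}e2; ring.
by rewrite mulf_eq0 subr_eq0 => /orP[/eqP ac|//]; case: ca.
Qed.

(** * Eigenvectors of conjugation by a reflection *)

Section Weights.
Variables (u : H) (a : C) (S : B) (k : C).
Hypotheses (u1 : nm u = 1) (a1 : normc a = 1) (aN1 : a <> 1) (aNc : a <> Num.conj a).
Hypothesis wS : reflection u a * S * adjoint (reflection u a) = k *: S.

Let aa : a * Num.conj a = 1. Proof. by rewrite -normc_sq a1 expr1n. Qed.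

Let comm x : reflection u a (S x) = k *: S (reflection u a x).
Proof.
have [_ h] := reflection_unitary u1 a1.
by rewrite -!opME -opZE -opZMl -wS -!mulrA h mulr1.
Qed.
Let comm_orth x : '[x, u] = 0 -> reflection u a (S x) = k *: S x.
Proof. by move=> xu; rewrite comm reflection_orth. Qed.
Let comm_self : reflection u a (S u) = (k * a) *: S u.
Proof. by rewrite comm reflection_self// mapZ scalerA. Qed.
Let split_u x : exists2 y, '[y, u] = 0 & x = '[x, u] *: u + y.
Proof.
exists (x - '[x, u] *: u); last by rewrite addrC subrK.
by rewrite inBl inZl nm1_in// mulr1 subrr.
Qed.

(** With respect to the line of [u] and its complement, the diagonal blocks of [S] have weight [1],
    the block from the complement into the line has weight [a], and the block from the line into the
    complement has weight [Num.conj a]. *)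
Lemma weight_none : k <> 1 -> k <> a -> k <> Num.conj a -> S = 0.
Proof.
move=> k1 ka kc; apply: bounded_op_ext => x; rewrite op0E.
have [y yu ->] := split_u x; rewrite mapD mapZ.
have [/(_ k1) h3 /(_ ka) h4] := reflection_eigen u1 (comm_orth yu).
have [h1 h2] := reflection_eigen u1 comm_self.
rewrite h3 h4 h1 ?h2 ?scale0r ?scaler0 ?addr0// => e.
  by apply: k1; apply: (mulIf (x := a)); rewrite ?mul1r// -normc_eq0 a1 oner_eq0.
by apply: kc; rewrite -[LHS]mulr1 -aa mulrA e mul1r.
Qed.

(** Since [a] differs from [1] and from [Num.conj a], only the block from the complement into the
    line survives. *)
Lemma weight_left : k = a -> S = dyad u (adjoint S u) /\ S u = 0.
Proof.
move=> ka.
have Su : S u = 0.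
  have [h1 h2] := reflection_eigen u1 comm_self.
  rewrite h1 ?h2 ?scale0r// ka => e.
    by apply: aN1; apply: (mulIf (x := a)); rewrite ?mul1r// -normc_eq0 a1 oner_eq0.
  by apply: aNc; rewrite -[LHS]mulr1 -aa mulrA e mul1r.
split=> //; apply: bounded_op_ext => x; rewrite dyadE -adjE.
have [y yu ->] := split_u x; rewrite mapD mapZ Su scaler0 add0r.
by have [h _] := reflection_eigen u1 (comm_orth yu); apply: h; rewrite ka.
Qed.

Lemma weight_right : k = Num.conj a -> S = dyad (S u) u /\ '[S u, u] = 0.
Proof.
move=> kc.
have k1 : k <> 1 by rewrite kc => e; apply: aN1; rewrite -[a]conjCK e rmorph1.
have ka : k <> a by rewrite kc => e; apply: aNc.
split.
  apply: bounded_op_ext => x; rewrite dyadE.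
  have [y yu e] := split_u x; rewrite [in LHS]e mapD mapZ.
  have [/(_ k1) h3 /(_ ka) h4] := reflection_eigen u1 (comm_orth yu).
  by rewrite h3 h4 scale0r addr0.
have [_ h] := reflection_eigen u1 comm_self; apply: h.
by rewrite kc mulrC aa => e; apply: aN1.
Qed.
End Weights.

End Unitaries.

(** * The numerical radius as a norm *)

Section NumericalRadius.
Variables (R : realType) (H : hilbertType R).
Hypothesis H_infinite : infinite_dimensional H.
Local Notation C := R[i].
Local Notation B := (bounded_op H).
Local Notation w := (@numerical_radius R H).
Implicit Types (x y z u v : H) (a b c : C) (S T X V : B).

Lemma numerical_radiusP T x : nm x = 1 -> normc '[T x, x] <= w T.
Proof.
move=> x1; apply: ub_le_sup; last by exists x => //=; apply/nm_norm1.
have [M M0 bM] := op_bound T.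
exists M => _ [y /nm_norm1 y1 <-].
apply: (le_trans (CauchySchwarz _ _)).
by rewrite y1 mulr1 (le_trans (bM y))// y1 mulr1.
Qed.

Lemma numerical_radius_le T M : (forall x, nm x = 1 -> normc '[T x, x] <= M) -> w T <= M.
Proof.
move=> h; apply: ge_sup.
  by have [x x1] := exists_unit H_infinite; exists (normc '[T x, x]), x => //=; apply/nm_norm1.
by move=> _ [y /nm_norm1 y1 <-]; apply: h.
Qed.

Lemma numerical_radius_adherent T e : 0 < e ->
  exists2 x, nm x = 1 & w T - e < normc '[T x, x].
Proof.
move=> e0; apply: contrapT => h.
have : w T <= w T - e.
  apply: numerical_radius_le => x x1; rewrite leNgt; apply/negP => lt.
  by apply: h; exists x.
by rewrite leNgt ltrBlDr ltrDl e0.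
Qed.

Lemma numerical_radius_ge0 T : 0 <= w T.
Proof.
by have [x x1] := exists_unit H_infinite; apply: le_trans (numerical_radiusP T x1); exact: normc_ge0.
Qed.

Lemma normalize x : x != 0 -> exists2 y, nm y = 1 & x = (nm x)%:C *: y.
Proof.
move=> x0; have xp : 0 < nm x by rewrite nm_gt0.
exists ((nm x)^-1%:C *: x).
  by rewrite nmZ normc_real ger0_norm ?invr_ge0 ?nm_ge0// mulVf// gt_eqF.
by rewrite scalerA -rmorphM divff ?scale1r// gt_eqF.
Qed.

Lemma orthZr a x y : a != 0 -> '[x, a *: y] = 0 -> '[x, y] = 0.
Proof. by move=> a0 /eqP; rewrite inZr mulf_eq0 fmorph_eq0 (negbTE a0) => /eqP. Qed.

Lemma orthZ a b x y : a != 0 -> b != 0 -> '[a *: x, b *: y] = 0 -> '[x, y] = 0.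
Proof. by move=> a0 b0 /(orthZr b0)/eqP; rewrite inZl mulf_eq0 (negbTE a0) => /eqP. Qed.

Lemma numerical_radius_form T x : normc '[T x, x] <= w T * nm x ^+ 2.
Proof.
have [->|/normalize[y y1 ->]] := eqVneq x 0.
  by rewrite in0r nm0 expr0n mulr0 -[0 in leLHS]/(0%:C) normc_real normr0.
rewrite mapZ inZl inZr conjE conjc_real mulrA -rmorphM normcM normc_real nmZ normc_real y1 mulr1.
rewrite -!expr2 real_normK ?num_real// ger0_norm ?sqr_ge0// mulrC ler_wpM2r ?sqr_ge0//.
exact: numerical_radiusP.
Qed.

(** The constant comes from polarization: for unit vectors the four squared norms in [form4] add up
    to [8] by the parallelogram law, and [8 / 4 = 2]. *)
Lemma numerical_radius_bilinear T x y : normc '[T x, y] <= 2 * w T * (nm x * nm y).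
Proof.
have [->|/normalize[u u1 ->]] := eqVneq x 0.
  by rewrite map0 in0l nm0 mul0r mulr0 -[0 in leLHS]/(0%:C) normc_real normr0.
have [->|/normalize[v v1 ->]] := eqVneq y 0.
  by rewrite in0r nm0 !mulr0 -[0 in leLHS]/(0%:C) normc_real normr0.
rewrite mapZ inZl inZr conjE conjc_real !nmZ !normcM u1 v1 !mulr1 mulrA [leRHS]mulrC.
rewrite ler_wpM2l ?mulr_ge0 ?normc_ge0//.
have : normc (4 * '[T u, v]) <= w T * 8.
  rewrite form4.
  apply: (le_trans (normcD _ _)); rewrite normcN normcM normc_ii mul1r.
  have h1 := numerical_radius_form T (u - ii *: v).
  have := normcD ('[T (u + v), u + v] - '[T (u - v), u - v]) (ii * '[T (u + ii *: v), u + ii *: v]).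
  rewrite normcM normc_ii mul1r => h2.
  have h3 := numerical_radius_form T (u + ii *: v).
  have := normcD '[T (u + v), u + v] (- '[T (u - v), u - v]); rewrite normcN => h4.
  have h5 := numerical_radius_form T (u + v).
  have h6 := numerical_radius_form T (u - v).
  have p1 := parallelogram u v; have := parallelogram u (ii *: v).
  rewrite nmZ normc_ii mul1r u1 v1 in p1 * => p2.
  have -> : w T * 8 = w T * nm (u + v) ^+ 2 + w T * nm (u - v) ^+ 2
     + (w T * nm (u + ii *: v) ^+ 2 + w T * nm (u - ii *: v) ^+ 2).
    by rewrite -!mulrDr p1 p2; congr (_ * _); ring.
  move: h1 h2 h3 h4 h5 h6; lra.
rewrite normcM -[4]/((4%:R)) -(rmorph_nat (real_complex R)) normc_real ger0_norm ?ler0n// => h.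
by lra.
Qed.

Lemma nm_le_numerical_radius T x : nm (T x) <= 2 * w T * nm x.
Proof.
have [->|Tx] := eqVneq (T x) 0.
  by rewrite nm0 !mulr_ge0 ?nm_ge0 ?numerical_radius_ge0.
have fp : 0 < nm (T x) by rewrite nm_gt0.
have h := numerical_radius_bilinear T x (T x); rewrite mulrA in h.
rewrite -(ler_pM2r fp); apply: (le_trans _ h).
by rewrite -expr2 nm_sq (le_trans (ler_norm _))// Re_le_normc.
Qed.

Lemma numerical_radiusZ a T : w (a *: T) = normc a * w T.
Proof.
have le b S : w (b *: S) <= normc b * w S.
  apply: numerical_radius_le => x x1; rewrite opZE inZl normcM ler_wpM2l ?normc_ge0//.
  exact: numerical_radiusP.
apply/eqP; rewrite eq_le le /=.
have [->|a0] := eqVneq a 0.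
  by rewrite -[0]/(0%:C) normc_real normr0 mul0r numerical_radius_ge0.
have {1}-> : T = a^-1 *: (a *: T) by rewrite scalerA mulVf// scale1r.
have an0 : normc a != 0 by rewrite normc_eq0.
by apply: (le_trans (ler_wpM2l (normc_ge0 a) (le _ _))); rewrite normcV mulVKf.
Qed.

Lemma numerical_radiusD S T : w (S + T) <= w S + w T.
Proof.
apply: numerical_radius_le => x x1; rewrite opDE inDl.
by apply: (le_trans (normcD _ _)); rewrite lerD// numerical_radiusP.
Qed.

Lemma numerical_radius1 : w 1 = 1.
Proof.
apply/eqP; rewrite eq_le numerical_radius_le => [|x /nm1_in x1]; last by rewrite op1E x1 normc1.
by have [x x1] := exists_unit H_infinite; have := numerical_radiusP 1 x1; rewrite op1E nm1_in// normc1.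
Qed.

Lemma numerical_radius_dyad x y : w (dyad x y) <= nm x * nm y.
Proof.
apply: numerical_radius_le => u u1; rewrite dyadE inZl normcM mulrC ler_pM ?normc_ge0//.
  by have := CauchySchwarz x u; rewrite u1 mulr1.
by have := CauchySchwarz u y; rewrite u1 mul1r.
Qed.

Lemma numerical_radius_unitary V T : unitary V -> w (V * T * adjoint V) = w T.
Proof.
have le U S : unitary U -> w (U * S * adjoint U) <= w S.
  move=> uU; apply: numerical_radius_le => x x1; rewrite !opE adjE.
  by apply: numerical_radiusP; rewrite (unitary_nm _ (unitary_adj uU)).
move=> uV; apply/eqP; rewrite eq_le le//=.
have {1}-> : T = adjoint V * (V * T * adjoint V) * adjoint (adjoint V).
  by case: uV => h1 h2; rewrite adjK -!mulrA h2 mulr1 mulrA h2 mul1r.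
exact/le/unitary_adj.
Qed.

End NumericalRadius.

(** * Vector states exposed by the numerical radius *)

Section VectorStates.
Variables (R : realType) (H : hilbertType R).
Hypothesis H_infinite : infinite_dimensional H.
Local Notation C := R[i].
Local Notation B := (bounded_op H).
Local Notation w := (@numerical_radius R H).
Implicit Types (x y z u v : H) (a b c : C) (S T X Y V : B).

Lemma numerical_radius_adj T : w (adjoint T) = w T.
Proof.
have le S : w (adjoint S) <= w S.
  apply: (numerical_radius_le H_infinite) => x x1; rewrite -adjEr inC normc_conj.
  exact: numerical_radiusP.
by apply/eqP; rewrite eq_le le /= -[X in w X <= _]adjK le.
Qed.

Lemma phase_align a b (r : R) : 0 <= r ->
  exists2 t, normc t = r & normc (a + t * b) = normc a + r * normc b.
Proof.
move=> r0; have [u u1 ua] := phase a; have [v v1 vb] := phase b.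
have uu : Num.conj u * u = 1 by rewrite mulrC -normc_sq u1 expr1n.
exists (r%:C * (Num.conj u * v)).
  by rewrite !normcM normc_conj u1 v1 !mulr1 normc_real ger0_norm.
have -> : a + r%:C * (Num.conj u * v) * b = Num.conj u * (u * a + r%:C * (v * b)).
  by rewrite -[X in X + _]mul1r -uu; ring.
rewrite ua vb -rmorphM -rmorphD normcM normc_conj u1 mul1r normc_real ger0_norm//.
by rewrite addr_ge0 ?mulr_ge0 ?normc_ge0.
Qed.

Definition orth_part x h := h - '[h, x] *: x.

Lemma orth_part_orth x h : nm x = 1 -> '[orth_part x h, x] = 0.
Proof. by move=> /nm1_in x1; rewrite inBl inZl x1 mulr1 subrr. Qed.
Lemma orth_part_nm x h : nm x = 1 -> nm h ^+ 2 = normc '[h, x] ^+ 2 + nm (orth_part x h) ^+ 2.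
Proof.
move=> x1; have {1}-> : h = '[h, x] *: x + orth_part x h by rewrite addrC subrK.
by rewrite pythagoras ?nmZ ?x1 ?mulr1// inZl (orthC (orth_part_orth h x1)) mulr0.
Qed.
Lemma orth_part_le x h : nm x = 1 -> nm (orth_part x h) <= nm h.
Proof.
move=> x1; rewrite -ler_sqr ?nnegrE ?nm_ge0// [leRHS](orth_part_nm _ x1).
by rewrite lerDr sqr_ge0.
Qed.
Lemma orth_part_in x h y : '[y, x] = 0 -> '[h, y] = '[orth_part x h, y].
Proof. by move=> /orthC xy; rewrite inBl inZl xy mulr0 subr0. Qed.

Definition proj_orth x : B := 1 - dyad x x.

Lemma proj_orthE x h : proj_orth x h = orth_part x h.
Proof. by rewrite /proj_orth !opE dyadE. Qed.
Lemma adj_proj_orth x : adjoint (proj_orth x) = proj_orth x.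
Proof. by rewrite adjD adjN adj1 adj_dyad. Qed.

(** These are the blocks [p X p], [p X q], [q X p] and [q X q] for [p = dyad x x] and
    [q = proj_orth x]. *)
Lemma corner_decomposition x X : X = '[X x, x] *: dyad x x +
  (dyad x (orth_part x (adjoint X x)) + (dyad (orth_part x (X x)) x + proj_orth x * X * proj_orth x)).
Proof.
have <- : dyad x x * X * proj_orth x = dyad x (orth_part x (adjoint X x)).
  by rewrite !mul_dyad_op adj_proj_orth proj_orthE.
have <- : proj_orth x * X * dyad x x = dyad (orth_part x (X x)) x.
  by rewrite -mulrA !mul_op_dyad proj_orthE.
have <- : dyad x x * X * dyad x x = '[X x, x] *: dyad x x by rewrite mul_dyad_op mul_dyad -adjE.
by rewrite addrA -!mulrDr -!mulrDl /proj_orth addrC subrK mulr1 mul1r.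
Qed.

Section Exposed.
Variables (x : H) (e : R).
Hypotheses (x1 : nm x = 1) (e0 : 0 < e).
Let p : B := dyad x x.

Let p_form h : normc '[p h, h] = normc '[h, x] ^+ 2.
Proof. by rewrite dyadE inZl normcM (inC h x) normc_conj expr2. Qed.

Variable g : B -> C.
Hypotheses (g_lin : scalar g) (g_le : forall X, normc (g X) <= w X).
Hypothesis gp : 1 - e ^+ 2 <= normc (g p).

Let gD X Y : g (X + Y) = g X + g Y.
Proof. exact: (GRing.semilinear_linear g_lin).2. Qed.
Let gZ a X : g (a *: X) = a * g X.
Proof. exact: GRing.scalable_linear. Qed.

(* [p = xx*] has numerical radius [1], and [w (p + t Y) <= 1] as soon as [Y] is small and
   supported on the complement of [x]; with the phase of [t] chosen to align [g Y] with [g p],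
   this leaves room for [g Y] only of the order of the defect [e ^+ 2]. *)
Lemma exposed_corner Y (K : R) : 0 < K ->
  (forall h, normc '[Y h, h] <= K * nm (orth_part x h) ^+ 2) -> normc (g Y) <= e ^+ 2 * K.
Proof.
move=> K0 Yb.
have [t tK tE] : exists2 t, normc t = K^-1 & normc (g p + t * g Y) = normc (g p) + K^-1 * normc (g Y).
  by apply: phase_align; rewrite invr_ge0 ltW.
have : normc (g p + t * g Y) <= 1.
  rewrite -gZ -gD; apply: (le_trans (g_le _)); apply: (numerical_radius_le H_infinite) => h h1.
  rewrite opDE inDl opZE inZl; apply: (le_trans (normcD _ _)).
  rewrite p_form normcM tK -[leRHS](expr1n _ 2) -h1 (orth_part_nm h x1) lerD2l.
  by rewrite ler_pdivrMl.
rewrite tE => h; rewrite -ler_pdivrMr// mulrC.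
by move: h gp; set s := _ * normc (g Y); lra.
Qed.

(* Off the diagonal, [w (p + t Y)] grows only to second order in [t]; the best [t] is [2 e / N]. *)
Lemma exposed_side y (N : R) : 0 < N -> nm y <= N -> '[y, x] = 0 ->
  normc (g (dyad x y)) <= e * N.
Proof.
move=> N0 yN yx; set Y := dyad x y.
pose r := (e *+ 2) / N.
have r0 : 0 < r by rewrite divr_gt0// mulrn_wgt0.
have [t tr tE] := phase_align (g p) (g Y) (ltW r0).
have h : normc (g p + t * g Y) <= 1 + e ^+ 2.
  rewrite -gZ -gD; apply: (le_trans (g_le _)); apply: (numerical_radius_le H_infinite) => h h1.
  rewrite opDE inDl opZE inZl; apply: (le_trans (normcD _ _)).
  rewrite p_form normcM tr /Y dyadE inZl normcM (inC h x) normc_conj (orth_part_in h yx).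
  have := orth_part_nm h x1; rewrite h1 expr1n.
  have := CauchySchwarz (orth_part x h) y.
  have := nm_ge0 (orth_part x h).
  set b := nm (orth_part x h); set a := normc '[h, x]; set c := normc _ => b0 cb ab.
  have a0 : 0 <= a by exact: normc_ge0.
  have : r * (c * a) <= r * (b * N * a).
    rewrite ler_wpM2l ?(ltW r0)// ler_wpM2r//; apply: (le_trans cb).
    by rewrite ler_wpM2l.
  have -> : r * (b * N * a) = e *+ 2 * b * a by rewrite /r; field; rewrite gt_eqF.
  (* By the choice of [r] the cross term is at most [2 e a b], hence at most
     [b ^+ 2 + e ^+ 2 * a ^+ 2]; as [a ^+ 2 + b ^+ 2 = 1], the total is at most [1 + e ^+ 2]. *)
  have : 0 <= (b - e * a) ^+ 2 by exact: sqr_ge0.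
  have : 0 <= e ^+ 2 * b ^+ 2 by rewrite mulr_ge0 ?sqr_ge0.
  have -> : a ^+ 2 = 1 - b ^+ 2 by lra.
  have -> : (b - e * a) ^+ 2 = b ^+ 2 + e ^+ 2 * (1 - b ^+ 2) - e *+ 2 * b * a.
    have -> : 1 - b ^+ 2 = a ^+ 2 by lra.
    by ring.
  by lra.
have : r * normc (g Y) <= e ^+ 2 *+ 2 by move: h gp; rewrite tE; lra.
have -> : r * normc (g Y) = (e *+ 2) / N * normc (g Y) by [].
rewrite mulrAC ler_pdivrMr//.
have -> : e ^+ 2 *+ 2 * N = e *+ 2 * (e * N) by ring.
by rewrite ler_pM2l// mulrn_wgt0.
Qed.
End Exposed.

(** Block by block: each off-diagonal block is given by a vector of norm at most [2 K] and
    contributes at most [2 e K], and the corner contributes at most [e ^+ 2 * K <= e K]; hence the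
    factor [5]. *)
Lemma exposed x (e K : R) (g : B -> C) : nm x = 1 -> 0 < e -> e <= 1 -> 0 < K ->
  scalar g -> (forall X, normc (g X) <= w X) ->
  1 - e ^+ 2 <= normc (g (dyad x x)) ->
  forall X, w X <= K -> normc (g X - g (dyad x x) * '[X x, x]) <= e * (5 * K).
Proof.
move=> x1 e0 e1 K0 gl gw gp X XK.
have gD Y Z : g (Y + Z) = g Y + g Z by exact: (GRing.semilinear_linear gl).2.
have gZ a Y : g (a *: Y) = a * g Y by exact: GRing.scalable_linear.
pose y1 := orth_part x (adjoint X x); pose y2 := orth_part x (X x).
have n1 : nm y1 <= 2 * K.
  apply: (le_trans (orth_part_le _ x1)).
  have := nm_le_numerical_radius H_infinite (adjoint X) x.
  by rewrite x1 mulr1 numerical_radius_adj => /le_trans; apply; rewrite ler_wpM2l.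
have n2 : nm y2 <= 2 * K.
  apply: (le_trans (orth_part_le _ x1)).
  have := nm_le_numerical_radius H_infinite X x.
  by rewrite x1 mulr1 => /le_trans; apply; rewrite ler_wpM2l.
have K2 : 0 < 2 * K by rewrite mulr_gt0.
have b1 := exposed_side x1 e0 gl gw gp K2 n1 (orth_part_orth _ x1).
have b2 : normc (g (dyad y2 x)) <= e * (2 * K).
  (* Taking adjoints exchanges the two off-diagonal blocks and preserves [w], so [exposed_side]
     covers this block as well. *)
  pose g' Y := Num.conj (g (adjoint Y)).
  have gl' : scalar g'.
    by move=> a Y Z; rewrite /g' adjD adjZ gl rmorphD rmorphM /= conjCK.
  have gw' Y : normc (g' Y) <= w Y by rewrite normc_conj -numerical_radius_adj.
  have gp' : 1 - e ^+ 2 <= normc (g' (dyad x x)) by rewrite normc_conj adj_dyad.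
  have := exposed_side x1 e0 gl' gw' gp' K2 n2 (orth_part_orth _ x1).
  by rewrite /g' normc_conj adj_dyad.
have b3 : normc (g (proj_orth x * X * proj_orth x)) <= e ^+ 2 * K.
  apply: (exposed_corner x1 gl gw gp K0) => h.
  rewrite !opME adjE adj_proj_orth proj_orthE; apply: (le_trans (numerical_radius_form X _)).
  by rewrite ler_wpM2r ?sqr_ge0.
rewrite {1}(corner_decomposition x X) !gD gZ [g _ * _]mulrC addrAC subrr add0r.
have h1 := normcD (g (dyad x y1)) (g (dyad y2 x) + g (proj_orth x * X * proj_orth x)).
have h2 := normcD (g (dyad y2 x)) (g (proj_orth x * X * proj_orth x)).
have : e ^+ 2 * K <= e * K by rewrite ler_wpM2r ?(ltW K0)// expr2 ler_piMl// ltW.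
have -> : e * (5 * K) = e * (2 * K) + e * (2 * K) + e * K by ring.
lra.
Qed.

(** Nearby vector states have nearby vectors only up to a phase. The vector ['[y0, y] *: y], image
    of a fixed [y0] under yy*, is blind to the phase of [y]. Such vectors converge to the [z] that
    Riesz attaches to [u |-> h (dyad u y0)], and [h] is the state of [z] normalized. *)
Lemma vector_state_limit (h : B -> C) : scalar h ->
  (forall e : R, 0 < e -> exists2 y, nm y = 1 & forall T, normc ('[T y, y] - h T) <= e * w T) ->
  exists2 y, nm y = 1 & forall T, h T = '[T y, y].
Proof.
move=> hl hap.
have hw T : normc (h T) <= w T.
  apply: (@eps_le _ _ _ (w T)) => e /hap[y y1 yT].
  have -> : h T = '[T y, y] - ('[T y, y] - h T) by rewrite opprB addrC subrK.
  by apply: (le_trans (normcD _ _)); rewrite normcN lerD// numerical_radiusP.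
have [y0 y01 y0P] := hap 4^-1 (ltac:(by rewrite invr_gt0)).
have [z zP] : exists z, forall u, h (dyad u y0) = '[u, z].
  apply: (@riesz _ _ _ 1) => [a u v|u]; first by rewrite dyadDl dyadZl hl.
  apply: (le_trans (hw _)); apply: (le_trans (numerical_radius_dyad H_infinite _ _)).
  by rewrite y01 mulr1 mul1r.
have near (e : R) y : nm y = 1 -> (forall T, normc ('[T y, y] - h T) <= e * w T) ->
    0 <= e -> nm ('[y0, y] *: y - z) <= e.
  move=> y1 yP e0; set v := _ - z.
  have [->|v0] := eqVneq v 0; first by rewrite nm0.
  have vp : 0 < nm v by rewrite nm_gt0.
  have := yP (dyad v y0); rewrite zP dyadE inZl => h1.
  rewrite -(ler_pM2r vp) -expr2 nm_sq (le_trans (ler_norm _))// (le_trans (Re_le_normc _))//.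
  have -> : '[v, v] = '[y, y0] * '[v, y] - '[v, z].
    by rewrite {2}/v inBr inZr -inC.
  apply: (le_trans h1); rewrite ler_wpM2l//.
  by apply: (le_trans (numerical_radius_dyad H_infinite _ _)); rewrite y01 mulr1.
(* At [y = y0] the estimate says that [z] is within [1/4] of the unit vector [y0]. *)
have zn : z != 0.
  apply: contraTneq isT => z0; have := near 4^-1 y0 y01 y0P.
  rewrite z0 subr0 nm1_in// scale1r y01 => /(_ (ltac:(by rewrite invr_ge0))); lra.
have zp : 0 < nm z by rewrite nm_gt0.
exists ((nm z)^-1%:C *: z).
  by rewrite nmZ normc_real ger0_norm ?invr_ge0 ?nm_ge0// mulVf// gt_eqF.
move=> T; rewrite mapZ inZl inZr conjE conjc_real mulrA -rmorphM.
have zn2 : (nm z ^+ 2)%:C != 0 :> C by rewrite fmorph_eq0 expf_eq0 /= gt_eqF.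
apply: (mulfI zn2); rewrite [RHS]mulrA -rmorphM.
have -> : nm z ^+ 2 * ((nm z)^-1 * (nm z)^-1) = 1 by field; rewrite gt_eqF.
rewrite mul1r; apply/eqP; rewrite -subr_eq0 -normc_eq0; apply/eqP.
have [M M0 TM] := op_bound T.
pose K := w T + (nm z + 1) * normc (h T) + M * (nm z + 1).
apply: (@eps0 _ _ K) => e e0; rewrite ger0_norm ?normc_ge0//.
have [y y1 yP] := hap e e0.
set v := '[y0, y] *: y.
have vz := near e y y1 yP (ltW e0); rewrite -/v in vz.
have v1 : nm v <= 1.
  by rewrite nmZ y1 mulr1; have := CauchySchwarz y0 y; rewrite y1 y01 mulr1.
have Tv : '[T v, v] = (nm v ^+ 2)%:C * '[T y, y].
  by rewrite /v mapZ inZl inZr nmZ y1 mulr1 normc_sq mulrA.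
have -> : (nm z ^+ 2)%:C * h T - '[T z, z] =
   - ((nm v ^+ 2)%:C * ('[T y, y] - h T)) + ('[T (v - z), v] + '[T z, v - z])
   + (nm z ^+ 2 - nm v ^+ 2)%:C * h T.
  rewrite mulrBr -Tv mapB inBl inBr rmorphB; ring.
have h1 : normc (- ((nm v ^+ 2)%:C * ('[T y, y] - h T))) <= e * w T.
  rewrite normcN normcM normc_real ger0_norm ?sqr_ge0//.
  rewrite -[leRHS]mul1r ler_pM ?sqr_ge0 ?normc_ge0//.
  by rewrite expr_le1// nm_ge0.
have h2 : normc ('[T (v - z), v] + '[T z, v - z]) <= e * (M * (nm z + 1)).
  apply: (le_trans (normcD _ _)).
  have -> : e * (M * (nm z + 1)) = M * e * 1 + M * nm z * e by ring.
  rewrite lerD// (le_trans (CauchySchwarz _ _))// ler_pM ?nm_ge0//.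
  by apply: (le_trans (TM _)); rewrite ler_wpM2l// ltW.
have h3 : normc ((nm z ^+ 2 - nm v ^+ 2)%:C * h T) <= e * ((nm z + 1) * normc (h T)).
  rewrite normcM mulrA ler_wpM2r ?normc_ge0// normc_real subr_sqr normrM.
  rewrite ler_pM//; last by rewrite ger0_norm ?addr_ge0 ?nm_ge0// lerD2l.
  rewrite ler_norml; apply/andP; split.
    have := nmD (v - z) z; rewrite subrK; lra.
  have := nmD (z - v) v; rewrite subrK (nmBC z v); lra.
have e1 := normcD (- ((nm v ^+ 2)%:C * ('[T y, y] - h T)) + ('[T (v - z), v] + '[T z, v - z]))
  ((nm z ^+ 2 - nm v ^+ 2)%:C * h T).
have e2 := normcD (- ((nm v ^+ 2)%:C * ('[T y, y] - h T))) ('[T (v - z), v] + '[T z, v - z]).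
have -> : e * K = e * w T + e * ((nm z + 1) * normc (h T)) + e * (M * (nm z + 1)) by rewrite /K; ring.
lra.
Qed.

(** [psi' (dyad x x)] has numerical radius [1], almost attained at some [y]. The functional [X |->
    '[psi' X y, y]] then almost attains its norm at [dyad x x], so [exposed] makes it close to a
    multiple of the state of [x]. Read at [X = psi T], this compares the state of [y] with the
    pullback [f]. *)
Lemma isometry_vector_state (psi psi' : B -> B) x :
  linear psi -> linear psi' -> cancel psi' psi -> cancel psi psi' ->
  (forall X, w (psi X) = w X) -> nm x = 1 ->
  exists s : C, normc s = 1 /\
    exists2 y, nm y = 1 & forall T, '[psi T x, x] = s * '[T y, y].
Proof.
move=> pl pl' pK pK' pw x1.
have pw' X : w (psi' X) = w X by rewrite -pw pK.
pose f T := '[psi T x, x].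
have fl : scalar f by move=> a X Y; rewrite /f pl opDE opZE !ipE.
have fw X : normc (f X) <= w X by rewrite -pw; apply: numerical_radiusP.
have app e : 0 < e -> e <= 1 -> exists2 y, nm y = 1 &
    exists2 c, normc c <= 1 & forall T, normc ('[T y, y] - c * f T) <= e * (5 * w T).
  move=> e0 e1.
  have [y y1 yP] := numerical_radius_adherent H_infinite (psi' (dyad x x)) (exprn_gt0 2 e0).
  exists y => //; pose g X := '[psi' X y, y].
  have gl : scalar g by move=> a X Y; rewrite /g pl' opDE opZE !ipE.
  have gw X : normc (g X) <= w X by rewrite -pw'; apply: numerical_radiusP.
  have wp : 1 <= w (dyad x x).
    by have := numerical_radiusP (dyad x x) x1; rewrite dyadE nm1_in// scale1r nm1_in// normc1.
  have gp : 1 - e ^+ 2 <= normc (g (dyad x x)).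
    by rewrite pw' in yP; move: yP wp; rewrite /g; lra.
  exists (g (dyad x x)).
    apply: (le_trans (gw _)); apply: (le_trans (numerical_radius_dyad H_infinite _ _)).
    by rewrite x1 mulr1.
  move=> T; have := numerical_radius_ge0 H_infinite T.
  (* [exposed] asks for a positive bound [K]; if [w T = 0], both values vanish. *)
  rewrite le_eqVlt => /orP[/eqP w0|wT].
    have z (a : C) : normc a <= w T -> a = 0.
      by rewrite -w0 => a0; apply/eqP; rewrite -normc_eq0 eq_le a0 normc_ge0.
    rewrite (z (f T))// (z '[T y, y]) ?numerical_radiusP// mulr0 subr0 normc0.
    by rewrite -w0 !mulr0.
  have := exposed x1 e0 e1 wT gl gw gp (X := psi T).
  by rewrite /g pK' pw => /(_ (lexx _)).
(* The factor is read off at the identity, where every vector state is [1]: this forces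
   [normc s = 1] and [c] close to [Num.conj s]. *)
set s := f 1.
have s1 : normc s = 1.
  apply/eqP; rewrite eq_le; apply/andP; split.
    by apply: (le_trans (fw 1)); rewrite (numerical_radius1 H_infinite).
  apply: (@eps_le _ _ _ 5) => e e0.
  have [e1|e1] := leP e 1; last by have := normc_ge0 s; lra.
  have [y y1 [c c1 /(_ 1)]] := app e e0 e1.
  rewrite op1E nm1_in// (numerical_radius1 H_infinite) mulr1 -/s => h.
  have := normcD (1 - c * s) (c * s); rewrite subrK normc1 normcM.
  have : normc c * normc s <= 1 * normc s by rewrite ler_wpM2r ?normc_ge0.
  by lra.
have ss : s * Num.conj s = 1 by rewrite -normc_sq s1 expr1n.
have [||y y1 yP] := @vector_state_limit (fun T => Num.conj s * f T).
- by move=> a X Y; rewrite fl; ring.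
- move=> e e0.
  (* Two errors of relative size [5 d] occur, one from [app] and one from replacing [c] by
     [Num.conj s]. *)
  pose d := Num.min (e / 10) 1.
  have d0 : 0 < d by rewrite lt_min divr_gt0//= ltr01.
  have d1 : d <= 1 by rewrite ge_min lexx orbT.
  have de : d * 10 <= e by rewrite -ler_pdivlMr// ge_min lexx.
  have [y y1 [c c1 cP]] := app d d0 d1; exists y => // T.
  have cs : normc (c - Num.conj s) <= d * 5.
    have -> : c - Num.conj s = - ('[(1 : B) y, y] - c * s) * Num.conj s.
      by rewrite op1E nm1_in// mulNr mulrBl mul1r -mulrA ss mulr1 opprB.
    rewrite normcM normcN normc_conj s1 mulr1 (le_trans (cP 1))//.
    by rewrite (numerical_radius1 H_infinite) mulr1.
  have -> : '[T y, y] - Num.conj s * f T = ('[T y, y] - c * f T) + (c - Num.conj s) * f T by ring.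
  apply: (le_trans (normcD _ _)); rewrite normcM.
  have h1 := cP T.
  have w0 := numerical_radius_ge0 H_infinite T.
  have h2 : normc (c - Num.conj s) * normc (f T) <= d * 5 * w T.
    by rewrite ler_pM ?normc_ge0.
  have h3 : d * 10 * w T <= e * w T by rewrite ler_wpM2r.
  have h4 : d * 10 * w T = d * (5 * w T) + d * 5 * w T by ring.
  lra.
exists s; split=> //; exists y => // T.
by rewrite -yP mulrA ss mul1r.
Qed.

End VectorStates.

(** * Maps that pull back vector states are Jordan morphisms *)

Section Jordan.
Variables (R : realType) (H : hilbertType R).
Hypothesis H_infinite : infinite_dimensional H.
Local Notation C := R[i].
Local Notation B := (bounded_op H).
Implicit Types (x y z u v : H) (a b c : C) (A S T X Y Z : B).

Lemma form_eq_unit S T : (forall x, nm x = 1 -> '[S x, x] = '[T x, x]) -> S = T.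
Proof.
move=> h; apply: form_eq => x; have [->|/normalize[y y1 ->]] := eqVneq x 0; first by rewrite !in0r.
by rewrite !mapZ !(inZl, inZr) h.
Qed.

(** For orthonormal [x0] and [y], the vectors [x0 + y] and [x0 - y] are orthogonal too, and this
    makes the diagonal values at [x0] and [y] equal. *)
Lemma orth_eq0_scalar T : (forall x y, '[x, y] = 0 -> '[T x, y] = 0) -> exists c, T = c *: (1 : B).
Proof.
move=> h; have [x0 x1] := exists_unit H_infinite; exists '[T x0, x0]; apply: form_eq => x.
have unit_form y : nm y = 1 -> '[y, x0] = 0 -> '[T y, y] = '[T x0, x0].
  move=> y1 yx; have xy := orthC yx.
  have := h (x0 + y) (x0 - y); rewrite !ipE !nm1_in// xy yx subr0 add0r subrr => /(_ erefl).
  rewrite !mapD !ipE (h _ _ xy) (h _ _ yx) add0r addr0 => /eqP.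
  by rewrite subr_eq0 => /eqP.
have {1 2}-> : x = '[x, x0] *: x0 + orth_part x0 x by rewrite addrC subrK.
have o := orth_part_orth x x1; have o' := orthC o.
rewrite opZE op1E inZl nm_sqC (orth_part_nm _ x1) rmorphD /= normc_sq.
move: o o'; move: (orth_part x0 x) => y o o'.
rewrite mapD mapZ !ipE (h _ _ o) (h _ _ o') !mulr0 addr0 add0r mulrDr; congr (_ + _).
  by rewrite [RHS]mulrC mulrA.
have [->|y0] := eqVneq y 0; first by rewrite in0r nm0 expr0n mulr0.
have [v v1 e] := normalize y0.
have vx : '[v, x0] = 0.
  move: o => /eqP; rewrite e inZl mulf_eq0 => /orP[|/eqP//].
  by rewrite fmorph_eq0 nm_eq0 (negbTE y0).
by rewrite {1 2}e mapZ inZl inZr unit_form// conjE conjc_real mulrA -rmorphM -expr2 mulrC.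
Qed.

(** For [t = p + iq] the hypothesis reads [|1 + t b + conj(t) a + |t|^2 d| = 1 + |t|^2]. The linear
    terms give [b = - conj a], so [t b + conj(t) a = 2 i Im(conj(t) a)]. The quadratic terms then
    make the square of [Im(conj(t) a)] proportional to [|t|^2], which forces [a = 0]. The evaluation
    points isolate these coefficients. *)
Lemma real_unimodular_form (a1 a2 b1 b2 d1 d2 : R) :
  (forall p q, (1 + p * b1 - q * b2 + p * a1 + q * a2 + (p ^+ 2 + q ^+ 2) * d1) ^+ 2
     + (p * b2 + q * b1 + p * a2 - q * a1 + (p ^+ 2 + q ^+ 2) * d2) ^+ 2
     = (1 + p ^+ 2 + q ^+ 2) ^+ 2) -> a1 = 0 /\ a2 = 0.
Proof.
move=> h.
have e1 : b1 = - a1.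
  have := h 1 0; have := h (-1) 0; have := h 2 0; have := h (-2) 0; lra.
have e2 : b2 = a2.
  have := h 0 1; have := h 0 (-1); have := h 0 2; have := h 0 (-2); lra.
rewrite e1 e2 in h.
have h1 : a1 ^+ 2 = a2 ^+ 2.
  have := h 1 0; have := h (-1) 0; have := h 0 1; have := h 0 (-1); lra.
have h2 : a1 * a2 = 0.
  have := h 1 0; have := h (-1) 0; have := h 2 0; have := h (-2) 0; have := h 1 1; have := h (-1) (-1); lra.
have /eqP := h2; rewrite mulf_eq0 => /orP[]/eqP e; rewrite e expr0n /= in h1 *; split=> //.
  by apply/eqP; rewrite -sqrf_eq0 -h1.
by apply/eqP; rewrite -sqrf_eq0 h1.
Qed.

(** Numerical ranges are convex, and a convex subset of the unit circle is a point. The direct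
    argument compares the values at [x + t *: y] for orthonormal [x] and [y], rotated so that the
    value at [x] is [1]. *)
Lemma unimodular_form_scalar T : (forall x, nm x = 1 -> normc '[T x, x] = 1) ->
  exists c, T = c *: (1 : B).
Proof.
move=> h; apply: orth_eq0_scalar.
have hn x : normc '[T x, x] = nm x ^+ 2.
  have [->|/normalize[y y1 ->]] := eqVneq x 0; first by rewrite in0r normc0 nm0 expr0n.
  rewrite mapZ inZl inZr !normcM normc_conj h// mulr1 nmZ y1 mulr1 normc_real.
  by rewrite ger0_norm ?nm_ge0// expr2.
have unit_case x y : nm x = 1 -> nm y = 1 -> '[x, y] = 0 -> '[T x, y] = 0.
  move=> x1 y1 xy.
  have cc : '[T x, x] * Num.conj '[T x, x] = 1 by rewrite -normc_sq h// expr1n.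
  suff : Num.conj '[T x, x] * '[T x, y] = 0.
    by move/eqP; rewrite mulf_eq0 => /orP[|/eqP//]; rewrite fmorph_eq0 -normc_eq0 h// oner_eq0.
  have := @real_unimodular_form (complex.Re (Num.conj '[T x, x] * '[T x, y]))
    (complex.Im (Num.conj '[T x, x] * '[T x, y])) (complex.Re (Num.conj '[T x, x] * '[T y, x]))
    (complex.Im (Num.conj '[T x, x] * '[T y, x])) (complex.Re (Num.conj '[T x, x] * '[T y, y]))
    (complex.Im (Num.conj '[T x, x] * '[T y, y])).
  set a := _ * '[T x, y]; set b := _ * '[T y, x]; set d := _ * '[T y, y] => hr.
  have [|r1 r2] := hr; last by rewrite [LHS]RImE r1 r2 !rmorph0 mulr0 addr0.
  move=> p q; pose t : C := p +i* q.
  have nt : nm (x + t *: y) ^+ 2 = 1 + p ^+ 2 + q ^+ 2.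
    by rewrite pythagoras ?inZr ?xy ?mulr0// nmZ x1 y1 mulr1 normc_sqE expr1n addrA.
  have := hn (x + t *: y); rewrite nt.
  have -> : normc '[T (x + t *: y), x + t *: y] = normc (1 + t * b + Num.conj t * a + (t * Num.conj t) * d).
    rewrite -[LHS]mul1r -(h x x1) -(normc_conj '[T x, x]) -normcM; congr normc.
    rewrite mapD mapZ !ipE -cc /a /b /d; ring.
  move=> /(congr1 (fun r => r ^+ 2)); rewrite normc_sqE => <-.
  congr (_ ^+ 2 + _ ^+ 2); rewrite !(ReD, ReM, ImM, ReC, ImC) /=; first by ring.
  rewrite -!/(complex.Im _).
  have ImD (m n : C) : complex.Im (m + n) = complex.Im m + complex.Im n by case: m n => [? ?] [? ?].
  by rewrite !ImD !(ReM, ImM, ReC, ImC) /=; ring.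
move=> x y xy.
have [->|x0] := eqVneq x 0; first by rewrite map0 in0l.
have [->|y0] := eqVneq y 0; first by rewrite in0r.
have [u u1 xu] := normalize x0; have [v v1 yv] := normalize y0.
rewrite xu yv mapZ inZl inZr unit_case ?mulr0//.
move: xy; rewrite xu yv inZl inZr => /eqP; rewrite !mulf_eq0 !fmorph_eq0 !nm_eq0.
by rewrite (negbTE x0) (negbTE y0) => /eqP.
Qed.

Definition pulls_states (psi : B -> B) := linear psi /\
  forall x, nm x = 1 -> exists2 y, nm y = 1 & forall T, '[psi T x, x] = '[T y, y].

Section PullsStates.
Variables psi psi' : B -> B.
Hypotheses (psi_vs : pulls_states psi) (psi_vs' : pulls_states psi').
Hypotheses (psiK : cancel psi psi') (psiK' : cancel psi' psi).

Let psi_lin : linear psi := psi_vs.1.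
Let psiD X Y : psi (X + Y) = psi X + psi Y.
Proof. exact: (GRing.semilinear_linear psi_lin).2. Qed.
Let psiZ a X : psi (a *: X) = a *: psi X.
Proof. exact: GRing.scalable_linear. Qed.

Lemma pulls_states1 : psi 1 = 1.
Proof.
apply: form_eq_unit => x x1; have [y y1 ->] := psi_vs.2 x x1.
by rewrite !op1E !nm1_in.
Qed.

Lemma pulls_states_adj X : psi (adjoint X) = adjoint (psi X).
Proof.
apply: form_eq_unit => x x1; have [y y1 yP] := psi_vs.2 x x1.
by rewrite -adjEr [RHS]inC !yP -adjEr -inC.
Qed.

Lemma self_adjoint_form_real A x : adjoint A = A -> '[A x, x] = (complex.Re '[A x, x])%:C.
Proof.
move=> sa; have : Num.conj '[A x, x] = '[A x, x] by rewrite -inC adjEr sa.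
case: ('[A x, x]) => p q; rewrite conjE /= => -[/eqP].
by rewrite -subr_eq0 -opprD oppr_eq0 -mulr2n mulrn_eq0 /= => /eqP ->.
Qed.

Lemma real_form_self_adjoint A :
  (forall x, nm x = 1 -> Num.conj '[A x, x] = '[A x, x]) -> adjoint A = A.
Proof. by move=> h; apply: form_eq_unit => x x1; rewrite -adjEr inC h. Qed.

(** Cauchy-Schwarz for a semidefinite form: a real polynomial [2 p t + q t^2] that is never negative
    has [p = 0]. *)
Lemma nonneg_form_ker A x : adjoint A = A -> (forall y, 0 <= complex.Re '[A y, y]) ->
  '[A x, x] = 0 -> A x = 0.
Proof.
move=> sa pos Ax0; apply: in_injl => v; rewrite in0l.
have reA u : complex.Re '[A x, u] = 0.
  have quad t : 0 <= t * (complex.Re '[A x, u] *+ 2) + t ^+ 2 * complex.Re '[A u, u].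
    have := pos (x + t%:C *: u); rewrite mapD mapZ !ipE Ax0 conjE conjc_real add0r.
    have -> : '[A u, x] = Num.conj '[A x, u] by rewrite -inC adjE sa.
    by rewrite !ReD !ReZ ReC; set p := complex.Re '[A x, u]; set q := complex.Re '[A u, u]; lra.
  apply/eqP; apply: contraT => p0; move: (quad); set p := complex.Re _ in p0 *; set q := complex.Re _ => h.
  have q0 : 0 <= q by exact: pos.
  (* The minimum is at [- p / q]; adding [1] to the denominator includes the case [q = 0]. *)
  have := h (- p / (q + 1)).
  have -> : - p / (q + 1) * (p *+ 2) + (- p / (q + 1)) ^+ 2 * q =
     - (p ^+ 2 / (q + 1) ^+ 2) * (q + 2) by field; rewrite gt_eqF// ltr_wpDl.
  rewrite mulNr oppr_ge0 leNgt mulr_gt0//; last by rewrite ltr_wpDl.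
  by apply: divr_gt0; [rewrite exprn_even_gt0|rewrite exprn_gt0// ltr_wpDl].
rewrite [LHS]RImE reA; have := reA (ii *: v).
by rewrite inZr ii_conj ReM /= oppr0 mul0r mulN1r sub0r opprK => ->; rewrite mulr0 addr0.
Qed.

Lemma dyad_form x z : '[dyad x x z, z] = (normc '[z, x] ^+ 2)%:C.
Proof. by rewrite dyadE inZl (inC z x) normc_sq. Qed.

(** The bounds and ['[T x, x] = 1] make [x] a fixed vector of [T], so [T] is the sum of xx* and a
    positive operator on the complement of [x]. *)
Lemma dyad_le_form T x : nm x = 1 ->
  (forall z, nm z = 1 -> 0 <= '[T z, z] <= 1) -> '[T x, x] = 1 ->
  forall z, nm z = 1 -> '[dyad x x z, z] <= '[T z, z].
Proof.
move=> x1 T01 Tx.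
have sa : adjoint T = T.
  by apply: real_form_self_adjoint => z /T01/andP[T0 _]; apply/eqP; rewrite conj_Creal// ger0_real.
have saD : adjoint (1 - T) = 1 - T by rewrite adjD adjN adj1 sa.
have re01 z : nm z = 1 -> 0 <= complex.Re '[T z, z] <= 1.
  by move=> /T01; rewrite (self_adjoint_form_real _ sa) /= !lecR.
have homog z : 0 <= complex.Re '[T z, z] <= nm z ^+ 2.
  have [->|/normalize[y y1 ->]] := eqVneq z 0; first by rewrite in0r nm0 expr0n /= lexx.
  rewrite mapZ inZl inZr conjE conjc_real !ReZ nmZ y1 mulr1 normc_real ger0_norm ?nm_ge0//.
  have /andP[p0 p1] := re01 y y1; rewrite !mulr_ge0 ?nm_ge0//= expr2 mulrA.
  by rewrite ler_piMr// mulr_ge0 ?nm_ge0.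
have TxE : T x = x.
  have : (1 - T) x = 0.
    apply: nonneg_form_ker => // [y|].
      by rewrite !opE inDl inNl ReD ReN -nm_sq subr_ge0; have /andP[] := homog y.
    by rewrite !opE inDl inNl Tx nm1_in// subrr.
  by rewrite !opE => /eqP; rewrite subr_eq0 => /eqP.
move=> z z1; rewrite dyad_form (self_adjoint_form_real _ sa) lecR.
have o := orth_part_orth z x1; have o' := orthC o.
have o2 : '[T (orth_part x z), x] = 0 by rewrite adjE sa TxE.
have -> : '[T z, z] = '[z, x] * Num.conj '[z, x] + '[T (orth_part x z), orth_part x z].
  rewrite {1 2}(_ : z = '[z, x] *: x + orth_part x z); last by rewrite addrC subrK.
  move: o' o2; move: (orth_part x z) => y o' o2.
  by rewrite mapD mapZ TxE !ipE o' o2 nm1_in// !(mulr0, addr0, add0r, mulr1).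
rewrite -normc_sq ReD /= lerDl; by have /andP[] := homog (orth_part x z).
Qed.

Lemma dyad_form01 x z : nm x = 1 -> nm z = 1 -> 0 <= '[dyad x x z, z] <= 1.
Proof.
move=> x1 z1; rewrite dyad_form !lecR sqr_ge0 /= expr_le1// ?normc_ge0//.
by have := CauchySchwarz z x; rewrite x1 z1 mulr1.
Qed.

(** By [dyad_le_form], [psi' (dyad u u)] dominates [dyad u' u'] and [psi (dyad u' u')] dominates
    [dyad u u]. Applying [psi], which is positive, to the first inequality reverses the second. *)
Lemma pulls_dyad u u' : nm u = 1 -> nm u' = 1 ->
  (forall T, '[psi T u, u] = '[T u', u']) -> psi (dyad u' u') = dyad u u.
Proof.
move=> u1 u1' h.
have h' T : '[psi' T u', u'] = '[T u, u] by rewrite -h psiK'.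
have dd (x : H) : nm x = 1 -> '[dyad x x x, x] = 1.
  by move=> x1; rewrite dyad_form nm1_in// normc1 expr1n.
pose r := psi' (dyad u u); pose q := psi (dyad u' u').
have r01 z : nm z = 1 -> 0 <= '[r z, z] <= 1.
  by move=> /psi_vs'.2[y y1 ->]; exact: dyad_form01.
have q01 z : nm z = 1 -> 0 <= '[q z, z] <= 1.
  by move=> /psi_vs.2[y y1 ->]; exact: dyad_form01.
have le1 := dyad_le_form u1' r01; have le2 := dyad_le_form u1 q01.
rewrite /r h' dd// in le1; rewrite /q h dd// in le2.
apply: form_eq_unit => z z1; apply: le_anti; rewrite le2// andbT.
have [y y1 yP] := psi_vs.2 z z1.
by rewrite yP (le_trans (le1 erefl y y1))// -yP psiK'.
Qed.

Lemma pulls_transition u u' z z' : nm u = 1 -> nm u' = 1 ->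
  (forall T, '[psi T u, u] = '[T u', u']) -> (forall T, '[psi T z, z] = '[T z', z']) ->
  normc '[z, u] = normc '[z', u'].
Proof.
move=> u1 u1' hu hz; have := hz (dyad u' u').
rewrite (pulls_dyad u1 u1' hu) !dyad_form => /complexI/eqP.
by rewrite eqrXn2 ?normc_ge0// => /eqP.
Qed.

Lemma pulls_vector z : exists2 z', nm z' = nm z & forall T, '[psi T z, z] = '[T z', z'].
Proof.
have [->|/normalize[y y1 e]] := eqVneq z 0; first by exists 0 => // T; rewrite !in0r.
have [y' y1' yP] := psi_vs.2 y y1.
exists ((nm z)%:C *: y') => [|T].
  by rewrite nmZ y1' mulr1 normc_real ger0_norm ?nm_ge0.
by rewrite {1 2}e !mapZ !(inZl, inZr) yP.
Qed.

(* First-order comparison: the vector state at [u + t psi(A)u] is pulled back to some [z'], whose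
   component along [u'] has modulus [1] and whose complement has norm [t |psi(A)u|]. *)
Lemma pulls_le A u u' : adjoint A = A -> nm u = 1 -> nm u' = 1 ->
  (forall T, '[psi T u, u] = '[T u', u']) -> '[A u', u'] = 0 -> nm (psi A u) <= nm (A u').
Proof.
move=> sa u1 u1' hu Au0.
have saP : adjoint (psi A) = psi A by rewrite -pulls_states_adj sa.
set v := psi A u; have vu : '[v, u] = 0 by rewrite /v hu.
have [->|v0] := eqVneq v 0; first by rewrite nm0 nm_ge0.
have vp : 0 < nm v by rewrite nm_gt0.
have [M M0 MA] := op_bound A; have [N N0 NA] := op_bound (psi A).
(* The tolerance of the limit argument is the parameter [t] itself: after division by [2 t * nm v],
   the second-order terms amount to [t] times this constant. *)
apply: (@eps_le _ _ _ (nm v * (M + N) / 2)) => t t0.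
have [z' zn zP] := pulls_vector (u + t%:C *: v).
have zsq : nm z' ^+ 2 = 1 + (t * nm v) ^+ 2.
  rewrite zn pythagoras ?inZr ?(orthC vu) ?mulr0// nmZ u1 expr1n normc_real.
  by rewrite ger0_norm ?ltW.
pose a := '[z', u']; pose y := orth_part u' z'.
have a1 : normc a = 1.
  rewrite /a -(pulls_transition u1 u1' hu zP) inDl inZl vu mulr0 addr0 nm1_in//.
  exact: normc1.
have yn : nm y = t * nm v.
  apply/eqP; rewrite -(@eqrXn2 _ 2) ?nm_ge0// ?mulr_ge0 ?nm_ge0 ?(ltW t0)//.
  have := orth_part_nm z' u1'; rewrite zsq -/a a1 expr1n => /addrI ->.
  exact: eqxx.
have zE : z' = a *: u' + y by rewrite /y /orth_part addrC subrK.
have := congr1 (@complex.Re R) (zP A).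
have -> : complex.Re '[psi A (u + t%:C *: v), u + t%:C *: v] =
    (t * nm v ^+ 2) *+ 2 + t ^+ 2 * complex.Re '[psi A v, v].
  have uv : '[psi A v, u] = '[v, v] by rewrite adjE saP.
  rewrite mapD mapZ !ipE uv -/v vu conjE conjc_real add0r !ReD !ReZ -nm_sq; ring.
have h1 : complex.Re '[A z', z'] <= (nm (A u') * nm y) *+ 2 + M * nm y ^+ 2.
  have yu : '[A y, u'] = Num.conj '[A u', y] by rewrite adjE sa -inC.
  have -> : complex.Re '[A z', z'] = complex.Re (a * '[A u', y]) *+ 2 + complex.Re '[A y, y].
    rewrite zE; move: (y) yu => y0 yu.
    rewrite mapD mapZ !ipE yu Au0 !mulr0 add0r !ReD -rmorphM ReC; ring.
  have b1 : complex.Re (a * '[A u', y]) <= nm (A u') * nm y.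
    apply: (le_trans (ler_norm _)); apply: (le_trans (Re_le_normc _)).
    by rewrite normcM a1 mul1r CauchySchwarz.
  have b2 : complex.Re '[A y, y] <= M * nm y ^+ 2.
    apply: (le_trans (ler_norm _)); apply: (le_trans (Re_le_normc _)).
    by rewrite (le_trans (CauchySchwarz _ _))// expr2 mulrA ler_wpM2r ?nm_ge0.
  lra.
have h2 : - (N * nm v ^+ 2) <= complex.Re '[psi A v, v].
  have : `|complex.Re '[psi A v, v]| <= N * nm v ^+ 2.
    apply: (le_trans (Re_le_normc _)).
    by rewrite (le_trans (CauchySchwarz _ _))// expr2 mulrA ler_wpM2r ?nm_ge0.
  by rewrite ler_norml => /andP[].
move=> e; rewrite -e yn in h1.
have tn : 0 < t * nm v by rewrite mulr_gt0.
rewrite -(ler_pM2l tn).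
have h3 : - (t ^+ 2 * (N * nm v ^+ 2)) <= t ^+ 2 * complex.Re '[psi A v, v].
  by rewrite -mulrN ler_wpM2l ?sqr_ge0.
have -> : t * nm v * (nm (A u') + t * (nm v * (M + N) / 2)) =
  nm (A u') * (t * nm v) + (M * (t * nm v) ^+ 2) / 2 + (t ^+ 2 * (N * nm v ^+ 2)) / 2 by field.
have -> : t * nm v * nm v = t * nm v ^+ 2 by ring.
lra.
Qed.
End PullsStates.

Section JordanMorphism.
Variables psi psi' : B -> B.
Hypotheses (psi_vs : pulls_states psi) (psi_vs' : pulls_states psi').
Hypotheses (psiK : cancel psi psi') (psiK' : cancel psi' psi).

Let psi_lin : linear psi := psi_vs.1.
Let psiD X Y : psi (X + Y) = psi X + psi Y.
Proof. exact: (GRing.semilinear_linear psi_lin).2. Qed.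
Let psiZ a X : psi (a *: X) = a *: psi X.
Proof. exact: GRing.scalable_linear. Qed.
Let psiN X : psi (- X) = - psi X.
Proof. by rewrite -scaleN1r psiZ scaleN1r. Qed.

(** [pulls_le] applies to [psi] and to [psi'] once [A] is shifted to have value [0] at [u']; the
    shift changes both squared norms by [normc s ^+ 2]. *)
Lemma pulls_square_nm A u u' : adjoint A = A -> nm u = 1 -> nm u' = 1 ->
  (forall T, '[psi T u, u] = '[T u', u']) -> nm (psi A u) = nm (A u').
Proof.
move=> sa u1 u1' hu.
have h' T : '[psi' T u', u'] = '[T u, u] by rewrite -hu psiK'.
pose s := '[A u', u'].
have sr : Num.conj s = s by rewrite /s -inC adjEr sa.
pose A0 := A - s *: (1 : B).
have sa0 : adjoint A0 = A0 by rewrite adjD adjN adjZ adj1 sa sr.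
have A00 : '[A0 u', u'] = 0 by rewrite !opE inDl inNl inZl nm1_in// mulr1 subrr.
have pA0 : psi A0 = psi A - s *: (1 : B) by rewrite psiD psiN psiZ (pulls_states1 psi_vs).
have e0 : nm (psi A0 u) = nm (A0 u').
  apply/eqP; rewrite eq_le (pulls_le psi_vs psi_vs' psiK')//=.
  have h2 := pulls_le psi_vs' psi_vs psiK (A := psi A0) _ u1' u1 h'.
  by rewrite psiK in h2; apply: h2; [rewrite -(pulls_states_adj psi_vs) sa0|rewrite hu].
have split (T : B) (v : H) : nm v = 1 -> '[(T - s *: (1 : B)) v, v] = 0 ->
    nm (T v) ^+ 2 = nm ((T - s *: (1 : B)) v) ^+ 2 + normc s ^+ 2.
  move=> v1 o; have {1}-> : T v = (T - s *: (1 : B)) v + s *: v by rewrite !opE subrK.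
  by rewrite pythagoras ?inZr ?o ?mulr0// nmZ v1 mulr1.
apply/eqP; rewrite -(@eqrXn2 _ 2) ?nm_ge0// (split A)// (split (psi A))//.
  by rewrite -pA0 e0.
by rewrite -pA0 hu.
Qed.

Lemma pulls_square A : adjoint A = A -> psi (A * A) = psi A * psi A.
Proof.
move=> sa; apply: form_eq_unit => u u1; have [u' u1' hu] := psi_vs.2 u u1.
have saP : adjoint (psi A) = psi A by rewrite -(pulls_states_adj psi_vs) sa.
by rewrite hu !opME adjE [RHS]adjE sa saP !nm_sqC (pulls_square_nm sa u1 u1' hu).
Qed.

Let sqD X Y : (X + Y) * (X + Y) = (X * X + Y * Y) + (X * Y + Y * X).
Proof. by rewrite mulrDl !mulrDr [Y * X + _]addrC addrACA. Qed.

Let polarize X Y : psi (X * X) = psi X * psi X -> psi (Y * Y) = psi Y * psi Y ->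
  psi ((X + Y) * (X + Y)) = psi (X + Y) * psi (X + Y) ->
  psi (X * Y + Y * X) = psi X * psi Y + psi Y * psi X.
Proof. by move=> hX hY; rewrite sqD [X in X = _]psiD [psi (X + Y)]psiD sqD psiD hX hY => /addrI. Qed.

Lemma cartesian_decomposition X :
  exists A S, [/\ adjoint A = A, adjoint S = S & X = A + ii *: S].
Proof.
exists (2^-1 *: (X + adjoint X)), ((2^-1 * - ii) *: (X - adjoint X)).
have h2 : Num.conj 2^-1 = 2^-1 :> C by rewrite fmorphV rmorph_nat.
split.
- by rewrite adjZ adjD adjK h2 addrC.
- by rewrite adjZ adjD adjN adjK rmorphM rmorphN /= ii_conj h2 opprK mulrN scaleNr -scalerN opprB.
- rewrite scalerA mulrCA mulrN ii_sq opprK mulr1 -scalerDr addrACA subrr addr0.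
  exact: scaler_half.
Qed.

(** The self-adjoint case, polarized, gives the mixed term [A * S + S * A] of the square of
    [A + ii *: S]. *)
Lemma pulls_squares X : psi (X * X) = psi X * psi X.
Proof.
have [A [S [sa ss ->]]] := cartesian_decomposition X.
have sAS : adjoint (A + S) = A + S by rewrite adjD sa ss.
have p := polarize (pulls_square sa) (pulls_square ss) (pulls_square sAS).
have e (U V : B) : (U + ii *: V) * (U + ii *: V) = (U * U + (ii * ii) *: (V * V)) + ii *: (U * V + V * U).
  by rewrite sqD !opZMl !opZMr scalerA scalerDr.
have -> : psi (A + ii *: S) = psi A + ii *: psi S by rewrite psiD psiZ.
by rewrite !e [LHS]psiD [psi (_ + (ii * ii) *: _)]psiD !psiZ p (pulls_square sa) (pulls_square ss).
Qed.

Lemma pulls_jordan X Y : psi (X * Y + Y * X) = psi X * psi Y + psi Y * psi X.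
Proof. by apply: polarize; apply: pulls_squares. Qed.

(** With [X o Y = X Y + Y X] this reads [2 X Z X = X o (X o Z) - X^2 o Z], so a Jordan morphism
    preserves [X Z X]. *)
Let tripleE X Z : (X * Z * X) *+ 2 =
  (X * (X * Z + Z * X) + (X * Z + Z * X) * X) - (X * X * Z + Z * (X * X)).
Proof.
rewrite mulrDr mulrDl !mulrA [X * X * Z + X * Z * X]addrC addrACA.
by rewrite addrK -mulr2n.
Qed.

Lemma pulls_triple X Z : psi (X * Z * X) = psi X * psi Z * psi X.
Proof.
have h : psi (X * Z * X) *+ 2 = (psi X * psi Z * psi X) *+ 2.
  rewrite tripleE mulr2n -psiD -mulr2n tripleE psiD psiN pulls_jordan pulls_jordan.
  by rewrite [psi (X * X * Z + _)]pulls_jordan pulls_squares.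
exact: mulr2n_inj h.
Qed.

End JordanMorphism.
End Jordan.

(** * Equivariant products pulled back along [Phi] *)

Section InvariantMap.
Variables (R : realType) (H : hilbertType R).
Hypothesis H_infinite : infinite_dimensional H.
Local Notation C := R[i].
Local Notation B := (bounded_op H).
Local Notation w := (@numerical_radius R H).
Implicit Types (x y z u v : H) (a b c : C) (A S T X Y Z V : B).

Definition conjugate V T : B := V * T * adjoint V.

Lemma conjugateD V S T : conjugate V (S + T) = conjugate V S + conjugate V T.
Proof. by rewrite /conjugate mulrDr mulrDl. Qed.
Lemma conjugateZ V a T : conjugate V (a *: T) = a *: conjugate V T.
Proof. by rewrite /conjugate opZMr opZMl. Qed.
Lemma conjugate_dyad V x y : conjugate V (dyad x y) = dyad (V x) (V y).
Proof. by rewrite /conjugate mul_op_dyad mul_dyad_op adjK. Qed.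
Lemma conjugateK V T : unitary V -> conjugate (adjoint V) (conjugate V T) = T.
Proof. by move=> [_ h]; rewrite /conjugate adjK !mulrA h mul1r -mulrA h mulr1. Qed.
Lemma conjugateK' V T : unitary V -> conjugate V (conjugate (adjoint V) T) = T.
Proof. by move=> [h _]; rewrite /conjugate adjK !mulrA h mul1r -mulrA h mulr1. Qed.
Lemma conjugate1 V : unitary V -> conjugate V 1 = 1.
Proof. by move=> [h _]; rewrite /conjugate mulr1. Qed.

Variables Phi Psi : B -> B.
Hypotheses (Phi_lin : linear Phi) (Psi_lin : linear Psi).
Hypotheses (PhiK : cancel Phi Psi) (PsiK : cancel Psi Phi).
Hypothesis Phi_inv : forall V T, unitary V -> w (Phi (conjugate V T)) = w (Phi T).

Let PhiD X Y : Phi (X + Y) = Phi X + Phi Y.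
Proof. exact: (GRing.semilinear_linear Phi_lin).2. Qed.
Let Phi0 : Phi 0 = 0. Proof. by apply: (addrI (Phi 0)); rewrite -PhiD !addr0. Qed.
Let PhiZ a X : Phi (a *: X) = a *: Phi X.
Proof. exact: GRing.scalable_linear. Qed.
Let PsiD X Y : Psi (X + Y) = Psi X + Psi Y.
Proof. exact: (GRing.semilinear_linear Psi_lin).2. Qed.
Let Psi0 : Psi 0 = 0. Proof. by apply: (addrI (Psi 0)); rewrite -PsiD !addr0. Qed.
Let PsiZ a X : Psi (a *: X) = a *: Psi X.
Proof. exact: GRing.scalable_linear. Qed.

Let psi V X := Phi (conjugate V (Psi X)).

Let psi_lin V : linear (psi V).
Proof. by move=> a X Y; rewrite /psi Psi_lin conjugateD conjugateZ Phi_lin. Qed.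
Let psiK V : unitary V -> cancel (psi V) (psi (adjoint V)).
Proof. by move=> uV X; rewrite /psi PhiK conjugateK. Qed.
Let psiK' V : unitary V -> cancel (psi (adjoint V)) (psi V).
Proof. by move=> uV X; rewrite /psi PhiK conjugateK'. Qed.

Let psi_state V x : unitary V -> nm x = 1 -> exists s : C, normc s = 1 /\
  exists2 y, nm y = 1 & forall T, '[psi V T x, x] = s * '[T y, y].
Proof.
move=> uV x1; apply: (isometry_vector_state H_infinite (psi_lin V) (psi_lin (adjoint V))) => //.
- exact: psiK'.
- exact: psiK.
- by move=> X; rewrite /psi Phi_inv// PsiK.
Qed.

Let unit_eigen V : unitary V -> exists c, conjugate V (Psi 1) = c *: Psi 1.
Proof.
move=> uV; have [c cP] : exists c, psi V 1 = c *: (1 : B).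
  apply: (unimodular_form_scalar H_infinite) => x x1; have [s [s1 [y y1 ->]]] := psi_state uV x1.
  by rewrite op1E nm1_in// mulr1.
by exists c; rewrite -[LHS]PhiK -/(psi V 1) cP PsiZ.
Qed.

(** [Z = Psi 1] is an eigenvector of every conjugation. A reflection in a [u] orthogonal to [x]
    fixes [x], so [Z x] is an eigenvector of it: orthogonal to [u] or on its line. A nonzero
    component along [y'] would put [Z x] on the line of [y'] and also on that of [y' + z]. *)
Let unit_scalar : exists c, Psi 1 = c *: (1 : B).
Proof.
set Z := Psi 1.
have K x u : nm u = 1 -> '[x, u] = 0 -> '[Z x, u] <> 0 -> Z x = '[Z x, u] *: u.
  move=> u1 xu Zxu; have uV := reflection_unitary u1 (normc_mu R).
  have [c cP] := unit_eigen uV.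
  have e : reflection u mu (Z x) = c *: Z x.
    have := congr1 (fun T : B => T x) cP; rewrite /conjugate -/Z !opE adj_reflection reflection_orth//.
  have [h1 h2] := reflection_eigen u1 e.
  apply: h1 => c1; apply: Zxu; apply: h2; rewrite c1 => h; exact: (@mu_neq1 R).
apply: (orth_eq0_scalar H_infinite) => x y xy; apply: contrapT => Zxy.
have y0 : y != 0 by apply: contra_notN Zxy => /eqP ->; rewrite in0r.
have [y' y1 yE] := normalize y0.
have ny0 : (nm y)%:C != 0 :> C by rewrite fmorph_eq0 nm_eq0.
have xy' : '[x, y'] = 0.
  by move: xy; rewrite yE inZr conjE conjc_real => /eqP; rewrite mulf_eq0 (negbTE ny0) => /eqP.
have Zxy' : '[Z x, y'] <> 0 by move=> h; apply: Zxy; rewrite yE inZr h mulr0.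
have [z z1 zP] := exists_ortho H_infinite [:: x; y'].
have zx : '[z, x] = 0 by apply: zP; rewrite !inE eqxx.
have zy : '[z, y'] = 0 by apply: zP; rewrite !inE eqxx orbT.
have yz := orthC zy; have xz := orthC zx.
have e1 := K x y' y1 xy' Zxy'.
have Zxz : '[Z x, z] = 0 by rewrite e1 inZl yz mulr0.
have s0 : y' + z != 0.
  apply/eqP => /(congr1 (fun v => '[v, y'])); rewrite inDl zy addr0 in0l nm1_in// => /eqP.
  by rewrite oner_eq0.
have [u u1 uE] := normalize s0.
have ns0 : (nm (y' + z))%:C != 0 :> C by rewrite fmorph_eq0 nm_eq0.
have xu : '[x, u] = 0.
  have : '[x, y' + z] = 0 by rewrite inDr xy' xz addr0.
  by rewrite uE inZr conjE conjc_real => /eqP; rewrite mulf_eq0 (negbTE ns0) => /eqP.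
have Zxu : '[Z x, u] <> 0.
  move=> h; apply: Zxy'; have : '[Z x, y' + z] = 0 by rewrite uE inZr h mulr0.
  by rewrite inDr Zxz addr0.
have e2 := K x u u1 xu Zxu.
have : '[Z x, y' - z] = 0.
  have uyz : '[u, y' - z] = 0.
    have : (nm (y' + z))%:C * '[u, y' - z] = 0.
      by rewrite -inZl -uE inBr !inDl !nm1_in// yz zy addr0 add0r subrr.
    by move/eqP; rewrite mulf_eq0 (negbTE ns0) => /eqP.
  by rewrite e2 inZl uyz mulr0.
by rewrite inBr Zxz subr0.
Qed.

Lemma invariant_scalar_image : exists c, Phi (c *: (1 : B)) = 1.
Proof. by have [c cP] := unit_scalar; exists c; rewrite -[RHS]PsiK cP. Qed.

Let psi_pulls V : unitary V -> pulls_states (psi V).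
Proof.
move=> uV; split; first exact: psi_lin.
have psi1 : psi V 1 = 1.
  by have [c cP] := unit_scalar; rewrite /psi cP conjugateZ conjugate1// -cP PsiK.
move=> x x1; have [s [s1 [y y1 h]]] := psi_state uV x1.
exists y => // T; have := h 1; rewrite psi1 !op1E !nm1_in// mulr1 => es.
by rewrite h -es mul1r.
Qed.

Let psi_Phi V A : psi V (Phi A) = Phi (conjugate V A).
Proof. by rewrite /psi PhiK. Qed.

Definition pull_triple A X := Psi (Phi A * Phi X * Phi A).
(** The triple product treats one xy* at a time; the Jordan product and the adjoint relate the
    images of different ones. *)
Definition pull_jordan A S := Psi (Phi A * Phi S + Phi S * Phi A).
Definition pull_adjoint A := Psi (adjoint (Phi A)).

Lemma conjugate_triple V A X : unitary V ->
  conjugate V (pull_triple A X) = pull_triple (conjugate V A) (conjugate V X).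
Proof.
move=> uV; rewrite /pull_triple -[LHS]PhiK -/(psi V _).
rewrite (pulls_triple (psi_pulls uV) (psi_pulls (unitary_adj uV)) (psiK uV) (psiK' uV)).
by rewrite !psi_Phi.
Qed.

Lemma conjugate_jordan V A X : unitary V ->
  conjugate V (pull_jordan A X) = pull_jordan (conjugate V A) (conjugate V X).
Proof.
move=> uV; rewrite /pull_jordan -[LHS]PhiK -/(psi V _).
rewrite (pulls_jordan (psi_pulls uV) (psi_pulls (unitary_adj uV)) (psiK uV) (psiK' uV)).
by rewrite !psi_Phi.
Qed.

Lemma conjugate_adjoint V A : unitary V ->
  conjugate V (pull_adjoint A) = pull_adjoint (conjugate V A).
Proof.
move=> uV; rewrite /pull_adjoint -[LHS]PhiK -/(psi V _).
by rewrite (pulls_states_adj (psi_pulls uV)) !psi_Phi.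
Qed.

Lemma pull_tripleZ a A X : pull_triple (a *: A) X = (a * a) *: pull_triple A X.
Proof. by rewrite /pull_triple PhiZ !opZMl opZMr PsiZ PsiZ scalerA. Qed.
Lemma pull_triple_linear A : linear (pull_triple A).
Proof. by move=> a X Y; rewrite /pull_triple Phi_lin mulrDr mulrDl opZMr opZMl Psi_lin. Qed.
Lemma pull_jordanZl a A S : pull_jordan (a *: A) S = a *: pull_jordan A S.
Proof. by rewrite /pull_jordan PhiZ opZMl opZMr -scalerDr PsiZ. Qed.
Lemma pull_jordanZr a A S : pull_jordan A (a *: S) = a *: pull_jordan A S.
Proof. by rewrite /pull_jordan PhiZ opZMl opZMr -scalerDr PsiZ. Qed.
Lemma pull_adjointZ a A : pull_adjoint (a *: A) = Num.conj a *: pull_adjoint A.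
Proof. by rewrite /pull_adjoint PhiZ adjZ PsiZ. Qed.

Lemma dyad_left_right S (x y b d : H) : S = dyad x b -> S = dyad d y -> nm y = 1 ->
  exists g, S = g *: dyad x y.
Proof.
move=> e1 e2 y1; exists '[y, b]; rewrite e2 -dyadZl; congr dyad.
by have := congr1 (fun T : B => T y) e2; rewrite e1 !dyadE nm1_in// scale1r.
Qed.

(** * The image of a single xy* *)

Section Pair.
Variables x y : H.
Hypotheses (x1 : nm x = 1) (y1 : nm y = 1) (xy : '[x, y] = 0).
Let T := dyad x y.
Let Vx := reflection x mu.
Let Vy := reflection y mu.
Let uVx : unitary Vx := reflection_unitary x1 (normc_mu R).
Let uVy : unitary Vy := reflection_unitary y1 (normc_mu R).
Let yx : '[y, x] = 0 := orthC xy.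

Let VxT : conjugate Vx T = mu *: T.
Proof. by rewrite conjugate_dyad /Vx reflection_self// reflection_orth// dyadZl. Qed.
Let VyT : conjugate Vy T = Num.conj mu *: T.
Proof. by rewrite conjugate_dyad /Vy reflection_self// reflection_orth// dyadZr. Qed.

(** Conjugation by [Vx] multiplies [pull_jordan T T] by [mu * mu], which is not a weight. *)
Lemma image_dyad_square : Phi T * Phi T = 0.
Proof.
have e : pull_jordan T T = 0.
  have [h1 h2 h3] := mu2_neq R.
  apply: (weight_none x1 (normc_mu R) (k := mu * mu)) => //.
  rewrite -/(conjugate _ _) conjugate_jordan// VxT pull_jordanZl pull_jordanZr.
  by rewrite scalerA.
apply: mulr2n_inj; rewrite mul0rn mulr2n.
by move: e => /(congr1 Phi); rewrite /pull_jordan PsiK Phi0.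
Qed.

Let triple_weight V k l X : unitary V -> conjugate V T = k *: T -> conjugate V X = l *: X ->
  conjugate V (pull_triple T X) = (k * k * l) *: pull_triple T X.
Proof.
move=> uV VT VX; rewrite conjugate_triple// VT VX pull_tripleZ.
have -> : pull_triple T (l *: X) = l *: pull_triple T X.
  exact: (GRing.scalable_linear (pull_triple_linear T)).
by rewrite scalerA.
Qed.

Let mu_conj : mu * Num.conj mu = 1 :> C.
Proof. by rewrite -normc_sq normc_mu expr1n. Qed.

(* Conjugation by [Vx] multiplies [T] by [mu], so it multiplies the component of
   [pull_triple T X] coming from a component of weight [k] of [X] by [mu * mu * k]. Only
   [k = mu^-1] gives a weight that occurs; likewise for [Vy]. *)
Lemma pull_triple_dyad : exists c, forall X, pull_triple T X = (c * '[X x, y]) *: T.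
Proof.
have [g gP] : exists g, pull_triple T (dyad y x) = g *: T.
  have wx : conjugate Vx (dyad y x) = Num.conj mu *: dyad y x.
    by rewrite conjugate_dyad /Vx reflection_self// reflection_orth// dyadZr.
  have wy : conjugate Vy (dyad y x) = mu *: dyad y x.
    by rewrite conjugate_dyad /Vy reflection_self// reflection_orth// dyadZl.
  have := triple_weight uVx VxT wx; rewrite -mulrA mu_conj mulr1.
  move=> /(weight_left x1 (normc_mu R) (@mu_neq1 R) (@mu_neqC R))/(_ erefl)[l _].
  have := triple_weight uVy VyT wy; rewrite -mulrA [Num.conj mu * mu]mulrC mu_conj mulr1.
  move=> /(weight_right y1 (normc_mu R) (@mu_neq1 R) (@mu_neqC R))/(_ erefl)[r _].
  exact: dyad_left_right l r y1.
have [n1 n2 n3] := mu2_neq R; have [m1 m2 m3] := mu3_neq R.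
have tD X Y : pull_triple T (X + Y) = pull_triple T X + pull_triple T Y.
  exact: (GRing.semilinear_linear (pull_triple_linear T)).2.
exists g => X.
pose b := orth_part x (adjoint X x); pose d := orth_part x (X x).
have bx : '[b, x] = 0 by exact: orth_part_orth.
have dx : '[d, x] = 0 by exact: orth_part_orth.
have Vq : Vx * proj_orth x = proj_orth x.
  by apply: bounded_op_ext => h; rewrite opME proj_orthE /Vx reflection_orth// orth_part_orth.
have Vq' : proj_orth x * adjoint Vx = proj_orth x.
  by rewrite -{1}(adj_proj_orth x) -adjM Vq adj_proj_orth.
have t0 : pull_triple T ('[X x, x] *: dyad x x) = 0.
  apply: (weight_none x1 (normc_mu R) (k := mu * mu)) => //.
  rewrite -[mu * mu]mulr1; apply: (triple_weight uVx VxT); rewrite scale1r conjugateZ.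
  rewrite conjugate_dyad /Vx reflection_self// dyadZl dyadZr; congr (_ *: _).
  by rewrite scalerA mu_conj scale1r.
have t3 : pull_triple T (proj_orth x * X * proj_orth x) = 0.
  apply: (weight_none x1 (normc_mu R) (k := mu * mu)) => //.
  rewrite -[mu * mu]mulr1; apply: (triple_weight uVx VxT); rewrite scale1r.
  by rewrite /conjugate !mulrA Vq -mulrA Vq'.
have t1 : pull_triple T (dyad x b) = 0.
  apply: (weight_none x1 (normc_mu R) (k := mu * mu * mu)) => //.
  apply: (triple_weight uVx VxT).
  by rewrite conjugate_dyad /Vx reflection_self// reflection_orth// dyadZl.
have dE : d = '[X x, y] *: y + orth_part y d.
  have -> : '[X x, y] = '[d, y] by rewrite (orth_part_in _ yx).
  by rewrite addrC subrK.
have t2 : pull_triple T (dyad (orth_part y d) x) = 0.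
  apply: (weight_none y1 (normc_mu R) (k := Num.conj mu * Num.conj mu)).
  - rewrite -[Num.conj mu * Num.conj mu]mulr1; apply: (triple_weight uVy VyT); rewrite scale1r.
    by rewrite conjugate_dyad /Vy !reflection_orth// orth_part_orth.
  - by rewrite -rmorphM => h; apply: n1; rewrite -[LHS]conjCK h rmorph1.
  - by rewrite -rmorphM => h; apply: n3; rewrite -[LHS]conjCK h.
  - by rewrite -rmorphM => h; apply: n2; rewrite -[LHS]conjCK h conjCK.
rewrite {1}(corner_decomposition x X) !tD t0 t1 t3 !add0r addr0 -/d dE dyadDl tD t2 addr0 dyadZl.
have -> (l : C) Y : pull_triple T (l *: Y) = l *: pull_triple T Y.
  exact: (GRing.scalable_linear (pull_triple_linear T)).
by rewrite gP scalerA mulrC.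
Qed.

Lemma image_dyad_sandwich : exists c, forall X, Phi T * Phi X * Phi T = (c * '[X x, y]) *: Phi T.
Proof.
have [c cP] := pull_triple_dyad; exists c => X.
by rewrite -[LHS]PsiK -/(pull_triple T X) cP PhiZ.
Qed.

(** Sandwiching [Phi X = dyad u v], for suitable [u] and [v], yields a nonzero rank-one operator
    that is also a multiple of [Phi T]. The orthogonality of [a] and [b] expresses that [Phi T] has
    square [0]. *)
Lemma image_dyad_rank1 : exists a b : H, [/\ Phi T = dyad a b, a != 0, b != 0 & '[a, b] = 0].
Proof.
have [c cP] := image_dyad_sandwich.
have T0 : T <> 0.
  by move=> /dyad_eq0[] e; [have := x1|have := y1]; rewrite e nm0 => /eqP; rewrite eq_sym oner_eq0.
have N0 : Phi T <> 0 by move=> e; apply: T0; rewrite -[LHS]PhiK e Psi0.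
have [u Nu] : exists u, Phi T u <> 0.
  by apply: contrapT => h; apply: N0; apply: bounded_op_ext => u; apply: contrapT => Nu; apply: h; exists u.
have [v Nv] : exists v, adjoint (Phi T) v <> 0.
  apply: contrapT => h; apply: N0; rewrite -[LHS]adjK -[RHS]adjK; congr adjoint.
  apply: bounded_op_ext => v; apply: contrapT => Nv; apply: h; exists v => h; apply: Nv.
  by rewrite h adj0.
have := cP (Psi (dyad u v)); rewrite PsiK mul_op_dyad mul_dyad_op => e.
have c0 : c * '[Psi (dyad u v) x, y] != 0.
  by apply/eqP => c0; move: e; rewrite c0 scale0r => /dyad_eq0[].
have eN : Phi T = dyad ((c * '[Psi (dyad u v) x, y])^-1 *: Phi T u) (adjoint (Phi T) v).
  by rewrite dyadZl e scalerA mulVf// scale1r.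
do 2 eexists; split; first exact: eN.
- by rewrite scaler_eq0 negb_or invr_eq0 c0; apply/eqP.
- exact/eqP.
have := image_dyad_square; rewrite {1 2}eN mul_dyad => /eqP.
rewrite scaler_eq0 => /orP[/eqP h|/eqP]; last by rewrite -eN.
exact: h.
Qed.

Lemma pull_adjoint_dyad : exists r, pull_adjoint T = r *: dyad y x.
Proof.
have := conjugate_adjoint T uVx; rewrite VxT pull_adjointZ.
move=> /(weight_right x1 (normc_mu R) (@mu_neq1 R) (@mu_neqC R))/(_ erefl)[r _].
have := conjugate_adjoint T uVy; rewrite VyT pull_adjointZ conjCK.
move=> /(weight_left y1 (normc_mu R) (@mu_neq1 R) (@mu_neqC R))/(_ erefl)[l _].
exact: dyad_left_right l r x1.
Qed.
End Pair.

Lemma exists_orthonormal3 : exists x y z : H, orthonormal3 x y z.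
Proof.
have [x x1 _] := exists_ortho H_infinite [::].
have [y y1 yP] := exists_ortho H_infinite [:: x].
have [z z1 zP] := exists_ortho H_infinite [:: x; y].
exists x, y, z; split=> //; split; apply: orthC; [apply: yP|apply: zP|apply: zP];
  by rewrite !inE eqxx ?orbT.
Qed.

Lemma exists_third x y : nm x = 1 -> nm y = 1 -> '[x, y] = 0 -> exists z, orthonormal3 x y z.
Proof.
move=> x1 y1 xy; have [z z1 zP] := exists_ortho H_infinite [:: x; y].
by exists z; split=> //; split=> //; apply: orthC; apply: zP; rewrite !inE eqxx ?orbT.
Qed.

(** One [r] serves all pairs, because [pull_adjoint] is equivariant and unitaries act transitively
    on orthonormal triples, to which the pairs are completed. *)
Lemma image_dyad_adjoint : exists r, forall x y, nm x = 1 -> nm y = 1 -> '[x, y] = 0 ->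
  adjoint (Phi (dyad x y)) = r *: Phi (dyad y x).
Proof.
have [x0 [y0 [z0 o]]] := exists_orthonormal3.
have [x01 y01 z01 [xy0 _ _]] := o.
have [r rP] := pull_adjoint_dyad x01 y01 xy0.
exists r => x y x1 y1 xy; have [z o'] := exists_third x1 y1 xy.
have [U uU [Ux Uy _]] := orthonormal3_transitive o o'.
have := conjugate_adjoint (dyad x0 y0) uU; rewrite rP conjugateZ !conjugate_dyad Ux Uy => e.
by rewrite -PhiZ e PsiK.
Qed.

(** The pulled-back product has weight [mu] for the reflection in [y] and [Num.conj mu] for the one
    in [z], which singles out yz*; transitivity makes [k] universal. *)
Lemma image_dyad_jordan : exists k, forall x y z, orthonormal3 x y z ->
  Phi (dyad y x) * Phi (dyad x z) + Phi (dyad x z) * Phi (dyad y x) = k *: Phi (dyad y z).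
Proof.
have [x0 [y0 [z0 o]]] := exists_orthonormal3.
have [x1 y1 z1 [xy xz yz]] := o.
have [k kP] : exists k, pull_jordan (dyad y0 x0) (dyad x0 z0) = k *: dyad y0 z0.
  have uVy := reflection_unitary y1 (normc_mu R).
  have uVz := reflection_unitary z1 (normc_mu R).
  have := conjugate_jordan (dyad y0 x0) (dyad x0 z0) uVy.
  rewrite !conjugate_dyad reflection_self// !reflection_orth// ?(orthC yz)// dyadZl pull_jordanZl.
  move=> /(weight_left y1 (normc_mu R) (@mu_neq1 R) (@mu_neqC R))/(_ erefl)[l _].
  have := conjugate_jordan (dyad y0 x0) (dyad x0 z0) uVz.
  rewrite !conjugate_dyad reflection_self// !reflection_orth// dyadZr pull_jordanZr.
  move=> /(weight_right z1 (normc_mu R) (@mu_neq1 R) (@mu_neqC R))/(_ erefl)[r _].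
  exact: dyad_left_right l r z1.
exists k => x y z o'.
have [U uU [Ux Uy Uz]] := orthonormal3_transitive o o'.
have := conjugate_jordan (dyad y0 x0) (dyad x0 z0) uU.
rewrite kP conjugateZ !conjugate_dyad Ux Uy Uz => e.
by rewrite -PhiZ e PsiK.
Qed.

(** * Gluing the images of rank-one operators into an isometry *)

Section CommonRange.

(** Evaluating at a vector orthogonal to [b] but not to [b'] puts [a'] on the line of [p];
    evaluating at [b] then puts [a] there too. *)
Lemma dyad_sum_rank1 (a b a' b' p q : H) : a != 0 -> a' != 0 -> b != 0 ->
  dyad a b + dyad a' b' = dyad p q -> (exists t, a' = t *: a) \/ (exists t, b' = t *: b).
Proof.
move=> a0 a0' b0 e; apply: contrapT => /not_orP[na nb].
have bb : '[b, b] != 0 by apply: contraNneq b0 => /in_eq0 ->.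
have ev u : '[u, b] *: a + '[u, b'] *: a' = '[u, q] *: p.
  by have := congr1 (fun T : B => T u) e; rewrite !opE !dyadE.
pose u := b' - ('[b', b] / '[b, b]) *: b.
have ub : '[u, b] = 0 by rewrite /u inBl inZl divfK// subrr.
have ub' : '[u, b'] != 0.
  apply/eqP => h; apply: nb; exists ('[b', b] / '[b, b]); apply/eqP; rewrite -subr_eq0.
  by apply/eqP/in_eq0; rewrite -/u {2}/u inBr inZr ub mulr0 subr0 h.
have := ev u; rewrite ub scale0r add0r => e1.
have e2 : a' = ('[u, b']^-1 * '[u, q]) *: p by rewrite -scalerA -e1 scalerA mulVf// scale1r.
have t0 : '[u, b']^-1 * '[u, q] != 0 by apply: contraNneq a0' => t0; rewrite e2 t0 scale0r.
have e3 : p = ('[u, b']^-1 * '[u, q])^-1 *: a' by rewrite e2 scalerA mulVf// scale1r.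
have : exists s, a = s *: a'.
  set l := _^-1 in e3; exists ('[b, b]^-1 * ('[b, q] * l - '[b, b'])).
  by rewrite -scalerA scalerBl -scalerA -e3 -(ev b) addrK scalerA mulVf// scale1r.
move=> [s es]; apply: na; exists s^-1; rewrite es scalerA mulVf ?scale1r//.
by apply: contraNneq a0 => s0; rewrite es s0 scale0r.
Qed.

Lemma image_dyad_rank_le1 x y : nm x = 1 -> '[x, y] = 0 -> exists a b : H, Phi (dyad x y) = dyad a b.
Proof.
move=> x1 xy; have [->|y0] := eqVneq y 0; first by exists 0, 0; rewrite dyad0r Phi0 dyad0l.
have [v v1 e] := normalize y0.
have xv : '[x, v] = 0.
  move: xy => /eqP; rewrite e inZr mulf_eq0 => /orP[|/eqP//].
  by rewrite fmorph_eq0 fmorph_eq0 nm_eq0 (negbTE y0).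
have [a [b [ab _ _ _]]] := image_dyad_rank1 x1 v1 xv.
by exists ((nm y)%:C *: a), b; rewrite [in LHS]e dyadZr PhiZ ab dyadZl conjE conjc_real.
Qed.

(** The images form a linear space of operators of rank at most one. If [y2] leaves the range of
    [a1], it shares the corange [b1]; an image without that corange would share its range with those
    of both [y1] and [y2], whose ranges differ. *)
Lemma common_range_or_corange x : nm x = 1 ->
  (exists2 a : H, nm a = 1 & forall y, '[x, y] = 0 -> exists b : H, Phi (dyad x y) = dyad a b) \/
  (exists2 b : H, nm b = 1 & forall y, '[x, y] = 0 -> exists a : H, Phi (dyad x y) = dyad a b).
Proof.
move=> x1.
have [y1 y11 y1P] := exists_ortho H_infinite [:: x].
have xy1 : '[x, y1] = 0 by apply: orthC; apply: y1P; rewrite inE.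
have [a1 [b1 [e1 a10 b10 _]]] := image_dyad_rank1 x1 y11 xy1.
have [h|h] := pselect (forall y, '[x, y] = 0 -> exists b : H, Phi (dyad x y) = dyad a1 b).
  have [a a_1 aE] := normalize a10; left; exists a => // y /h[b ->].
  by exists (Num.conj (nm a1)%:C *: b); rewrite {1}aE dyadZl dyadZr conjCK.
right; have [b b_1 bE] := normalize b10; exists b => //.
suff hr y : '[x, y] = 0 -> exists a : H, Phi (dyad x y) = dyad a b1.
  by move=> y /hr[a ->]; exists (Num.conj (nm b1)%:C *: a); rewrite {1}bE dyadZl dyadZr.
have [y2 xy2 ny2] : exists2 y, '[x, y] = 0 & ~ exists b : H, Phi (dyad x y) = dyad a1 b.
  by apply: contrapT => n; apply: h => v xv; apply: contrapT => nv; apply: n; exists v.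
have [a2 [b2 e2]] := image_dyad_rank_le1 x1 xy2.
have a20 : a2 != 0.
  by apply/eqP => a20; apply: ny2; exists 0; rewrite e2 a20 dyad0l dyad0r.
have b20 : b2 != 0.
  by apply/eqP => b20; apply: ny2; exists 0; rewrite e2 b20 !dyad0r.
have na t : a2 <> t *: a1.
  by move=> e; apply: ny2; exists (Num.conj t *: b2); rewrite e2 e dyadZl dyadZr conjCK.
have [t bt] : exists t, b2 = t *: b1.
  have xy12 : '[x, y1 + y2] = 0 by rewrite inDr xy1 xy2 addr0.
  have [p [q]] := image_dyad_rank_le1 x1 xy12; rewrite dyadDr PhiD e1 e2.
  by move=> /(dyad_sum_rank1 a10 a20 b10)[[s /na]|].
move=> xy; have [a [c e]] := image_dyad_rank_le1 x1 xy.
have corange s : c = s *: b1 -> exists a : H, Phi (dyad x y) = dyad a b1.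
  by move=> cs; exists (Num.conj s *: a); rewrite e cs dyadZl dyadZr.
have [a0|a0] := eqVneq a 0; first by exists 0; rewrite e a0 !dyad0l.
have xy1y : '[x, y1 + y] = 0 by rewrite inDr xy1 xy addr0.
have xy2y : '[x, y2 + y] = 0 by rewrite inDr xy2 xy addr0.
have [p [q]] := image_dyad_rank_le1 x1 xy1y; rewrite dyadDr PhiD e1 e.
move=> /(dyad_sum_rank1 a10 a0 b10)[[s as1]|[s /corange]]; last by rewrite e.
have [p' [q']] := image_dyad_rank_le1 x1 xy2y; rewrite dyadDr PhiD e2 e.
move=> /(dyad_sum_rank1 a20 a0 b20)[[s' as2]|[s' cs']]; last first.
  by rewrite -e; apply: (corange (s' * t)); rewrite cs' bt scalerA.
have s0 : s' != 0 by apply: contraNneq a0 => s0; rewrite as2 s0 scale0r.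
by case: (na (s'^-1 * s)); rewrite -scalerA -as1 as2 scalerA mulVf// scale1r.
Qed.

Variables x0 a0 : H.
Hypotheses (x01 : nm x0 = 1) (a01 : nm a0 = 1).
Hypothesis common : forall y, '[x0, y] = 0 -> exists b : H, Phi (dyad x0 y) = dyad a0 b.

(** [W1 y] is the second vector of [Phi (dyad x0 y) = dyad a0 (W1 y)]. It is linear in [y], as the
    conjugations from the dyad and from the adjoint cancel. *)
Let W1 y := adjoint (Phi (dyad x0 y)) a0.

Let W1_lin : linear W1.
Proof.
by move=> a y z; rewrite /W1 dyadDr dyadZr PhiD PhiZ adjD adjZ conjCK !opE.
Qed.
Let W1D y z : W1 (y + z) = W1 y + W1 z.
Proof. exact: (GRing.semilinear_linear W1_lin).2. Qed.
Let W10 : W1 0 = 0. Proof. by apply: (addrI (W1 0)); rewrite -W1D !addr0. Qed.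
Let W1Z a y : W1 (a *: y) = a *: W1 y.
Proof. exact: GRing.scalable_linear. Qed.

Let N0y y : '[x0, y] = 0 -> Phi (dyad x0 y) = dyad a0 (W1 y).
Proof.
move=> /common[b e]; rewrite e /W1 e adj_dyad dyadE nm1_in// scale1r.
by [].
Qed.

Let Phi_neq0 x y : nm x = 1 -> nm y = 1 -> Phi (dyad x y) <> 0.
Proof.
move=> x1 y1 e; have : dyad x y = 0 :> B by rewrite -[LHS]PhiK e Psi0.
by move=> /dyad_eq0[] h; [move: x1|move: y1]; rewrite h nm0 => /eqP; rewrite eq_sym oner_eq0.
Qed.

Let W1_neq0 y : nm y = 1 -> '[x0, y] = 0 -> W1 y != 0.
Proof.
move=> y1 xy; apply/eqP => h; apply: (Phi_neq0 x01 y1).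
by rewrite N0y// h dyad0r.
Qed.

Let unit_orth x y : '[x, y] = 0 -> y = 0 \/ exists y' t, [/\ nm y' = 1, '[x, y'] = 0 & y = t *: y'].
Proof.
move=> xy; have [->|y0] := eqVneq y 0; first by left.
right; have [v v1 e] := normalize y0; exists v, (nm y)%:C; split=> //.
move: xy => /eqP; rewrite e inZr mulf_eq0 => /orP[|/eqP//].
by rewrite fmorph_eq0 fmorph_eq0 nm_eq0 (negbTE y0).
Qed.

Let a0W1 y : '[x0, y] = 0 -> '[a0, W1 y] = 0.
Proof.
move=> /unit_orth[->|[v [t [v1 xv ->]]]]; first by rewrite W10 in0r.
rewrite W1Z inZr; have := image_dyad_square x01 xv.
rewrite N0y// mul_dyad => /eqP; rewrite scaler_eq0 => /orP[/eqP->|/eqP/dyad_eq0[h|h]].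
- by rewrite mulr0.
- by move: a01; rewrite h nm0 => /eqP; rewrite eq_sym oner_eq0.
- by have := W1_neq0 v1 xv; rewrite h eqxx.
Qed.

Variables r k : C.
Hypothesis rP : forall x y, nm x = 1 -> nm y = 1 -> '[x, y] = 0 ->
  adjoint (Phi (dyad x y)) = r *: Phi (dyad y x).
Hypothesis kP : forall x y z, orthonormal3 x y z ->
  Phi (dyad y x) * Phi (dyad x z) + Phi (dyad x z) * Phi (dyad y x) = k *: Phi (dyad y z).

Let third y : nm y = 1 -> '[x0, y] = 0 -> exists z, orthonormal3 x0 y z.
Proof. by move=> y1 xy; exact: exists_third. Qed.

Let r0 : r != 0.
Proof.
have [y [y1 yP]] : exists y, nm y = 1 /\ '[x0, y] = 0.
  have [y y1 yP] := exists_ortho H_infinite [:: x0]; exists y; split=> //.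
  by apply: orthC; apply: yP; rewrite inE.
apply/eqP => r0; have := rP x01 y1 yP; rewrite r0 scale0r => h.
by apply: (Phi_neq0 x01 y1); rewrite -[LHS]adjK h adj0.
Qed.

Let Ny0 y : '[x0, y] = 0 -> Phi (dyad y x0) = r^-1 *: dyad (W1 y) a0.
Proof.
move=> /unit_orth[->|[v [t [v1 xv ->]]]]; first by rewrite dyad0l W10 dyad0l Phi0 scaler0.
rewrite W1Z !dyadZl PhiZ scalerA mulrC -scalerA; congr (_ *: _).
by have := rP x01 v1 xv; rewrite N0y// adj_dyad => ->; rewrite scalerA mulVf// scale1r.
Qed.

(** The Jordan relation through [x0] carries the description from the images of x0 y* to those of
    yz*. *)
Let triple0 y z : orthonormal3 x0 y z ->
  dyad (W1 y) (W1 z) + '[W1 y, W1 z] *: dyad a0 a0 = (r * k) *: Phi (dyad y z).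
Proof.
move=> o; have [_ y1 z1 [xy xz yz]] := o; have := kP o.
rewrite Ny0// N0y// opZMl opZMr !mul_dyad nm1_in// scale1r -scalerDr => h.
by rewrite -scalerA -h scalerA divff// scale1r.
Qed.

(** [L] is a multiple of [Phi (dyad y z)], so its square is [0], while [a0] is an eigenvector of [L]
    with eigenvalue [s]. *)
Let W1_orth3 y z : orthonormal3 x0 y z -> '[W1 y, W1 z] = 0.
Proof.
move=> o; have [_ y1 z1 [xy xz yz]] := o; have e := triple0 o.
set s := '[W1 y, W1 z] in e *; set L := dyad _ _ + _ in e.
have L2 : L * L = 0 by rewrite e opZMl opZMr (image_dyad_square y1 yz) !scaler0.
have La : L a0 = s *: a0.
  by rewrite /L !opE !dyadE (a0W1 xz) scale0r add0r nm1_in// scale1r.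
have := congr1 (fun T : B => T a0) L2; rewrite opME La mapZ La scalerA op0E => /eqP.
rewrite scaler_eq0 mulf_eq0 orbb => /orP[/eqP//|/eqP h].
by move: a01; rewrite h nm0 => /eqP; rewrite eq_sym oner_eq0.
Qed.

Let k0 : k != 0.
Proof.
have [y y1 yP] := exists_ortho H_infinite [:: x0].
have xy : '[x0, y] = 0 by apply: orthC; apply: yP; rewrite inE.
have [z o] := third y1 xy; have [_ _ z1 [_ xz yz]] := o.
apply/eqP => k0; have := triple0 o; rewrite (W1_orth3 o) k0 mulr0 !scale0r addr0.
by move=> /dyad_eq0[] h; [have := W1_neq0 y1 xy|have := W1_neq0 z1 xz]; rewrite h eqxx.
Qed.

Let c := (r * k)^-1.
Let c0 : c != 0. Proof. by rewrite invr_eq0 mulf_neq0. Qed.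

Let N_orth3 y z : orthonormal3 x0 y z -> Phi (dyad y z) = c *: dyad (W1 y) (W1 z).
Proof.
move=> o; have := triple0 o; rewrite (W1_orth3 o) scale0r addr0 => ->.
by rewrite /c scalerA mulVf ?scale1r// mulf_neq0.
Qed.

Let W1_orth y z : '[x0, y] = 0 -> '[x0, z] = 0 -> '[y, z] = 0 -> '[W1 y, W1 z] = 0.
Proof.
move=> xy xz yz; have [->|y0] := eqVneq y 0; first by rewrite W10 in0l.
have [->|z0] := eqVneq z 0; first by rewrite W10 in0r.
have [y' y1 ey] := normalize y0; have [z' z1 ez] := normalize z0.
have ny : (nm y)%:C != 0 :> C by rewrite fmorph_eq0 nm_eq0.
have nz : (nm z)%:C != 0 :> C by rewrite fmorph_eq0 nm_eq0.
rewrite ey ez !W1Z inZl inZr W1_orth3 ?mulr0//; split=> //; split.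
- by apply: (orthZr ny); rewrite -ey.
- by apply: (orthZr nz); rewrite -ez.
- by apply: (orthZ ny nz); rewrite -ey -ez.
Qed.

Let N_orth y z : '[x0, y] = 0 -> '[x0, z] = 0 -> '[y, z] = 0 ->
  Phi (dyad y z) = c *: dyad (W1 y) (W1 z).
Proof.
move=> xy xz yz; have [->|y0] := eqVneq y 0; first by rewrite W10 !dyad0l Phi0 scaler0.
have [->|z0] := eqVneq z 0; first by rewrite W10 !dyad0r Phi0 scaler0.
have [y' y1 ey] := normalize y0; have [z' z1 ez] := normalize z0.
have ny : (nm y)%:C != 0 :> C by rewrite fmorph_eq0 nm_eq0.
have nz : (nm z)%:C != 0 :> C by rewrite fmorph_eq0 nm_eq0.
rewrite ey ez !W1Z !dyadZl !dyadZr !PhiZ N_orth3.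
  by rewrite !scalerA; congr (_ *: _); ring.
split=> //; split.
- by apply: (orthZr ny); rewrite -ey.
- by apply: (orthZr nz); rewrite -ez.
- by apply: (orthZ ny nz); rewrite -ey -ez.
Qed.

(** [y + z] and [y - z] are orthogonal, hence so are their images. *)
Let W1_nm3 y z : orthonormal3 x0 y z -> nm (W1 y) = nm (W1 z).
Proof.
move=> o; have [_ y1 z1 [xy xz yz]] := o.
have h1 : '[x0, y + z] = 0 by rewrite inDr xy xz addr0.
have h2 : '[x0, y - z] = 0 by rewrite inBr xy xz subr0.
have h3 : '[y + z, y - z] = 0.
  by rewrite inDl !inBr !nm1_in// yz (orthC yz) subr0 add0r subrr.
have := W1_orth h1 h2 h3; rewrite -[- z]scaleN1r !W1D W1Z scaleN1r inDl !inBr.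
have o1 := W1_orth3 o; rewrite o1 (orthC o1) subr0 add0r !nm_sqC => /eqP.
rewrite subr_eq0 => /eqP/complexI/eqP; rewrite eqrXn2 ?nm_ge0//.
by move=> /eqP.
Qed.

Let kappa_ex : exists2 kappa : R, 0 < kappa & forall y, '[x0, y] = 0 -> nm (W1 y) = kappa * nm y.
Proof.
have [y y1 yP] := exists_ortho H_infinite [:: x0].
have xy : '[x0, y] = 0 by apply: orthC; apply: yP; rewrite inE.
exists (nm (W1 y)); first by rewrite nm_gt0 W1_neq0.
move=> _ /unit_orth[->|[v [t [v1 xv ->]]]]; first by rewrite W10 nm0 mulr0.
(* [W1_nm3] compares orthogonal vectors only, so [y] and [v] are compared through a third vector. *)
have [z z1 zP] := exists_ortho H_infinite [:: x0; y; v].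
have xz : '[x0, z] = 0 by apply: orthC; apply: zP; rewrite !inE eqxx.
have yz : '[y, z] = 0 by apply: orthC; apply: zP; rewrite !inE eqxx orbT.
have vz : '[v, z] = 0 by apply: orthC; apply: zP; rewrite !inE eqxx !orbT.
rewrite W1Z !nmZ v1 mulr1 mulrC; congr (_ * _).
by rewrite (@W1_nm3 v z)// -(@W1_nm3 y z).
Qed.

(** On the complement of [x0], [W1] is a multiple of an isometry. Extended to [x0], it gives
    [Phi (dyad x y) = c *: dyad (W x) (W y)] for all orthonormal [x], [y], and [image_dyad_sandwich]
    then yields the off-diagonal entries of every [Phi Z]. *)
Lemma isometric_form : exists (U : B) (l : C), [/\ adjoint U * U = 1, l != 0 &
  forall Z x y, '[x, y] = 0 -> '[Phi Z (U x), U y] = l * '[Z x, y]].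
Proof.
have [kappa kap0 kapP] := kappa_ex.
have W1_in y : '[x0, y] = 0 -> '[W1 y, W1 y] = (kappa ^+ 2)%:C * '[y, y].
  by move=> xy; rewrite !nm_sqC kapP// exprMn rmorphM.
(* In the Jordan relation for x0 z* and zy* all images are already known; comparing coefficients
   determines [k]. *)
have ke : k = c * (kappa ^+ 2)%:C.
  have [y y1 yP] := exists_ortho H_infinite [:: x0].
  have xy : '[x0, y] = 0 by apply: orthC; apply: yP; rewrite inE.
  have [z o] := third y1 xy; have [_ _ z1 [_ xz yz]] := o.
  have o' : orthonormal3 z x0 y by split=> //; split=> //; exact: orthC.
  have := kP o'; rewrite !N0y// (N_orth xz xy (orthC yz)) opZMr opZMl !mul_dyad.
  rewrite (a0W1 xy) scale0r scaler0 addr0.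
  rewrite scalerA W1_in// nm1_in// mulr1 => h.
  apply/eqP; rewrite eq_sym -subr_eq0; apply/eqP.
  have : (c * (kappa ^+ 2)%:C - k) *: dyad a0 (W1 y) = 0 by rewrite scalerBl h subrr.
  move/eqP; rewrite scaler_eq0 => /orP[/eqP//|/eqP/dyad_eq0[] e].
    by move: a01; rewrite e nm0 => /eqP; rewrite eq_sym oner_eq0.
  by have := W1_neq0 y1 xy; rewrite e eqxx.
have ce : Num.conj c = r * c.
  have [y y1 yP] := exists_ortho H_infinite [:: x0].
  have xy : '[x0, y] = 0 by apply: orthC; apply: yP; rewrite inE.
  have [z o] := third y1 xy; have [_ _ z1 [_ xz yz]] := o.
  have := rP y1 z1 yz; rewrite (N_orth xy xz yz) (N_orth xz xy (orthC yz)) adjZ adj_dyad scalerA => h.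
  apply/eqP; rewrite -subr_eq0; apply/eqP.
  have : (Num.conj c - r * c) *: dyad (W1 z) (W1 y) = 0 by rewrite scalerBl h subrr.
  move/eqP; rewrite scaler_eq0 => /orP[/eqP//|/eqP/dyad_eq0[] e].
    by have := W1_neq0 z1 xz; rewrite e eqxx.
  by have := W1_neq0 y1 xy; rewrite e eqxx.
have cn : normc c^-1 = kappa.
  have r1 : normc r = 1.
    have /eqP := congr1 (fun z : C => normc z) ce; rewrite normcM normc_conj -subr_eq0.
    rewrite -{1}[normc c]mul1r -mulrBl mulf_eq0 normc_eq0 (negbTE c0) orbF subr_eq0.
    by move=> /eqP.
  have ckr : c * (c * (kappa ^+ 2)%:C * r) = 1.
    by rewrite -ke mulrC /c [k * r]mulrC divff// mulf_neq0.
  have := congr1 (fun z : C => normc z) ckr; rewrite !normcM r1 normc1 mulr1 normc_real.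
  rewrite ger0_norm ?sqr_ge0// mulrA -expr2 -exprMn => /eqP.
  rewrite sqrp_eq1 ?mulr_ge0 ?normc_ge0 ?(ltW kap0)// => /eqP h.
  rewrite normcV; have cp : normc c != 0 by rewrite normc_eq0.
  by rewrite -[LHS]mulr1 -h mulrA mulVf// mul1r.
(* Sending [x0] to [c^-1 *: a0] extends the formula for [Phi] to x0 z*, and by [ce] to z x0*; by
   [cn] the extension still multiplies norms by [kappa]. *)
pose Wf h := W1 (orth_part x0 h) + ('[h, x0] * c^-1) *: a0.
have orth_lin (a : C) (u v : H) : orth_part x0 (a *: u + v) = a *: orth_part x0 u + orth_part x0 v.
  by rewrite /orth_part inDl inZl scalerDl -scalerA scalerBr opprD addrACA.
have x0o h : '[x0, orth_part x0 h] = 0 by apply: orthC; exact: orth_part_orth.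
have Wlin : linear Wf.
  move=> a u v; rewrite /Wf orth_lin W1_lin inDl inZl scalerDr addrACA; congr (_ + _).
  by rewrite mulrDl scalerDl scalerA mulrA.
have Wnm h : nm (Wf h) = kappa * nm h.
  apply/eqP; rewrite -(@eqrXn2 _ 2) ?nm_ge0 ?mulr_ge0 ?nm_ge0 ?(ltW kap0)//; apply/eqP.
  rewrite /Wf pythagoras; last by rewrite inZr (orthC (a0W1 (x0o h))) mulr0.
  rewrite kapP// nmZ a01 normcM cn mulr1 !exprMn (orth_part_nm h x01); ring.
have Wbd : exists M, forall h, nm (Wf h) <= M * nm h by exists kappa => h; rewrite Wnm.
pose W : B := BoundedOp (nm_bounded Wlin Wbd).
have WE h : W h = Wf h by [].
have Wx h : '[x0, h] = 0 -> W h = W1 h.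
  move=> xh; rewrite WE /Wf (orthC xh) mul0r scale0r addr0 /orth_part (orthC xh) scale0r subr0.
  by [].
have WW : adjoint W * W = (kappa ^+ 2)%:C *: (1 : B).
  apply: form_eq => h; rewrite opME -adjEr WE nm_sqC Wnm exprMn rmorphM.
  by rewrite opZE op1E inZl nm_sqC.
have W_in x y : '[W x, W y] = (kappa ^+ 2)%:C * '[x, y].
  by rewrite adjE -opME WW opZE op1E inZr conjE conjc_real.
have NR x z : '[x0, z] = 0 -> '[x, z] = 0 -> Phi (dyad x z) = c *: dyad (W x) (W z).
  move=> xz xz'; have e : x = '[x, x0] *: x0 + orth_part x0 x by rewrite addrC subrK.
  have oz : '[orth_part x0 x, z] = 0 by rewrite inBl inZl xz xz' mulr0 subr0.
  rewrite {1}e dyadDl dyadZl PhiD PhiZ N0y// (N_orth (x0o x) xz oz) (Wx _ xz).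
  rewrite WE /Wf dyadDl dyadZl scalerDr addrC scalerA; congr (_ + _ *: _).
  by rewrite mulrCA divff ?mulr1.
have NL x z : '[x0, z] = 0 -> '[x, z] = 0 -> Phi (dyad z x) = c *: dyad (W z) (W x).
  move=> xz xz'; have e : x = '[x, x0] *: x0 + orth_part x0 x by rewrite addrC subrK.
  have oz : '[z, orth_part x0 x] = 0 by apply: orthC; rewrite inBl inZl xz xz' mulr0 subr0.
  rewrite {1}e dyadDr dyadZr PhiD PhiZ (Ny0 xz) (N_orth xz (x0o x) oz) (Wx _ xz).
  rewrite WE /Wf dyadDr dyadZr scalerDr addrC !scalerA; congr (_ + _ *: _).
  rewrite rmorphM fmorphV /= ce; field.
  by rewrite c0 r0.
have NW x y : nm x = 1 -> nm y = 1 -> '[x, y] = 0 -> Phi (dyad x y) = c *: dyad (W x) (W y).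
  (* Both [x] and [y] may have a component along [x0]; the Jordan relation through a [z] orthogonal
     to all three reduces to [NR] and [NL]. *)
  move=> x1 y1 xy; have [z z1 zP] := exists_ortho H_infinite [:: x0; x; y].
  have xz : '[x0, z] = 0 by apply: orthC; apply: zP; rewrite !inE eqxx.
  have zx : '[z, x] = 0 by apply: zP; rewrite !inE eqxx orbT.
  have zy : '[z, y] = 0 by apply: zP; rewrite !inE eqxx !orbT.
  have o : orthonormal3 z x y by split.
  have := kP o; rewrite (NR _ _ xz (orthC zx)) (NL _ _ xz (orthC zy)) !(opZMl, opZMr) !mul_dyad !W_in.
  rewrite xy mulr0 scale0r !scaler0 addr0 nm1_in// mulr1 => h.
  apply: (scalerI k0); rewrite -h !scalerA {1}ke; congr (_ *: _); ring.
have formW x y Z : nm x = 1 -> nm y = 1 -> '[x, y] = 0 ->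
    '[Phi Z (W x), W y] = (k * (kappa ^+ 2)%:C) * '[Z x, y].
  move=> x1 y1 xy; have [g gP] := image_dyad_sandwich x1 y1 xy.
  have dn : dyad (W x) (W y) <> 0.
    by move=> h; apply: (Phi_neq0 x1 y1); rewrite NW// h scaler0.
  have key Z' : c * '[Phi Z' (W x), W y] = g * '[Z' x, y].
    have := gP Z'; rewrite (NW _ _ x1 y1 xy) !(opZMl, opZMr) -mulrA mul_op_dyad mul_dyad !scalerA.
    move/eqP; rewrite -subr_eq0 -scalerBl scaler_eq0 => /orP[|/eqP//].
    rewrite subr_eq0 => /eqP h; apply: (mulfI c0); rewrite -[RHS]mulrC -h; ring.
  (* The constant [g] is read off at [Z = dyad y x], where ['[Z x, y] = 1]. *)
  have := key (dyad y x); rewrite (NW _ _ y1 x1 (orthC xy)) opZE !dyadE !inZl !W_in !nm1_in// !mulr1 => hg.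
  by apply: (mulfI c0); rewrite key -hg ke; ring.
exists ((kappa^-1)%:C *: W), k; split=> //.
  rewrite adjZ opZMl opZMr WW !scalerA conjE conjc_real -!rmorphM.
  have -> : kappa^-1 * kappa^-1 * kappa ^+ 2 = 1 by field; rewrite gt_eqF.
  by rewrite scale1r.
move=> Z x y xy; have [->|xn] := eqVneq x 0; first by rewrite !map0 !in0l mulr0.
have [->|yn] := eqVneq y 0; first by rewrite map0 !in0r mulr0.
have [x' x1 ex] := normalize xn; have [y' y1 ey] := normalize yn.
have nx : (nm x)%:C != 0 :> C by rewrite fmorph_eq0 nm_eq0.
have ny : (nm y)%:C != 0 :> C by rewrite fmorph_eq0 nm_eq0.
have xy' : '[x', y'] = 0 by apply: (orthZ nx ny); rewrite -ex -ey.
rewrite ex ey !opZE !mapZ !inZl !inZr formW// !conjE !conjc_real.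
have kk : (kappa^-1)%:C * (kappa^-1)%:C * (kappa ^+ 2)%:C = 1.
  rewrite -!rmorphM; have -> : kappa^-1 * kappa^-1 * kappa ^+ 2 = 1 by field; rewrite gt_eqF.
  by [].
rewrite -[RHS]mul1r -kk; ring.
Qed.
End CommonRange.

(** The off-diagonal entries of [adjoint U * Phi Z * U - l *: Z] vanish, so it is scalar. It remains
    to see that [U] is onto, for which the surjectivity of [Phi] is used. *)
Lemma common_range_form (x a : H) : nm x = 1 -> nm a = 1 ->
  (forall y, '[x, y] = 0 -> exists b : H, Phi (dyad x y) = dyad a b) ->
  exists (U : B) (l : C) (f : B -> C), [/\ unitary U, l != 0 &
    forall Z, Phi Z = conjugate U (l *: Z + f Z *: (1 : B))].
Proof.
move=> x1 a1 common.
have [r rP] := image_dyad_adjoint; have [k kP] := image_dyad_jordan.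
have [U [l [UU l0 UP]]] := isometric_form x1 a1 common rP kP.
have ex Z : exists s : C, adjoint U * Phi Z * U = l *: Z + s *: (1 : B).
  have [s sP] : exists s, adjoint U * Phi Z * U - l *: Z = s *: (1 : B).
    apply: (orth_eq0_scalar H_infinite) => u v uv.
    by rewrite !opE inDl inNl inZl -adjEr UP// subrr.
  by exists s; rewrite -sP addrC subrK.
have [f fP] := choice ex.
(* If [adjoint U v = 0], then [U] compresses [dyad v v] to [0], so [Psi (dyad v v)] is scalar. As
   [Phi] maps scalars to scalars, [dyad v v] would be scalar, although it kills a unit vector
   orthogonal to [v]. *)
have ker v : adjoint U v = 0 -> v = 0.
  move=> Uv; apply/eqP/negPn/negP => v0.
  have e0 : l *: Psi (dyad v v) + f (Psi (dyad v v)) *: (1 : B) = 0.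
    rewrite -fP PsiK mul_op_dyad Uv mul_dyad_op Uv.
    by apply: bounded_op_ext => h; rewrite dyadE scaler0.
  have [t tP] : exists t, Psi (dyad v v) = t *: (1 : B).
    exists (- (f (Psi (dyad v v)) / l)); apply: (scalerI l0).
    by rewrite scalerA mulrN mulrCA divff// mulr1 scaleNr; apply/eqP; rewrite -addr_eq0 e0.
  have [c cP] := invariant_scalar_image.
  have c0 : c != 0.
    apply/eqP => c0; move: cP; rewrite c0 scale0r Phi0 => /(congr1 (fun T : B => T x)).
    by rewrite op0E op1E => h; move: x1; rewrite -h nm0 => /eqP; rewrite eq_sym oner_eq0.
  have vv : dyad v v = (t / c) *: (1 : B).
    have p1 : Phi 1 = c^-1 *: (1 : B).
      by apply: (scalerI c0); rewrite scalerA divff// scale1r -PhiZ cP.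
    by rewrite -[LHS]PsiK tP PhiZ p1 scalerA.
  have [z z1 zP] := exists_ortho H_infinite [:: v].
  have zv : '[z, v] = 0 by apply: zP; rewrite inE.
  have tc : t / c = 0.
    have := congr1 (fun T : B => T z) vv; rewrite dyadE zv scale0r opZE op1E => /esym/eqP.
    by rewrite scaler_eq0 (negbTE (nm1_neq0 z1)) orbF => /eqP.
  by move: vv; rewrite tc scale0r => /dyad_eq0[] h; rewrite h eqxx in v0.
have UU' : U * adjoint U = 1.
  apply: bounded_op_ext => v; apply/eqP; rewrite op1E -subr_eq0; apply/eqP/ker.
  by rewrite mapB -!opME mulrA UU mul1r subrr.
exists U, l, f; split=> // Z.
by rewrite -fP /conjugate !mulrA UU' mul1r -mulrA UU' mulr1.
Qed.

(* If [d = f (V Z V* ) - f Z] were nonzero, invariance of [w (Phi _)] along [Z + t 1] would make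
   [w (Y + s 1)] periodic in [s] with period [d], hence bounded. *)
Lemma invariant_functional (U : B) (l : C) (f : B -> C) : unitary U -> l != 0 ->
  (forall Z, Phi Z = conjugate U (l *: Z + f Z *: (1 : B))) ->
  scalar f /\ forall V Z, unitary V -> f (conjugate V Z) = f Z.
Proof.
move=> uU l0 PhiE.
have one_inj (s t : C) : s *: (1 : B) = t *: (1 : B) -> s = t.
  have [x x1] := exists_unit H_infinite.
  move=> /(congr1 (fun T : B => T x)); rewrite !opZE !op1E => /eqP.
  by rewrite -subr_eq0 -scalerBl scaler_eq0 (negbTE (nm1_neq0 x1)) orbF subr_eq0 => /eqP.
have conj_inj S T : conjugate U S = conjugate U T -> S = T.
  by move=> e; rewrite -[S](conjugateK S uU) e conjugateK.
have flin : scalar f.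
  move=> a X Y; apply: one_inj; have := Phi_lin a X Y; rewrite !PhiE -conjugateZ -conjugateD.
  move=> /conj_inj; rewrite !scalerDr !scalerA mulrC scalerDl -scalerA.
  by rewrite -!addrA => /addrI; rewrite [X in _ = X -> _]addrCA => /addrI ->.
split=> // V Z uV.
pose d := f (conjugate V Z) - f Z; apply/eqP; rewrite -subr_eq0 -/d.
pose Y : B := l *: Z + f Z *: (1 : B).
(* Adding [t *: 1] to [Z] adds [t * (l + f 1)] times the identity to [l *: Z + f Z *: 1]; this
   factor being nonzero, every shift [s] is reached. *)
have f1 : l + f 1 != 0.
  apply/eqP => h; have : Phi 1 = 0 by rewrite PhiE -scalerDl h scale0r /conjugate mulr0 mul0r.
  move=> e; have := PhiK 1; rewrite e Psi0 => /(congr1 (fun T : B => T)) z.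
  have [x x1] := exists_unit H_infinite; have := congr1 (fun T : B => T x) z.
  by rewrite op0E op1E => h'; move: x1; rewrite -h' nm0 => /eqP; rewrite eq_sym oner_eq0.
have shift s : w (Y + s *: (1 : B)) = w (Y + (s + d) *: (1 : B)).
  pose t := s / (l + f 1).
  have st : s = t * (l + f 1) by rewrite /t divfK.
  have e1 X : l *: (X + t *: (1 : B)) + f (X + t *: (1 : B)) *: (1 : B)
     = l *: X + f X *: (1 : B) + s *: (1 : B).
    rewrite [X + _]addrC flin scalerDr scalerA !scalerDl st mulrDr scalerDl [l * t]mulrC.
    by rewrite addrACA addrC.
  have wU (V' S : B) : unitary V' -> w (conjugate V' S) = w S.
    by move=> uV'; rewrite numerical_radius_unitary.
  have e2 : conjugate V (Z + t *: (1 : B)) = conjugate V Z + t *: (1 : B).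
    by rewrite conjugateD conjugateZ conjugate1.
  have h := Phi_inv (Z + t *: (1 : B)) uV.
  rewrite e2 (PhiE (conjugate V Z + _)) (PhiE (Z + _)) (wU _ _ uU) (wU _ _ uU) in h.
  rewrite (e1 (conjugate V Z)) (e1 Z) in h.
  rewrite /Y -h -[in RHS](wU V _ uV); congr w.
  rewrite conjugateD conjugateD !conjugateZ (conjugate1 uV) -!addrA; congr (_ + _).
  by rewrite -!scalerDl /d; congr (_ *: _); ring.
have shiftn n : w (Y + (n%:R * d) *: (1 : B)) = w Y.
  elim: n => [|n IH]; first by rewrite mul0r scale0r addr0.
  by rewrite -IH [RHS]shift -natr1 mulrDl mul1r.
rewrite -normc_eq0; apply/eqP/(@eps0 _ _ (2 * w Y)) => e e0.
rewrite ger0_norm ?normc_ge0//.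
have [N NP] := @ex_invn_le R e e0.
have n0 : 0 < N.+1%:R :> R by rewrite ltr0n.
have : w ((N.+1%:R * d) *: (1 : B)) <= 2 * w Y.
  have -> : (N.+1%:R * d) *: (1 : B) = (Y + (N.+1%:R * d) *: (1 : B)) + (-1) *: Y.
    by rewrite scaleN1r addrC addKr.
  apply: (le_trans (numerical_radiusD H_infinite _ _)); rewrite shiftn (numerical_radiusZ H_infinite).
  by rewrite normcN normc1 mul1r mulr2n mulrDl mul1r.
rewrite (numerical_radiusZ H_infinite) (numerical_radius1 H_infinite) mulr1 normcM.
rewrite -(rmorph_nat (real_complex R)) normc_real ger0_norm ?(ltW n0)// => h.
have h2 : normc d <= N.+1%:R^-1 * (2 * w Y) by rewrite ler_pdivlMl.
apply: (le_trans h2); rewrite ler_wpM2r ?NP//.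
by rewrite mulr_ge0 ?numerical_radius_ge0.
Qed.

End InvariantMap.

(** * Splitting an infinite index set *)

Section InfiniteSets.
Variable I : Type.

(* The index set is partitioned into sequences, the finite remainder being prepended to
   one of them; splitting each sequence by parity gives the two halves. *)
Lemma infinite_split : infinite_set [set: I] -> exists f g : I -> I,
  [/\ injective f, injective g, forall i j, f i <> g j &
    forall i, (exists j, i = f j) \/ (exists j, i = g j)].
Proof.
elim/Ppointed: I => T Iinf.
  by exfalso; apply: Iinf; rewrite emptyE; exact: finite_set0.
(* One condition for two: every sequence is injective, and distinct sequences have disjoint
   ranges. *)
pose good (F : set (nat -> T)) := forall s t n m, F s -> F t -> s n = t m -> s = t /\ n = m.
have chain F : F `<=` good -> total_on F subset -> good (\bigcup_(X in F) X).
  move=> Fg Ft s t n m [X FX Xs] [Y FY Yt] e.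
  have [XY|YX] := Ft X Y FX FY; first by apply: (Fg Y FY) => //; exact: XY.
  by apply: (Fg X FX) => //; exact: YX.
have [F [Fg Fmax]] := Zorn_bigcup chain.
pose U := [set i | exists s n, F s /\ s n = i].
(* An infinite remainder would contain one more injective sequence, against maximality. *)
have cofin : finite_set (~` U).
  apply: contrapT => /infiniteP/pcard_leP[s].
  have sinj n m : s n = s m -> n = m by move=> e; apply: (@inj _ _ setT s); rewrite ?inE.
  have sU n : ~ U (s n) by exact: (@funS _ _ setT (~` U) s).
  apply: (Fmax (F `|` [set (s : nat -> T)])).
    split=> [t Ft|h]; first by left.
    by apply: (sU 0%N); exists s, 0%N; split=> //; apply: h; right.
  move=> t t' n m [Ft|->] [Ft'|->] e.
  - exact: Fg.
  - by case: (sU m); exists t, n.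
  - by case: (sU n); exists t', m.
  - by split=> //; exact: sinj.
have [s0 Fs0] : exists s, F s.
  apply: contrapT => nF; apply: Iinf; have -> : [set: T] = ~` U.
    by apply/seteqP; split=> i // _ [s [n [Fs _]]]; apply: nF; exists s.
  exact: cofin.
have [r0 r0E] := (finite_seqP _).1 cofin.
pose r := undup r0.
have rU i : i \in r -> ~ U i by rewrite mem_undup => ir; have : [set` r0] i by []; rewrite -r0E.
have Ur i : ~ U i -> i \in r by move=> nU; rewrite mem_undup; have : (~` U) i by []; rewrite r0E.
pose s1 n := if (n < size r)%N then nth point r n else s0 (n - size r)%N.
pose F1 := [set s | (F s /\ s <> s0) \/ s = s1].
have s1r n : (n < size r)%N -> s1 n \in r by move=> nr; rewrite /s1 nr mem_nth.
have F1g : good F1.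
  have mixed s n m : F s -> s <> s0 -> s n = s1 m -> False.
    move=> Fs ss0 e; have [mr|mr] := boolP (m < size r)%N.
      by apply: (rU _ (s1r m mr)); exists s, n.
    by move: e; rewrite /s1 (negbTE mr) => /(Fg _ _ _ _ Fs Fs0)[].
  have selfl n m : (n < size r)%N -> s1 n = s1 m -> n = m.
    move=> nr e; have [mr|mr] := boolP (m < size r)%N.
      by move: e; rewrite /s1 nr mr => /eqP; rewrite nth_uniq ?undup_uniq// => /eqP.
    by case: (rU _ (s1r n nr)); rewrite e /s1 (negbTE mr); exists s0, (m - size r)%N.
  move=> s t n m [[Fs ss0]|->] [[Ft ts0]|->] e.
  - exact: Fg.
  - by case: (mixed s n m).
  - by case: (mixed t m n).
  - split=> //; have [nr|nr] := boolP (n < size r)%N; first exact: selfl.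
    have [mr|mr] := boolP (m < size r)%N; first by apply/esym/selfl.
    move: e; rewrite /s1 (negbTE nr) (negbTE mr) => /(Fg _ _ _ _ Fs0 Fs0)[_].
    by rewrite -!leqNgt in nr mr => e; rewrite -(subnK nr) -(subnK mr) e.
have cover i : exists p : (nat -> T) * nat, F1 p.1 /\ p.1 p.2 = i.
  have [[s [n [Fs <-]]]|nU] := pselect (U i).
    have [->|ss0] := pselect (s = s0); last by exists (s, n); split=> //; left.
    exists (s1, (n + size r)%N); split; first by right.
    by rewrite /s1 /= ltnNge leq_addl /= addnK.
  have ir := Ur i nU; exists (s1, index i r); split; first by right.
  by rewrite /s1 /= index_mem ir nth_index.
have [code codeP] := choice cover.
have codeE s n : F1 s -> code (s n) = (s, n).
  move=> Fs; have [F1c ec] := codeP (s n); have [] := F1g _ _ _ _ F1c Fs ec.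
  by case: (code (s n)) => ? ? /= -> ->.
exists (fun i => (code i).1 (code i).2.*2), (fun i => (code i).1 (code i).2.*2.+1).
split.
- move=> i j; have [Fi ei] := codeP i; have [Fj ej] := codeP j.
  move=> /(F1g _ _ _ _ Fi Fj)[e1 /double_inj e2].
  by rewrite -ei -ej e1 e2.
- move=> i j; have [Fi ei] := codeP i; have [Fj ej] := codeP j.
  move=> /(F1g _ _ _ _ Fi Fj)[e1 [/double_inj e2]].
  by rewrite -ei -ej e1 e2.
- move=> i j; have [Fi ei] := codeP i; have [Fj ej] := codeP j.
  move=> /(F1g _ _ _ _ Fi Fj)[_ /(congr1 odd)].
  by rewrite /= !odd_double.
- move=> i; have [Fi ei] := codeP i; case: (code i) Fi ei => s n /= Fs en.
  have := odd_double_half n; case: (odd n) => h.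
    by right; exists (s n./2); rewrite codeE//= -en -{1}h.
  by left; exists (s n./2); rewrite codeE//= -en -{1}h.
Qed.
End InfiniteSets.

(** * Isometries prescribed on an orthonormal basis *)

Section OrthonormalBasis.
Variables (R : realType) (H : hilbertType R).
Local Notation C := R[i].
Local Notation B := (bounded_op H).
Implicit Types (x y z u v : H) (a b c : C).

(** Norm preservation makes the closure of the relation single-valued, and density of its domain
    makes it total. The twist [s] allows for linear and conjugate-linear maps alike. *)
Lemma graph_extension (s : C -> C) (G : H -> H -> Prop) :
  (forall a, normc (s a) = normc a) -> s (-1) = -1 -> s 1 = 1 ->
  (forall a x y x' y', G x y -> G x' y' -> G (a *: x + x') (s a *: y + y')) ->
  (forall x y, G x y -> nm y = nm x) ->
  (forall x e, 0 < e -> exists d d', G d d' /\ nm (x - d) <= e) ->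
  exists f : H -> H, [/\ forall a x y, f (a *: x + y) = s a *: f x + f y,
    forall x y, G x y -> f x = y & forall x, nm (f x) = nm x].
Proof.
move=> sn sN1 s1 GD Gn Gd.
pose K x y := forall e : R, 0 < e -> exists d d', [/\ G d d', nm (x - d) <= e & nm (y - d') <= e].
have GB x y x' y' : G x y -> G x' y' -> G (x - x') (y - y').
  by move=> Gx Gx'; have := GD (-1) _ _ _ _ Gx' Gx; rewrite sN1 !scaleN1r ![- _ + _]addrC.
have KG x y : G x y -> K x y by move=> Gxy e e0; exists x, y; rewrite !subrr nm0 ltW.
have Kuniq x y y' : K x y -> K x y' -> y = y'.
  move=> h h'; apply/eqP; rewrite -subr_eq0; apply/eqP/nm_eps0 => e e0.
  have e40 : 0 < e / 4 by rewrite divr_gt0.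
  have [d [d' [Gd1 h1 h2]]] := h _ e40; have [c [c' [Gc h3 h4]]] := h' _ e40.
  have h5 := Gn _ _ (GB _ _ _ _ Gd1 Gc).
  have h6 := nmD (y - d') ((d' - c') + (c' - y')); rewrite [d' - c' + _]addrA !subrK in h6.
  have h7 := nmD (d' - c') (c' - y').
  have h8 := nmD (d - x) (x - c); rewrite addrA subrK in h8.
  rewrite addrA subrK in h6.
  rewrite (nmBC d x) in h8; rewrite (nmBC c' y') in h7.
  have : d' - c' + (c' - y') = d' - y' by rewrite addrA subrK.
  by move=> e1; rewrite e1 in h7; move: h6; lra.
have Kex x : exists y, K x y.
  have ex n : exists p : H * H, G p.1 p.2 /\ nm (x - p.1) <= n.+1%:R^-1.
    have n0 : 0 < n.+1%:R^-1 :> R by rewrite invr_gt0 ltr0n.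
    by have [d [d' [h1 h2]]] := Gd x _ n0; exists (d, d').
  have [p pP] := choice ex.
  have pn n m : nm ((p n).2 - (p m).2) <= n.+1%:R^-1 + m.+1%:R^-1.
    have [g1 h1] := pP n; have [g2 h2] := pP m.
    rewrite (Gn _ _ (GB _ _ _ _ g1 g2)).
    have := nmD ((p n).1 - x) (x - (p m).1); rewrite addrA subrK (nmBC (p n).1) => h.
    by apply: (le_trans h); rewrite lerD.
  have [y yP] : exists l, forall e : R, 0 < e -> exists N, forall n, (N <= n)%N -> nm ((p n).2 - l) <= e.
    apply: (hilbert_complete (s := fun n => (p n).2)) => e e0.
    have [N NP] := @ex_invn_le R (e / 2) (divr_gt0 e0 (ltr0Sn _ _)).
    exists N => n m /NP h1 /NP h2; apply: (le_trans (pn n m)).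
    by rewrite [e]splitr lerD.
  exists y => e e0; have [N1 N1P] := yP e e0; have [N2 N2P] := @ex_invn_le R e e0.
  exists (p (maxn N1 N2)).1, (p (maxn N1 N2)).2; have [h1 h2] := pP (maxn N1 N2).
  split=> //; first by rewrite (le_trans h2)// N2P// leq_maxr.
  by rewrite nmBC N1P// leq_maxl.
have [f fK] := choice Kex.
exists f; split=> [a x y|x y /KG|x]; last 2 first.
- exact: Kuniq.
- apply/eqP; rewrite -subr_eq0; apply/eqP/(@eps0 _ _ 2) => e e0.
  have [d [d' [g h1 h2]]] := fK x e e0; have gn := Gn _ _ g.
  have h3 := nmD (f x - d') d'; have h4 := nmD (x - d) d; rewrite !subrK in h3 h4.
  have h5 := nmD (d' - f x) (f x); have h6 := nmD (d - x) x; rewrite !subrK in h5 h6.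
  rewrite (nmBC d') in h5; rewrite (nmBC d) in h6.
  by rewrite ler_norml; apply/andP; split; lra.
apply: (Kuniq (a *: x + y)) => // e e0.
have n0 : 0 < normc a + 1 by rewrite ltr_wpDl ?normc_ge0.
pose e1 := e / (normc a + 1).
have e10 : 0 < e1 by rewrite divr_gt0.
have e1e : normc a * e1 + e1 = e by rewrite /e1; field; rewrite gt_eqF.
have [d [d' [g h1 h2]]] := fK x e1 e10; have [c [c' [g' h3 h4]]] := fK y e1 e10.
exists (a *: d + c), (s a *: d' + c'); split; first exact: GD.
  rewrite opprD addrACA -scalerBr (le_trans (nmD _ _))// nmZ -e1e lerD// ler_wpM2l ?normc_ge0//.
rewrite opprD addrACA -scalerBr (le_trans (nmD _ _))// nmZ sn -e1e lerD// ler_wpM2l ?normc_ge0//.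
Qed.

Variables (I : choiceType) (e : I -> H).
Hypothesis e_basis : orthonormal_basis e.

(** Lists of pairs, with repetitions allowed, make addition a concatenation; that equal combinations
    have equal images comes from norm preservation in [graph_extension]. *)
Definition combination (g : I -> H) (s : C -> C) (l : seq (C * I)) := \sum_(p <- l) s p.1 *: g p.2.

Lemma basis_dense x (r : R) : 0 < r -> exists l, nm (x - combination e idfun l) <= r.
Proof.
move=> r0; have [_ dn] := e_basis.
have r0' : 0 < (r%:C : C) by rewrite ltcR.
have [||y [xy [s [a ya]]]] := dn (ball x r%:C).
- by exists x; apply: ballxx.
- exact: ball_open.
exists [seq (a i, i) | i <- s]; rewrite /combination big_map /= -ya.
by move: xy; rewrite -ball_normE /ball_ /= nmE ltcR => /ltW.
Qed.

Lemma orth_basis_eq0 x : (forall i, '[x, e i] = 0) -> x = 0.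
Proof.
move=> h; apply: nm_eps0 => r r0; have [l lP] := basis_dense x r0.
have o : '[x, combination e idfun l] = 0.
  rewrite /combination; elim: l {lP} => [|p l IH]; first by rewrite big_nil in0r.
  by rewrite big_cons inDr inZr h mulr0 add0r.
have := pythagoras (x := x) (y := - combination e idfun l); rewrite inNr o oppr0 => /(_ erefl) p.
rewrite -ler_sqr ?nnegrE ?nm_ge0 ?(ltW r0)//.
apply: (@le_trans _ _ (nm (x - combination e idfun l) ^+ 2)).
  by rewrite p lerDl sqr_ge0.
by rewrite ler_sqr ?nnegrE ?nm_ge0 ?(ltW r0).
Qed.

Lemma basis_map (s : {rmorphism C -> C}) (g : I -> H) :
  (forall a, s (Num.conj a) = Num.conj (s a)) -> (forall a : R, s a%:C = a%:C) ->
  (forall i j, '[g i, g j] = (i == j)%:R) ->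
  exists f : H -> H, [/\ forall a x y, f (a *: x + y) = s a *: f x + f y,
    forall i, f (e i) = g i & forall x, nm (f x) = nm x].
Proof.
move=> sc sr gg; have [ee _] := e_basis.
have sn a : normc (s a) = normc a.
  apply/eqP; rewrite -(@eqrXn2 _ 2) ?normc_ge0//; apply/eqP/complexI.
  by rewrite normc_sq -sc -rmorphM -normc_sq sr.
pose G x y := exists l, x = combination e idfun l /\ y = combination g s l.
have inner_comb (h : I -> H) (t : C -> C) l l' : (forall i j, '[h i, h j] = (i == j)%:R) ->
    '[combination h t l, combination h t l'] =
    \sum_(p <- l) \sum_(q <- l') t p.1 * Num.conj (t q.1) * (p.2 == q.2)%:R.
  move=> hh; rewrite /combination; elim: l => [|p l IH]; first by rewrite !big_nil in0l.
  rewrite !big_cons inDl IH; congr (_ + _).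
  elim: l' {IH} => [|q l' IH]; first by rewrite !big_nil in0r.
  by rewrite !big_cons inDr IH inZl inZr hh mulrA.
have [||||||f [f1 f2 f3]] := @graph_extension s G.
- exact: sn.
- by rewrite rmorphN1.
- by rewrite rmorph1.
- move=> a x y x' y' [l [-> ->]] [l' [-> ->]].
  exists ([seq (a * p.1, p.2) | p <- l] ++ l'); rewrite /combination !big_cat !big_map /=.
  rewrite !scaler_sumr; split; congr (_ + _); apply: eq_bigr => p _; rewrite scalerA//.
  by rewrite rmorphM.
- move=> x y [l [-> ->]]; apply/eqP; rewrite -(@eqrXn2 _ 2) ?nm_ge0//; apply/eqP/complexI.
  rewrite -[RHS]sr -!nm_sqC !inner_comb// rmorph_sum; apply: eq_bigr => p _.
  rewrite rmorph_sum; apply: eq_bigr => q _.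
  by rewrite !rmorphM /= sc; congr (_ * _); rewrite rmorph_nat.
- move=> x r r0; have [l lP] := basis_dense x r0.
  by exists (combination e idfun l), (combination g s l); split=> //; exists l.
exists f; split=> // i; apply: f2; exists [:: (1, i)].
by rewrite /combination !big_seq1 /= rmorph1 !scale1r.
Qed.

Lemma op_eq_basis (S T : B) : (forall i, S (e i) = T (e i)) -> S = T.
Proof.
move=> h; have z : adjoint S - adjoint T = 0.
  apply: bounded_op_ext => x; rewrite op0E; apply: orth_basis_eq0 => i.
  by rewrite !opE inDl inNl -!adjEr h subrr.
by move/eqP: z; rewrite subr_eq0 => /eqP st; rewrite -[S]adjK st adjK.
Qed.

Lemma basis_isometry (g : I -> H) : (forall i j, '[g i, g j] = (i == j)%:R) ->
  exists S : B, adjoint S * S = 1 /\ forall i, S (e i) = g i.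
Proof.
move=> gg; have [||f [f1 f2 f3]] := @basis_map idfun g _ _ gg => //.
have fl : linear f by move=> a x y; rewrite f1.
have fb : exists M, forall x, nm (f x) <= M * nm x by exists 1 => x; rewrite mul1r f3.
exists (BoundedOp (nm_bounded fl fb)); split=> //.
by apply: form_eq => x; rewrite op1E opME -adjEr !nm_sqC /= f3.
Qed.

End OrthonormalBasis.

(** Multiplication by [P - Q] on both sides changes the sign of [P * X * Q] and [Q * X * P], which
    cancel in the sum. *)
Lemma corner_pinching (A : pzRingType) (P Q X : A) : P + Q = 1 ->
  X + (P - Q) * X * (P - Q) = (P * X * P + Q * X * Q) *+ 2.
Proof.
move=> PQ; have {1}-> : X = (P + Q) * X * (P + Q) by rewrite PQ mul1r mulr1.
have twice (x y : A) : x + y + (x - y) = x *+ 2 by rewrite addrACA subrr addr0 mulr2n.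
rewrite !(mulrDl, mulrDr, mulrN, mulNr) [P * X * Q + _]addrC addrACA opprB !twice.
by rewrite mulrnDl.
Qed.

(** * The swindle, with two isometries of complementary ranges *)

Section Swindle.
Variables (R : realType) (H : hilbertType R).
Local Notation C := R[i].
Local Notation B := (bounded_op H).
Implicit Types (x y z u v : H) (a b c : C) (X Y Z V : B).

Variables s t : B.
Hypotheses (ss : adjoint s * s = 1) (tt : adjoint t * t = 1) (st : adjoint s * t = 0).
Hypothesis sstt : s * adjoint s + t * adjoint t = 1.
Local Notation s' := (adjoint s).
Local Notation t' := (adjoint t).

Let ts : t' * s = 0. Proof. by rewrite -[LHS]adjK adjM adjK st adj0. Qed.
Let mss X : X * s' * s = X. Proof. by rewrite -mulrA ss mulr1. Qed.
Let mtt X : X * t' * t = X. Proof. by rewrite -mulrA tt mulr1. Qed.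
Let mst X : X * s' * t = 0. Proof. by rewrite -mulrA st mulr0. Qed.
Let mts X : X * t' * s = 0. Proof. by rewrite -mulrA ts mulr0. Qed.
Let msstt X Y : X * s * s' * Y + X * t * t' * Y = X * Y.
Proof. by rewrite -mulrDl -!mulrA -mulrDr sstt mulr1. Qed.
Let cuntzE := (mss, mtt, mst, mts, ss, tt, st, ts, mulr0, mul0r, addr0, add0r, mulr1, mul1r).

(* The diagonal operator [X + X + ...] on the decomposition of [H] into the ranges of [t^n s]. *)
Lemma infinite_amplification X : exists D : B, D = s * X * s' + t * D * t'.
Proof.
have [M M0 XM] := op_bound X.
have nms x : nm (s x) = nm x.
  by apply/eqP; rewrite -(@eqrXn2 _ 2) ?nm_ge0// !nm_sq adjE -opME ss op1E.
have nmt x : nm (t x) = nm x.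
  by apply/eqP; rewrite -(@eqrXn2 _ 2) ?nm_ge0// !nm_sq adjE -opME tt op1E.
have so x y : '[s x, t y] = 0 by rewrite adjE -opME st op0E in0r.
have nm_split x : nm x ^+ 2 = nm (s' x) ^+ 2 + nm (t' x) ^+ 2.
  have e : x = s (s' x) + t (t' x) by rewrite -[LHS]op1E -sstt !opE.
  by rewrite {1}e pythagoras ?nms ?nmt//.
pose D := fix D n x : H := if n is n.+1 then s (X (s' x)) + t (D n (t' x)) else 0.
(* The squared norm of the part of [x] in the range of [t^n], which [D n] ignores; being decreasing
   and nonnegative, it makes the partial sums Cauchy. *)
pose r n x := nm (iter n t' x) ^+ 2.
have rS n x : r n.+1 x = r n (t' x) by rewrite /r iterSr.
have Dsq n x : nm (D n x) ^+ 2 <= M ^+ 2 * (nm x ^+ 2 - r n x).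
  elim: n x => [|n IH] x; first by rewrite /r /= nm0 expr0n subrr mulr0.
  rewrite rS /= pythagoras//.
  rewrite nms nmt (nm_split x) -addrA mulrDr lerD ?IH//.
  by rewrite -exprMn ler_sqr ?nnegrE ?mulr_ge0 ?nm_ge0 ?(ltW M0).
have Ddiff n m x : nm (D (m + n)%N x - D n x) ^+ 2 <= M ^+ 2 * (r n x - r (m + n)%N x).
  elim: n x => [|n IH] x; first by rewrite addn0 subr0 Dsq.
  by rewrite addnS !rS /= opprD addrACA subrr add0r -mapB nmt IH.
have r_dec n m x : (n <= m)%N -> r m x <= r n x.
  move=> nm_; rewrite -subr_ge0 -(pmulr_rge0 _ (exprn_gt0 2 M0)).
  by rewrite -(subnK nm_); apply: le_trans (Ddiff _ _ _); rewrite sqr_ge0.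
have lim x : exists l, forall e : R, 0 < e -> exists N, forall n, (N <= n)%N -> nm (D n x - l) <= e.
  apply: (hilbert_complete (s := fun n => D n x)) => e e0.
  have hinf : has_inf (range (r ^~ x)).
    by split; [exists (r 0%N x), 0%N|exists 0 => _ [n _ <-]; exact: sqr_ge0].
  have e1 : 0 < e ^+ 2 / M ^+ 2 by rewrite divr_gt0 ?exprn_gt0.
  have [_ [N _ <-] h] := inf_adherent e1 hinf.
  have lb n : inf (range (r ^~ x)) <= r n x by apply: ge_inf; [exact: hinf.2|exists n].
  have key n m : (N <= n)%N -> (n <= m)%N -> nm (D m x - D n x) <= e.
    move=> Nn nm_; rewrite -ler_sqr ?nnegrE ?nm_ge0 ?(ltW e0)// -(subnK nm_).
    apply: (le_trans (Ddiff _ _ _)); rewrite mulrC -ler_pdivlMr ?exprn_gt0// subnK//.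
    have := r_dec _ _ x Nn; have := lb m; move: h.
    set q := e ^+ 2 / M ^+ 2; lra.
  exists N => n m Nn Nm; have [nm_|mn] := leqP n m; first by rewrite nmBC key.
  by rewrite key// ltnW.
have [Df Df_lim] := choice lim.
have D_lin n a x y : D n (a *: x + y) = a *: D n x + D n y.
  elim: n x y => [|n IH] x y /=; first by rewrite scaler0 addr0.
  by rewrite !(mapD, mapZ) IH !(mapD, mapZ) scalerDr addrACA.
have uniq_lim x l :
    (forall e : R, 0 < e -> exists N, forall n, (N <= n)%N -> nm (D n x - l) <= e) -> Df x = l.
  move=> h; apply/eqP; rewrite -subr_eq0; apply/eqP/nm_eps0 => e e0.
  have e20 : 0 < e / 2 by rewrite divr_gt0.
  have [N1 h1] := h _ e20; have [N2 h2] := Df_lim x _ e20.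
  have := nmD (Df x - D (maxn N1 N2) x) (D (maxn N1 N2) x - l); rewrite addrA subrK.
  rewrite (nmBC (Df x) (D _ x)); have := h1 _ (leq_maxl N1 N2); have := h2 _ (leq_maxr N1 N2); lra.
have Df_lin : linear Df.
  move=> a x y; apply: uniq_lim => e e0.
  have n0 : 0 < normc a + 1 by rewrite ltr_wpDl ?normc_ge0.
  have e10 : 0 < e / (normc a + 1) by rewrite divr_gt0.
  have e1e : normc a * (e / (normc a + 1)) + e / (normc a + 1) = e by field; rewrite gt_eqF.
  have [N1 h1] := Df_lim x _ e10; have [N2 h2] := Df_lim y _ e10.
  exists (maxn N1 N2) => n; rewrite geq_max => /andP[/h1 g1 /h2 g2].
  rewrite D_lin opprD addrACA -scalerBr (le_trans (nmD _ _))// nmZ -e1e lerD//.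
  by rewrite ler_wpM2l ?normc_ge0.
have Df_bd : exists M, forall x, nm (Df x) <= M * nm x.
  exists M => x; apply: (@eps_le _ _ _ 1) => e e0.
  have [N /(_ N (leqnn _)) h] := Df_lim x e e0.
  have := nmD (Df x - D N x) (D N x); rewrite subrK (nmBC (Df x)).
  have : nm (D N x) <= M * nm x.
    rewrite -ler_sqr ?nnegrE ?mulr_ge0 ?nm_ge0 ?(ltW M0)// exprMn.
    by rewrite (le_trans (Dsq _ _))// ler_wpM2l ?sqr_ge0// gerBl sqr_ge0.
  by move: h; lra.
exists (BoundedOp (nm_bounded Df_lin Df_bd)); apply: bounded_op_ext => x.
rewrite !opE /=; apply: uniq_lim => e e0.
have [N h] := Df_lim (t' x) e e0.
exists N.+1 => -[//|n] /h hn /=.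
by rewrite opprD addrACA subrr add0r -mapB nmt.
Qed.

(* Eilenberg swindle: the amplification [D] of [X] is unitarily similar to [X + D]. *)
Lemma invariant_functional_eq0 (f : B -> C) : scalar f ->
  (forall V X, unitary V -> f (conjugate V X) = f X) -> forall X, f X = 0.
Proof.
move=> fl finv.
have fD X Y : f (X + Y) = f X + f Y by exact: (GRing.semilinear_linear fl).2.
(* This unitary exchanges the two copies of [H]. *)
have a1 : adjoint (s * t' + t * s') = s * t' + t * s' by rewrite adjD !adjM !adjK addrC.
have u1 : unitary (s * t' + t * s').
  by split; rewrite a1 !(mulrDl, mulrDr) !mulrA !cuntzE.
pose g X := f (s * X * s').
have gt_ X : f (t * X * t') = g X.
  rewrite /g -(finv _ (s * X * s') u1); congr f.
  by rewrite /conjugate a1 !(mulrDl, mulrDr) !mulrA !cuntzE.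
(* This unitary carries the ranges of [s * s], [s * t] and [t] to those of [s], [t * s] and [t * t]:
   it rebrackets a sum of three copies of [H]. *)
have a2 : adjoint (s * s' * s' + t * s * t' * s' + t * t * t') =
   s * s * s' + s * t * s' * t' + t * t' * t'.
  by rewrite !adjD !adjM !adjK !mulrA.
have u2 : unitary (s * s' * s' + t * s * t' * s' + t * t * t').
  split; rewrite a2 !(mulrDl, mulrDr) !mulrA !cuntzE.
    by rewrite -addrA msstt sstt.
  by rewrite msstt sstt.
have g0 X : g X = 0.
  have [D DE] := infinite_amplification X.
  have e1 : g D = g X + g (s * D * s').
    rewrite -(gt_ (s * D * s')) -fD {1}/g {1}DE -(finv _ _ u2); congr f.
    by rewrite /conjugate a2 !(mulrDl, mulrDr) !mulrA !cuntzE.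
  have e2 : g (s * D * s') = g D.
    rewrite /g -(finv _ (s * (s * D * s') * s') u2); congr f.
    by rewrite /conjugate a2 !(mulrDl, mulrDr) !mulrA !cuntzE.
  by move: e1; rewrite e2 => /eqP; rewrite -subr_eq0 opprD addrCA subrr addr0 oppr_eq0 => /eqP.
move=> X.
(* Adding to [X] its conjugate by this symmetry leaves only diagonal blocks, on which [f] vanishes
   by [g0]. *)
have a3 : adjoint (s * s' - t * t') = s * s' - t * t' by rewrite adjD adjN !adjM !adjK.
have u3 : unitary (s * s' - t * t').
  by split; rewrite a3 !(mulrDl, mulrDr, mulrN, mulNr, opprK) !mulrA !cuntzE ?oppr0 ?addr0 ?add0r.
have e : X + conjugate (s * s' - t * t') X = (s * (s' * X * s) * s' + t * (t' * X * t) * t') *+ 2.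
  by rewrite /conjugate a3 (corner_pinching X sstt) !mulrA.
have : f (X + conjugate (s * s' - t * t') X) = 0.
  by rewrite e mulr2n fD fD gt_ -/(g _) !g0 addr0 addr0.
by rewrite fD finv// -mulr2n => /eqP; rewrite mulrn_eq0 /= => /eqP.
Qed.
End Swindle.

(** * Isometries from the basis, and transposition *)

Section Transpose.
Variables (R : realType) (H : hilbertType R) (I : choiceType) (e : I -> H).
Hypothesis e_basis : orthonormal_basis e.
Local Notation C := R[i].
Local Notation B := (bounded_op H).
Implicit Types (x y z u v : H) (a b c : C) (X Y Z V : B).

(** A finite basis would leave a unit vector orthogonal to it. So the index set is infinite, and the
    basis can be mapped onto each of two complementary halves of itself. *)
Lemma cuntz_pair : infinite_dimensional H -> exists s t : B,
  [/\ adjoint s * s = 1, adjoint t * t = 1, adjoint s * t = 0 &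
      s * adjoint s + t * adjoint t = 1].
Proof.
move=> H_infinite; have [ee _] := e_basis.
have I_infinite : infinite_set [set: I].
  move=> /finite_seqP[l lE]; have [z z1 zP] := exists_ortho H_infinite [seq e i | i <- l].
  have : z = 0.
    apply: (orth_basis_eq0 e_basis) => i; apply: zP; apply: map_f.
    by have : [set: I] i by []; rewrite lE.
  by move=> z0; move: z1; rewrite z0 nm0 => /eqP; rewrite eq_sym oner_eq0.
have [f [g [finj ginj fg cover]]] := infinite_split I_infinite.
have [s [ss se]] : exists S : B, adjoint S * S = 1 /\ forall i, S (e i) = e (f i).
  by apply: (basis_isometry e_basis) => i j; rewrite ee (inj_eq finj).
have [t [tt te]] : exists S : B, adjoint S * S = 1 /\ forall i, S (e i) = e (g i).
  by apply: (basis_isometry e_basis) => i j; rewrite ee (inj_eq ginj).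
have st : adjoint s * t = 0.
  apply: (op_eq_basis e_basis) => i; apply: (orth_basis_eq0 e_basis) => j.
  rewrite opME te -adjEr se ee.
  by case: eqP => // /esym /fg.
have ts : adjoint t * s = 0 by rewrite -[LHS]adjK adjM adjK st adj0.
exists s, t; split=> //; apply: (op_eq_basis e_basis) => i.
have [[j ->]|[j ->]] := cover i.
  rewrite -se -!opME mulrDl -!mulrA ss ts mulr0 addr0 mulr1.
  by [].
by rewrite -te -!opME mulrDl -!mulrA tt st mulr0 add0r mulr1.
Qed.

Lemma basis_conjugation : exists J : H -> H,
  [/\ forall a x y, J (a *: x + y) = Num.conj a *: J x + J y, forall i, J (e i) = e i,
      forall x, J (J x) = x & forall x y, '[J x, J y] = '[y, x]].
Proof.
have [ee _] := e_basis.
have [||J [J1 J2 J3]] := @basis_map _ _ _ _ e_basis Num.conj e _ _ ee.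
- by move=> a.
- by move=> a; exact: conjc_real.
have {}J1 a x y : J (a *: x + y) = Num.conj a *: J x + J y by exact: J1.
have JD x y : J (x + y) = J x + J y by rewrite -[x in LHS]scale1r J1 rmorph1 scale1r.
have J0 : J 0 = 0 by apply: (addrI (J 0)); rewrite -JD !addr0.
have JZ a x : J (a *: x) = Num.conj a *: J x by rewrite -[a *: x]addr0 J1 J0 addr0.
(* Norms determine real parts. Imaginary parts follow at [ii *: x], where conjugate-linearity
   reverses the sign; hence the exchange of arguments in ['[y, x]]. *)
have Re_in x y : complex.Re '[J x, J y] = complex.Re '[x, y].
  have := J3 (x + y); move=> /(congr1 (fun r => r ^+ 2)); rewrite JD !nmD_sq !J3.
  by move=> /addrI/eqP; rewrite eqrMn2r /= => /eqP.
exists J; split=> //.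
  move=> x.
  have jl : linear (J \o J) by move=> a u v; rewrite /= J1 J1 conjCK.
  have jb : exists M, forall u, nm ((J \o J) u) <= M * nm u by exists 1 => u; rewrite mul1r /= !J3.
  have : BoundedOp (nm_bounded jl jb) = 1.
    by apply: (op_eq_basis e_basis) => i; rewrite /= !J2.
  by move=> /(congr1 (fun T : B => T x)).
move=> x y; have := Re_in (ii *: x) y; rewrite JZ ii_conj !inZl !ReM /=.
rewrite oppr0 !mul0r mulN1r mul1r !sub0r opprK => Im_in.
by rewrite (inC x y) [LHS]RImE [RHS]RImE ReC ImC Re_in Im_in.
Qed.

Variable J : H -> H.
Hypotheses (J_conj : forall a x y, J (a *: x + y) = Num.conj a *: J x + J y)
  (Je : forall i, J (e i) = e i) (JK : forall x, J (J x) = x)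
  (J_in : forall x y, '[J x, J y] = '[y, x]).

Let J_inl x y : '[J x, y] = '[J y, x].
Proof. by rewrite -{1}(JK y) J_in. Qed.

(** The transpose is the adjoint conjugated by the antiunitary involution [J] that fixes the
    basis. *)
Lemma transpose_subproof X : (fun h => J (adjoint X (J h))) \in @is_bounded_linear R H.
Proof.
have Jnm x : nm (J x) = nm x by apply/eqP; rewrite -(@eqrXn2 _ 2) ?nm_ge0// !nm_sq J_in.
apply: nm_bounded => [a x y|]; first by rewrite J_conj mapD mapZ J_conj conjCK.
have [M _ XM] := op_bound (adjoint X); exists M => x.
by rewrite Jnm -(Jnm x).
Qed.
Definition transposed X : B := BoundedOp (transpose_subproof X).

Lemma transposedE X x y : '[transposed X x, y] = '[X (J y), J x].
Proof. by rewrite J_inl -adjE. Qed.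

Lemma transpose_opE X : transpose_op e X = transposed X.
Proof.
rewrite /transpose_op; case: xgetP => [Y _ YP|h]; last first.
  by case: (h (transposed X)) => i j; rewrite transposedE !Je.
apply: (op_eq_basis e_basis) => j; apply/eqP; rewrite -subr_eq0; apply/eqP.
apply: (orth_basis_eq0 e_basis) => i.
by rewrite inBl YP transposedE !Je subrr.
Qed.

Lemma transposed_linear : linear transposed.
Proof.
by move=> a X Y; apply: op_eq => x y; rewrite !opE inDl inZl !transposedE !opE inDl inZl.
Qed.
Lemma transposedM X Y : transposed (X * Y) = transposed Y * transposed X.
Proof. by apply: bounded_op_ext => x; rewrite opME /= JK adjM. Qed.
Lemma transposed_adj X : transposed (adjoint X) = adjoint (transposed X).
Proof.
apply/esym/adj_uniq => x y; rewrite transposedE [RHS]inC transposedE -inC adjEr adjK.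
by [].
Qed.
Lemma transposed1 : transposed 1 = 1.
Proof. by apply: op_eq => x y; rewrite transposedE !op1E J_in. Qed.
Lemma transposedK : involutive transposed.
Proof. by move=> X; apply: op_eq => x y; rewrite !transposedE !JK. Qed.
Lemma transposed_dyad x y : transposed (dyad x y) = dyad (J y) (J x).
Proof.
apply: op_eq => u v; rewrite transposedE !dyadE !inZl mulrC J_inl; congr (_ * _).
by rewrite -{1}(JK x) J_in.
Qed.
Lemma transposed_unitary V : unitary V -> unitary (transposed V).
Proof. by move=> [h1 h2]; split; rewrite -transposed_adj -transposedM ?h1 ?h2 transposed1. Qed.
Lemma transposed_conjugate V X :
  transposed (conjugate V X) = conjugate (transposed (adjoint V)) (transposed X).
Proof. by rewrite /conjugate !transposedM transposed_adj adjK mulrA. Qed.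

End Transpose.

(** * Assembling the three conditions *)

Section Classification.
Variables (R : realType) (H : hilbertType R).
Hypothesis H_infinite : infinite_dimensional H.
Variables (I : choiceType) (e : I -> H).
Hypothesis e_basis : orthonormal_basis e.
Local Notation C := R[i].
Local Notation B := (bounded_op H).
Local Notation w := (@numerical_radius R H).

Lemma common_range_conjugate (Phi Psi : B -> B) (x a : H) : linear Phi -> linear Psi ->
  cancel Phi Psi -> cancel Psi Phi ->
  (forall V T, unitary V -> w (Phi (conjugate V T)) = w (Phi T)) ->
  nm x = 1 -> nm a = 1 ->
  (forall y, '[x, y] = 0 -> exists b : H, Phi (dyad x y) = dyad a b) ->
  exists (U : B) (c : C), [/\ unitary U, c != 0 & forall X, Phi X = c *: (U * X * adjoint U)].
Proof.
move=> Pl Pl' PK PK' Pinv x1 a1 hc.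
have [U [l [f [uU l0 fP]]]] := common_range_form H_infinite Pl Pl' PK PK' Pinv x1 a1 hc.
have [fl finv] := invariant_functional H_infinite Pl Pl' PK Pinv uU l0 fP.
have [s [t [ss tt st sstt]]] := cuntz_pair e_basis H_infinite.
exists U, l; split=> // X.
by rewrite fP (invariant_functional_eq0 ss tt st sstt fl finv) scale0r addr0 conjugateZ.
Qed.

(** If the images of xy* share the corange [b], then those of yx*, being multiples of their
    adjoints, share the range [b]. The transpose of (J x) y* is (J y) x*, so [Phi \o tr] is in the
    common range case. *)
Lemma invariant_classification (Phi Psi : B -> B) : linear Phi -> linear Psi ->
  cancel Phi Psi -> cancel Psi Phi ->
  (forall V T, unitary V -> w (Phi (conjugate V T)) = w (Phi T)) ->
  exists (W : B) (c : C), [/\ unitary W, c != 0 &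
    (forall X, Phi X = c *: (W * X * adjoint W)) \/
    (forall X, Phi X = c *: (W * transpose_op e X * adjoint W))].
Proof.
move=> Pl Pl' PK PK' Pinv.
have [x x1] := exists_unit H_infinite.
have [[a a1 aP]|[b b1 bP]] := common_range_or_corange H_infinite Pl Pl' PK PK' Pinv x1.
  have [U [c [uU c0 UP]]] := common_range_conjugate Pl Pl' PK PK' Pinv x1 a1 aP.
  by exists U, c; split=> //; left.
have [J [J1 J2 JK J_in]] := basis_conjugation e_basis.
pose tr := transposed J1 J_in.
have trK : involutive tr by exact: transposedK.
have trl : linear tr by exact: transposed_linear.
have tinv V T : unitary V -> w (Phi (tr (conjugate V T))) = w (Phi (tr T)).
  move=> uV; rewrite /tr transposed_conjugate// Pinv//.
  by apply: transposed_unitary => //; exact: unitary_adj.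
have Jx1 : nm (J x) = 1 by apply: nm1P; rewrite J_in nm1_in.
have PD Y Z : Phi (Y + Z) = Phi Y + Phi Z by exact: (GRing.semilinear_linear Pl).2.
have P0 : Phi 0 = 0 by apply: (addrI (Phi 0)); rewrite -PD !addr0.
have PZ a X : Phi (a *: X) = a *: Phi X by exact: GRing.scalable_linear.
have [r rP] := image_dyad_adjoint H_infinite Pl Pl' PK PK' Pinv.
have r0 : r != 0.
  have [y y1 yP] := exists_ortho H_infinite [:: x].
  have xy : '[x, y] = 0 by apply: orthC; apply: yP; rewrite inE.
  have [p [q [e1 p0 q0 _]]] := image_dyad_rank1 H_infinite Pl Pl' PK PK' Pinv x1 y1 xy.
  apply/eqP => r0; have := rP _ _ x1 y1 xy; rewrite r0 scale0r e1 adj_dyad.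
  by move=> /dyad_eq0[] h; [rewrite h eqxx in q0|rewrite h eqxx in p0].
have adj_gen v : '[x, v] = 0 -> adjoint (Phi (dyad x v)) = r *: Phi (dyad v x).
  have [->|v0] := eqVneq v 0.
    by rewrite dyad0r dyad0l P0 adj0 scaler0.
  have [y y1 ->] := normalize v0; have nv : (nm v)%:C != 0 :> C by rewrite fmorph_eq0 nm_eq0.
  move=> /(orthZr nv) xy; rewrite dyadZr dyadZl !PZ adjZ conjCK rP//.
  by rewrite !scalerA mulrC.
have [||||||||U [c [uU c0 UP]]] := @common_range_conjugate (Phi \o tr) (tr \o Psi) (J x) b.
- by move=> a X Y; rewrite /= trl Pl.
- by move=> a X Y; rewrite /= Pl' trl.
- by move=> X; rewrite /= PK trK.
- by move=> X; rewrite /= trK PK'.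
- exact: tinv.
- exact: Jx1.
- exact: b1.
- move=> y xy; rewrite /= /tr transposed_dyad// JK.
  have xJy : '[x, J y] = 0 by rewrite -{1}(JK x) J_in; apply: orthC.
  have [p pE] := bP _ xJy; have := adj_gen _ xJy; rewrite pE adj_dyad => h.
  exists (Num.conj r^-1 *: p); rewrite dyadZr conjCK h scalerA mulVf ?scale1r//.
exists U, c; split=> //; right => X.
by rewrite (transpose_opE e_basis J1 J2 JK J_in) -(UP (tr X)) /= trK.
Qed.

Lemma similar_numerical_radius (T S : B) : unitarily_similar T S -> w T = w S.
Proof. by move=> [W uW ->]; exact: numerical_radius_unitary. Qed.


Lemma transposed_similar (T S : B) : unitarily_similar T S ->
  unitarily_similar (transpose_op e T) (transpose_op e S).
Proof.
have [J [J1 J2 JK J_in]] := basis_conjugation e_basis.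
move=> [V uV ->]; rewrite !(transpose_opE e_basis J1 J2 JK J_in).
exists (transposed J1 J_in (adjoint V)).
  by apply: transposed_unitary => //; exact: unitary_adj.
exact: transposed_conjugate.
Qed.

Lemma conjugate_similar (W T S : B) (c : C) : unitary W -> unitarily_similar T S ->
  unitarily_similar (c *: (W * T * adjoint W)) (c *: (W * S * adjoint W)).
Proof.
move=> uW [V uV ->]; exists (W * V * adjoint W).
  by apply: unitary_mul; [exact: unitary_mul|exact: unitary_adj].
rewrite opZMr opZMl; congr (_ *: _); rewrite !adjM adjK !mulrA.
case: uW => _ WW; rewrite -[W * V * adjoint W * W]mulrA WW mulr1.
by rewrite -[_ * adjoint W * W]mulrA WW mulr1.
Qed.

End Classification.

Theorem theorem2p4 (R : realType) (H : hilbertType R)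
    (H_infinite : infinite_dimensional H)
    (I : choiceType) (e : I -> H) (e_basis : orthonormal_basis e)
    (Phi : {linear bounded_op H -> bounded_op H}) (Phi_bij : bijective Phi) :
  [<-> forall T S : bounded_op H,
         unitarily_similar T S -> unitarily_similar (Phi T) (Phi S);
       forall T S : bounded_op H,
         unitarily_similar T S ->
         numerical_radius (Phi T) = numerical_radius (Phi S);
       exists (W : bounded_op H) (c : R[i]),
         [/\ unitary W, c != 0
           & (forall X : bounded_op H, Phi X = c *: (W * X * adjoint W)) \/
             (forall X : bounded_op H, Phi X = c *: (W * transpose_op e X * adjoint W))]].
Proof.
tfae.
- by move=> h T S /h; exact: similar_numerical_radius.
- move=> h; have [Psi PK PK'] := Phi_bij.
  apply: (invariant_classification H_infinite e_basis _ _ PK PK').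
  + exact: linearP.
  + by move=> a X Y; apply: (can_inj PK); rewrite linearP !PK'.
  + by move=> V T uV; apply: h; exists V.
- move=> [W [c [uW c0 [hP|hP]]]] T S TS; rewrite !hP; apply: conjugate_similar => //.
  exact: transposed_similar.
Qed.
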